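(* Let $a>0$, $a\neq1$, $n\ge2$, $0<s<a/2$, and $r=2s/(a-2s)$. Let $(t_m)_{m\ge1}$ be a sequence with $1>t_1>t_2>\dots>0$, $\lim_{m\to\infty}t_m=0$, and $(t_m)\in l^{r,\infty}$. Then for every $f\in H_s(\mathbb{R}^n)$, $$\lim_{m\to\infty}S_{t_m}f(x)=f(x)\quad\text{for almost every }x\in\mathbb{R}^n.$$
   Context: The Fourier transform is $\hat f(\xi)=\int_{\mathbb{R}^n}e^{-i\xi\cdot x}f(x)\,dx$ (extended to $L^2$ as usual). For $f\in L^2(\mathbb{R}^n)$ and $t\ge0$, $S_tf(x)=(2\pi)^{-n}\int_{\mathbb{R}^n}e^{i\xi\cdot x}e^{it|\xi|^a}\hat f(\xi)\,d\xi$. $H_s(\mathbb{R}^n)$ is the space of tempered distributions $f$ with $\|f\|_{H_s}=\big(\int_{\mathbb{R}^n}(1+|\xi|^2)^s|\hat f(\xi)|^2\,d\xi\big)^{1/2}<\infty$. For $r>0$, $(t_m)\in l^{r,\infty}$ means that there is a constant $C$ with $\#\{m:t_m>b\}\le Cb^{-r}$ for all $b>0$. *)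

(* Defs.v *)
From HB Require Import structures.
From mathcomp Require Import all_boot all_order all_algebra.
From mathcomp Require Import all_classical all_reals all_analysis.
From mathcomp Require Import complex.
Set Implicit Arguments.
Unset Strict Implicit.
Unset Printing Implicit Defensive.

Import Order.TTheory GRing.Theory Num.Theory numFieldNormedType.Exports.

Local Open Scope classical_set_scope.
Local Open Scope complex_scope.
Local Open Scope ring_scope.


Section lebesgue_Rn.
Local Open Scope ereal_scope.
Context (R : realType).

Definition Rn_cons (n : nat) (z : R * n.-tuple R) : n.+1.-tuple R :=
  [tuple of z.1 :: z.2].

(* R ^ n is n.-tuple R with the product sigma-algebra; Lebesgue measure is the
   n-fold product measure, transported along R * R ^ n ~ R ^ n.+1. *)
Fixpoint lebesgue_Rn (n : nat) : set (n.-tuple R) -> \bar R :=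
  match n with
  | 0 => dirac ([tuple] : 0.-tuple R)
  | n'.+1 => pushforward (lebesgue_measure \x @lebesgue_Rn n') (@Rn_cons n')
  end.

Lemma measurable_Rn_cons n : measurable_fun setT (@Rn_cons n).
Proof. by apply: measurable_cons. Qed.

Let sigma_finite_pushforward n
    (m : {sigma_finite_measure set (n.-tuple R) -> \bar R}) :
  sigma_finite setT (pushforward (lebesgue_measure \x m) (@Rn_cons n)).
Proof.
have /sigma_finiteP[F [TF ndF Foo]] := sigma_finiteT (@lebesgue_measure R).
have /sigma_finiteP[G [TG ndG Goo]] := sigma_finiteT m.
pose behd (x : n.+1.-tuple R) : n.-tuple R := [tuple of behead x].
have Fhd k : measurable [set x : n.+1.-tuple R | F k (thead x)].
  rewrite -[X in measurable X]setTI; apply: (@measurable_tnth _ R n.+1 ord0) => //.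
  by have [] := Foo k.
have Gtl k : measurable (behd @^-1` G k).
  rewrite -[X in measurable X]setTI; apply: measurable_behead => //.
  by have [] := Goo k.
exists (fun k => [set x | F k (thead x)] `&` behd @^-1` G k).
  apply/esym; rewrite -subTset => x _.
  have [i _ Fi] : (\bigcup_k F k) (thead x) by rewrite -TF.
  have [j _ Gj] : (\bigcup_k G k) (behd x) by rewrite -TG.
  exists (maxn i j) => //; split => /=.
    by move: (thead x) Fi; exact/subsetPset/ndF/leq_maxl.
  by move: (behd x) Gj; exact/subsetPset/ndG/leq_maxr.
move=> k; have [mF Fk] := Foo k; have [mG Gk] := Goo k.
split; first exact: measurableI.
rewrite /pushforward (_ : _ @^-1` _ = F k `*` G k).
  by rewrite product_measure1E// lte_mul_pinfty// ge0_fin_numE.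
have behdK (z : R * n.-tuple R) : behd (Rn_cons z) = z.2 by exact: val_inj.
by apply/seteqP; split => z /=; rewrite behdK.
Qed.

Let lebesgue_RnS_measure n
    (m : {sigma_finite_measure set (n.-tuple R) -> \bar R}) :
  exists m' : {sigma_finite_measure set (n.+1.-tuple R) -> \bar R},
    m' = pushforward (lebesgue_measure \x m) (@Rn_cons n) :> (set _ -> _).
Proof.
have [nu nuE] : exists nu,
    nu = pushforward (lebesgue_measure \x m) (@Rn_cons n).
  by eexists.
rewrite -nuE.
have nusf : sigma_finite setT nu.
  by rewrite nuE; exact: sigma_finite_pushforward.
have [mu muE] : exists mu : {measure set (n.+1.-tuple R) -> \bar R},
    mu = nu :> (set _ -> _).
  rewrite nuE.
  by exists (measure_function_pushforward__canonical__measure_function_Measure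
    (lebesgue_measure \x m) (@measurable_Rn_cons n)).
have nu0 : nu set0 = 0 by rewrite -muE.
have nu_ge0 A : 0 <= nu A by rewrite -muE.
have nuD : semi_sigma_additive nu.
  by rewrite -muE; exact: measure_semi_sigma_additive.
pose nuM := isMeasure.Build _ _ _ nu nu0 nu_ge0 nuD.
pose nu' : {measure set (n.+1.-tuple R) -> \bar R} := HB.pack nu nuM.
pose nuS := Measure_isSigmaFinite.Build _ _ _ nu' nusf.
by exists (HB.pack nu nuM nuS :
  {sigma_finite_measure set (n.+1.-tuple R) -> \bar R}).
Qed.

Lemma lebesgue_Rn_measure n :
  exists m : {sigma_finite_measure set (n.-tuple R) -> \bar R},
    m = @lebesgue_Rn n :> (set _ -> _).
Proof.
elim: n => [|n [m mE]]; first by exists (dirac ([tuple] : 0.-tuple R)).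
by have [m' m'E] := lebesgue_RnS_measure m; exists m'; rewrite m'E mE.
Qed.

Let lebesgue_Rn0 n : @lebesgue_Rn n set0 = 0.
Proof. by have [m <-] := lebesgue_Rn_measure n; exact: measure0. Qed.

Let lebesgue_Rn_ge0 n A : 0 <= @lebesgue_Rn n A.
Proof. by have [m <-] := lebesgue_Rn_measure n; exact: measure_ge0. Qed.

Let lebesgue_Rn_semi_sigma_additive n : semi_sigma_additive (@lebesgue_Rn n).
Proof.
by have [m <-] := lebesgue_Rn_measure n; exact: measure_semi_sigma_additive.
Qed.

Let lebesgue_Rn_sigma_finite n : sigma_finite setT (@lebesgue_Rn n).
Proof. by have [m <-] := lebesgue_Rn_measure n; exact: sigma_finiteT. Qed.

HB.instance Definition _ n := isMeasure.Build _ _ _ (@lebesgue_Rn n)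
  (lebesgue_Rn0 n) (@lebesgue_Rn_ge0 n) (@lebesgue_Rn_semi_sigma_additive n).

HB.instance Definition _ n := Measure_isSigmaFinite.Build _ _ _ (@lebesgue_Rn n)
  (@lebesgue_Rn_sigma_finite n).

Lemma lebesgue_Rn_box n (A : 'I_n -> set R) : (forall i, measurable (A i)) ->
  lebesgue_Rn [set x : n.-tuple R | forall i, A i (tnth x i)] =
  \prod_(i < n) lebesgue_measure (A i).
Proof.
elim: n A => [|n IH] A mA.
  rewrite big_ord0 /= diracE mem_set//.
  by case.
rewrite big_ord_recl -IH; last by move=> i; exact: mA.
rewrite /= /pushforward.
pose B := [set y : n.-tuple R | forall i, A (lift ord0 i) (tnth y i)].
have mB : measurable B.
  rewrite (_ : B = \bigcap_(i in [set: 'I_n])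
      ((fun y => tnth y i) @^-1` A (lift ord0 i))).
    apply: fin_bigcap_measurable => // i _; rewrite -[X in measurable X]setTI.
    by apply: measurable_tnth => //; exact: mA.
  by apply/seteqP; split => [y By i _|y By i]; [exact: By|exact: (By i I)].
rewrite (_ : _ @^-1` _ = A ord0 `*` B); first by apply: product_measure1E => //; exact: mA.
apply/seteqP; split => -[a b] /=.
  move=> h; split; first exact: (h ord0).
  by move=> i; have := h (lift ord0 i); rewrite tnthS.
move=> [h0 h] i; case: (unliftP ord0 i) => [j ->|->//].
by rewrite tnthS.
Qed.

End lebesgue_Rn.

Section fourier.
Context (R : realType) (n : nat).
Local Notation Rn := (n.-tuple R).
Local Notation mu := (@lebesgue_Rn R n).
Implicit Types (f g : Rn -> R[i]) (x xi : Rn).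

Definition dot x xi : R := \sum_(i < n) tnth x i * tnth xi i.

Definition enorm x : R := Num.sqrt (dot x x).

Definition expi (t : R) : R[i] := cos t +i* sin t.

Definition cmeasurable f : Prop :=
  measurable_fun setT (fun x => complex.Re (f x)) /\
  measurable_fun setT (fun x => complex.Im (f x)).

Definition cintegral f : R[i] :=
  (\int[mu]_x complex.Re (f x)) +i* (\int[mu]_x complex.Im (f x)).

Definition cLnorm (p : \bar R) f : \bar R :=
  'N[mu]_p[EFin \o (@Normc.normc R \o f)]%E.

Definition cLp (p : \bar R) : set (Rn -> R[i]) :=
  [set f | cmeasurable f /\ (cLnorm p f < +oo)%E].

Definition fourier_int f : Rn -> R[i] :=
  fun xi => cintegral (fun x => expi (- dot xi x) * f x).

Definition fourier_inv_int g : Rn -> R[i] :=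
  fun x => ((2 * pi) ^- n)%:C * cintegral (fun xi => expi (dot xi x) * g xi).

(* g represents the value at f of the extension to L^2 by continuity of the
   operator F given on L^1 `&` L^2. *)
Definition is_L2_extension (F : (Rn -> R[i]) -> Rn -> R[i]) f g : Prop :=
  cLp 2%:E g /\
  exists u : nat -> Rn -> R[i],
    [/\ forall k, (cLp 1%:E `&` cLp 2%:E) (u k),
        cLnorm 2%:E (fun x => u k x - f x) @[k --> \oo] --> 0%E &
        cLnorm 2%:E (fun x => F (u k) x - g x) @[k --> \oo] --> 0%E].

(* By Plancherel's theorem, for F one of fourier_int, fourier_inv_int and f in
   L^2 such a g exists and is unique up to a null set; an arbitrary
   representative is chosen, and the default value 0 is only used for f not in
   L^2. *)
Definition L2_extension (F : (Rn -> R[i]) -> Rn -> R[i]) f : Rn -> R[i] :=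
  xget (fun=> 0) [set g | is_L2_extension F f g].

Definition fourier : (Rn -> R[i]) -> Rn -> R[i] := L2_extension fourier_int.

Definition fourier_inv : (Rn -> R[i]) -> Rn -> R[i] :=
  L2_extension fourier_inv_int.

Definition schrodinger (a t : R) f : Rn -> R[i] :=
  fourier_inv (fun xi => expi (t * enorm xi `^ a) * fourier f xi).

Definition sobolev_norm (s : R) f : \bar R :=
  ((\int[mu]_xi
      ((1 + enorm xi ^+ 2) `^ s * Normc.normc (fourier f xi) ^+ 2)%:E)
   `^ 2^-1)%E.

(* For s >= 0 every tempered distribution of finite H_s norm is an L^2 function
   (its Fourier transform is in L^2), so H_s is given here as a set of L^2
   functions; this definition is not meant for s < 0. *)
Definition sobolev (s : R) : set (Rn -> R[i]) :=
  [set f | cLp 2%:E f /\ (sobolev_norm s f < +oo)%E].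

End fourier.

(* counting A is +oo when A is infinite, so the sets below are finite. *)
Definition weak_l (R : realType) (r : R) (t : nat -> R) : Prop :=
  exists C : R, forall b : R, 0 < b ->
    (counting [set m | (b < t m)%R] <= (C * b `^ (- r))%:E)%E.

(* Main.v *)
Require Import Defs.
From mathcomp Require Import all_boot all_order all_algebra.
From mathcomp Require Import all_classical all_reals all_analysis.
From mathcomp Require Import measurable_realfun complex.
From mathcomp Require Import ring lra zify.
Import Order.TTheory GRing.Theory Num.Theory numFieldNormedType.Exports.
Set Implicit Arguments.
Unset Strict Implicit.
Unset Printing Implicit Defensive.

(** The difference S_t f - S_t' f is the inverse Fourier transform of
   (e^(i t y) - e^(i t' y)) fhat with y = |xi|^a, so by Plancherel's inequality its squared L^2 norm
   is at most C times the integral of min(1, ((t - t') y)^2) |fhat|^2.  By the weak l^r hypothesis,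
   t_m < T_l := A 2^(-l/r) for 2^l <= m+1 < 2^(l+1).  Approximating t_m within 2^(-l) T_l by a dyadic
   multiple of T_l and walking from there to 0 along binary digits bounds |S_(t_m) f - S_0 f|^2 on the
   l-th block pointwise by a weighted sum of squared differences; each block has only 2^k differences
   at scale 2^(-k) T_l, and summing over the blocks costs the integral of |xi|^(2s) |fhat|^2, which is
   finite.  Hence the block sums tend to 0 almost everywhere, and S_0 f = f almost everywhere by
   Fourier inversion.

   The L^2 theory uses the Poisson kernel: Schur's test for the damped transform gives Plancherel's
   inequality, and inversion is proved by duality, integrating over boxes. *)

Local Open Scope classical_set_scope.
Local Open Scope complex_scope.
Local Open Scope ring_scope.

(** * Complex-valued integrals *)

Section normsq.
Context {R : realType}.
Implicit Types z w : R[i].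

(** The obstacle is the number of times. With y = |xi|^a, summing the squared L^2 norms of S_(t_m) f
    - f over a block costs 2^l min(1, (T_l y)^2), whose sum over l is at least of order y^r for
    large y; but y^r = |xi|^(ar) with ar > 2s is more than f in H_s controls. Chaining charges the
    full multiplicity 2^l to the finest steps only. With sigma = 2s/a one has 1/r = 1/sigma - 1, so
    the finest step is 2^(-l) T_l = A 2^(-l/sigma), and the sum over l of 2^l min(1, (2^(-l) T_l
    y)^2) is of order (A y)^sigma, that is |xi|^(2s). A scale coarser by j levels has 2^j times
    fewer differences, each 2^j times longer; its total is smaller by (2^sigma / 2)^j, and sigma < 1
    because s < a/2. This geometric gain pays for the weights that replace the triangle inequality
    along the chain: a weight q^(-j) with q^2 = 2^sigma / 2 still leaves the summable q^j. *)

Definition nsq z : R := complex.Re z ^+ 2 + complex.Im z ^+ 2.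

Lemma nsq_ge0 z : 0 <= nsq z.
Proof. by rewrite addr_ge0 ?sqr_ge0. Qed.

Lemma normcE2 z : Normc.normc z = Num.sqrt (nsq z).
Proof. by case: z. Qed.

Lemma normc_sqr z : Normc.normc z ^+ 2 = nsq z.
Proof. by rewrite normcE2 sqr_sqrtr ?nsq_ge0. Qed.

Lemma normc_ge0 z : 0 <= Normc.normc z.
Proof. by rewrite normcE2 sqrtr_ge0. Qed.

Lemma nsqM z w : nsq (z * w) = nsq z * nsq w.
Proof. by rewrite -!normc_sqr Normc.normcM exprMn. Qed.

Lemma nsq_conj z : nsq z^* = nsq z.
Proof. by case: z => a b; rewrite /nsq /= sqrrN. Qed.

Lemma normc_conj z : Normc.normc z^* = Normc.normc z.
Proof. by rewrite !normcE2 nsq_conj. Qed.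

Lemma nsqN z : nsq (- z) = nsq z.
Proof. by case: z => a b; rewrite /nsq /= !sqrrN. Qed.

Lemma nsqBC z w : nsq (z - w) = nsq (w - z).
Proof. by rewrite -nsqN opprB. Qed.

Lemma nsq0 : nsq 0 = 0.
Proof. by rewrite /nsq /= !expr0n addr0. Qed.

Lemma nsq_eq0 z : nsq z = 0 -> z = 0.
Proof.
case: z => a b /eqP; rewrite /nsq /= paddr_eq0 ?sqr_ge0// !sqrf_eq0.
by move=> /andP[/eqP-> /eqP->].
Qed.

(** Cauchy-Schwarz with weights [q] and [1 - q]: in each coordinate the two sides differ by a
    multiple of a square. When it is iterated, the free [q] keeps the growth of the constants
    geometric with ratio [q^-1]. *)
Lemma nsq_addle z w (q : R) : 0 < q -> q < 1 ->
  nsq (z + w) <= q^-1 * nsq z + (1 - q)^-1 * nsq w.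
Proof.
move=> q0 q1; case: z w => a b [c d]; rewrite /nsq /=.
have key (x y : R) : (x + y) ^+ 2 <= q^-1 * x ^+ 2 + (1 - q)^-1 * y ^+ 2.
  have q1' : 0 < 1 - q by rewrite subr_gt0.
  rewrite -subr_ge0.
  have -> : q^-1 * x ^+ 2 + (1 - q)^-1 * y ^+ 2 - (x + y) ^+ 2 =
      (q * (1 - q))^-1 * ((1 - q) * x - q * y) ^+ 2.
    by field; rewrite !gt_eqF.
  by rewrite mulr_ge0 ?sqr_ge0// invr_ge0 mulr_ge0// ltW.
rewrite (le_trans (lerD (key a c) (key b d)))//.
by rewrite !mulrDr addrACA.
Qed.

Lemma nsqD_le z w : nsq (z + w) <= 2 * nsq z + 2 * nsq w.
Proof.
have h : 0 < 2^-1 :> R by [].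
have := @nsq_addle z w 2^-1 h.
rewrite invf_lt1 ?ltr1n// => /(_ isT); rewrite invrK.
by rewrite (_ : (1 - 2^-1)^-1 = 2 :> R)//; field.
Qed.

Lemma nsqB_le z w : nsq (z - w) <= 2 * nsq z + 2 * nsq w.
Proof. by rewrite -(nsqN w) nsqD_le. Qed.

Lemma nsqB_tri z w v : nsq (z - v) <= 2 * nsq (z - w) + 2 * nsq (w - v).
Proof. by rewrite (_ : z - v = (z - w) + (w - v)) ?nsqD_le// subrKA. Qed.

Lemma Re_le_normc z : `|complex.Re z| <= Normc.normc z.
Proof. by rewrite normcE2 -sqrtr_sqr ler_wsqrtr// lerDl sqr_ge0. Qed.

Lemma Im_le_normc z : `|complex.Im z| <= Normc.normc z.
Proof. by rewrite normcE2 -sqrtr_sqr ler_wsqrtr// lerDr sqr_ge0. Qed.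

(** Half the square of |z - w| is nonnegative; this is the pointwise input to Schur's test. *)
Lemma Re_mulconj_le z w :
  complex.Re (z * w^*) <= 2^-1 * (nsq z + nsq w).
Proof.
case: z w => a b [c d]; rewrite /nsq /=.
rewrite -subr_ge0.
have -> : 2^-1 * (a ^+ 2 + b ^+ 2 + (c ^+ 2 + d ^+ 2)) - (a * c - b * - d) =
   2^-1 * ((a - c) ^+ 2 + (b - d) ^+ 2) by field.
by rewrite mulr_ge0// ?addr_ge0 ?sqr_ge0.
Qed.

Lemma conj_mul z w : (z * w)^* = z^* * w^*.
Proof. exact: rmorphM. Qed.

Lemma conj_real (x : R) : (x%:C)^* = x%:C.
Proof. by apply/eqP; rewrite eq_complex /= oppr0 !eqxx. Qed.

Lemma mulc_conj z : z * z^* = (nsq z)%:C.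
Proof.
by case: z => a b; apply/eqP; rewrite eq_complex /nsq /=; apply/andP; split; apply/eqP; ring.
Qed.

Lemma complex_ReB z w : complex.Re (z - w) = complex.Re z - complex.Re w.
Proof. by case: z w => a b []. Qed.
Lemma complex_ImB z w : complex.Im (z - w) = complex.Im z - complex.Im w.
Proof. by case: z w => a b []. Qed.
Lemma complex_ReM z w : complex.Re (z * w) =
  complex.Re z * complex.Re w - complex.Im z * complex.Im w.
Proof. by case: z w => a b []. Qed.
Lemma complex_ImM z w : complex.Im (z * w) =
  complex.Re z * complex.Im w + complex.Im z * complex.Re w.
Proof. by case: z w => a b []. Qed.

Lemma nsq_expi (t : R) : nsq (expi t) = 1.
Proof. by rewrite /nsq /= cos2Dsin2. Qed.

Lemma normc_expi (t : R) : Normc.normc (expi t) = 1.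
Proof. by rewrite normcE2 nsq_expi sqrtr1. Qed.

Lemma expiD (s t : R) : expi (s + t) = expi s * expi t.
Proof.
apply/eqP; rewrite eq_complex /= cosD sinD; apply/andP; split; apply/eqP; ring.
Qed.

Lemma expi0 : expi 0 = 1 :> R[i].
Proof. by rewrite /expi cos0 sin0. Qed.

Lemma expiN (t : R) : expi (- t) = (expi t)^*.
Proof. by rewrite /expi cosN sinN. Qed.

Lemma normc_real (x : R) : Normc.normc x%:C = `|x|.
Proof. by rewrite /= expr0n addr0 sqrtr_sqr. Qed.

Lemma nsq_real (x : R) : nsq x%:C = x ^+ 2.
Proof. by rewrite /nsq /= expr0n addr0. Qed.

(* The radii of the balls of R[i]^o are the positive elements of R[i], that is, real ones. *)
Lemma cvg_nsq (u : nat -> R[i]) (l : R[i]) :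
  nsq (u k - l) @[k --> \oo] --> (0 : R) -> u k @[k --> \oo] --> (l : R[i]^o).
Proof.
move=> h; apply/(@cvgrPdist_lt R[i] R[i]^o) => e e0.
have [er ei] : (0 < complex.Re e) /\ complex.Im e = 0.
  by move: e0; rewrite ltcE /= => /andP[/eqP -> ->].
have e20 : 0 < complex.Re e ^+ 2 by rewrite exprn_gt0.
move/cvgrPdist_lt : h => /(_ _ e20); apply: filterS => k.
rewrite sub0r normrN (ger0_norm (nsq_ge0 _)) => hk.
rewrite normc_def ltcE /= ei eqxx /=.
rewrite -/(nsq (l - u k)) nsqBC.
by rewrite -(ger0_norm (ltW er)) -sqrtr_sqr ltr_sqrt.
Qed.

End normsq.

Section complex_integral.
Context d (T : measurableType d) (R : realType).
Implicit Types f g : T -> R[i].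

(** [cmeasurable] is tied to [n.-tuple R]; this version, like [cint] and [N2] below, also serves the
    real line and product spaces. *)
Definition cmeas f : Prop :=
  measurable_fun setT (fun x => complex.Re (f x)) /\
  measurable_fun setT (fun x => complex.Im (f x)).

Lemma cmeasB f g : cmeas f -> cmeas g -> cmeas (fun x => f x - g x).
Proof.
move=> [f1 f2] [g1 g2]; split.
- by under eq_fun do rewrite complex_ReB; exact: measurable_funB.
- by under eq_fun do rewrite complex_ImB; exact: measurable_funB.
Qed.

Lemma cmeasM f g : cmeas f -> cmeas g -> cmeas (fun x => f x * g x).
Proof.
move=> [f1 f2] [g1 g2]; split.
- under eq_fun do rewrite complex_ReM.
  by apply: measurable_funB; exact: measurable_funM.
- under eq_fun do rewrite complex_ImM.
  by apply: measurable_funD; exact: measurable_funM.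
Qed.

Lemma cmeas_conj f : cmeas f -> cmeas (fun x => (f x)^*).
Proof.
move=> [f1 f2]; split.
- rewrite [X in measurable_fun _ X](_ : _ = fun x => complex.Re (f x))//.
  by apply/funext => x; case: (f x).
- have := measurable_funN f2.
  rewrite [X in _ -> measurable_fun _ X](_ : _ = \- (fun x => complex.Im (f x)))//.
  by apply/funext => x /=; case: (f x).
Qed.

Lemma cmeas_cst (c : R[i]) : cmeas (fun _ => c).
Proof. by split; exact: measurable_cst. Qed.

Lemma cmeas_real (h : T -> R) : measurable_fun setT h -> cmeas (fun x => (h x)%:C).
Proof. by move=> mh; split. Qed.

Lemma cmeas_expi (h : T -> R) : measurable_fun setT h -> cmeas (fun x => expi (h x)).
Proof.
move=> mh; split => /=; apply: measurableT_comp => //;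
  apply: continuous_measurable_fun.
- exact: continuous_cos.
- exact: continuous_sin.
Qed.

Lemma measurable_nsq f : cmeas f -> measurable_fun setT (fun x => nsq (f x)).
Proof. by move=> [f1 f2]; apply: measurable_funD; exact: measurable_funX. Qed.

Lemma measurable_normc f : cmeas f -> measurable_fun setT (fun x => Normc.normc (f x)).
Proof.
move=> mf; under eq_fun do rewrite normcE2.
apply: measurableT_comp; last exact: measurable_nsq.
by apply: continuous_measurable_fun; exact: sqrt_continuous.
Qed.

Variable mu : {measure set T -> \bar R}.

Definition cint f : R[i] :=
  (\int[mu]_x complex.Re (f x)) +i* (\int[mu]_x complex.Im (f x)).

Definition L1norm f : \bar R := (\int[mu]_x (Normc.normc (f x))%:E)%E.

Definition cL1 f := cmeas f /\ (L1norm f < +oo)%E.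

(** The square of the L^2 norm. Without the root it is a plain integral, and the factor 2 in
    [N2_le2] takes the place of Minkowski's inequality. *)
Definition N2 f : \bar R := (\int[mu]_x (nsq (f x))%:E)%E.

Lemma normc_integrable f : cL1 f -> mu.-integrable setT (fun x => (Normc.normc (f x))%:E).
Proof.
move=> [mf foo]; apply/integrableP; split.
  by apply/measurable_EFinP; exact: measurable_normc.
by under eq_integral do rewrite /= ger0_norm ?normc_ge0//.
Qed.

Lemma cL1_Re f : cL1 f -> mu.-integrable setT (EFin \o (fun x => complex.Re (f x))).
Proof.
move=> fi; apply: le_integrable (normc_integrable fi) => //.
  by apply/measurable_EFinP; exact: fi.1.1.
by move=> x _ /=; rewrite lee_fin (ger0_norm (normc_ge0 _)) Re_le_normc.
Qed.

Lemma cL1_Im f : cL1 f -> mu.-integrable setT (EFin \o (fun x => complex.Im (f x))).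
Proof.
move=> fi; apply: le_integrable (normc_integrable fi) => //.
  by apply/measurable_EFinP; exact: fi.1.2.
by move=> x _ /=; rewrite lee_fin (ger0_norm (normc_ge0 _)) Im_le_normc.
Qed.

Lemma L1norm_ge0 f : (0 <= L1norm f)%E.
Proof. by apply: integral_ge0 => x _; rewrite lee_fin normc_ge0. Qed.

Lemma cL1_le f g : cmeas f -> (forall x, Normc.normc (f x) <= Normc.normc (g x)) ->
  cL1 g -> cL1 f.
Proof.
move=> mf fg [mg goo]; split=> //; apply: le_lt_trans goo.
apply: ge0_le_integral => //.
- by move=> x _; rewrite lee_fin normc_ge0.
- by apply/measurable_EFinP; exact: measurable_normc.
- by apply/measurable_EFinP; exact: measurable_normc.
- by move=> x _; rewrite lee_fin.
Qed.

Lemma cL1Z (M : R) f h : cmeas h -> (forall x, Normc.normc (h x) <= M) ->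
  cL1 f -> cL1 (fun x => h x * f x).
Proof.
move=> mh hM [mf foo]; split; first exact: cmeasM.
apply: (@le_lt_trans _ _ (\int[mu]_x (`|M|%:E * (Normc.normc (f x))%:E))%E).
  apply: ge0_le_integral => //.
  - by move=> x _; rewrite lee_fin normc_ge0.
  - by apply/measurable_EFinP/measurable_normc/cmeasM.
  - by apply/measurable_EFinP/measurable_funM => //; exact: measurable_normc.
  - move=> x _; rewrite -EFinM lee_fin Normc.normcM ler_wpM2r ?normc_ge0//.
    by rewrite (le_trans (hM x))// ler_norm.
rewrite ge0_integralZl_EFin//.
- by apply: lte_mul_pinfty.
- by move=> x _; rewrite lee_fin normc_ge0.
- by apply/measurable_EFinP; exact: measurable_normc.
Qed.

Lemma cL1B f g : cL1 f -> cL1 g -> cL1 (fun x => f x - g x).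
Proof.
move=> fi gi; split; first exact: cmeasB fi.1 gi.1.
apply: (@le_lt_trans _ _ (L1norm f + L1norm g)%E); last first.
  by apply: lte_add_pinfty; [exact: fi.2|exact: gi.2].
rewrite -ge0_integralD//; first last.
- by apply/measurable_EFinP/measurable_normc; exact: gi.1.
- by move=> x _; rewrite lee_fin normc_ge0.
- by apply/measurable_EFinP/measurable_normc; exact: fi.1.
- by move=> x _; rewrite lee_fin normc_ge0.
apply: ge0_le_integral => //.
- by move=> x _; rewrite lee_fin normc_ge0.
- by apply/measurable_EFinP/measurable_normc/cmeasB; [exact: fi.1|exact: gi.1].
- by apply/measurable_EFinP/measurable_funD; apply/measurable_normc; [exact: fi.1|exact: gi.1].
- move=> x _; rewrite -EFinD lee_fin.
  by rewrite -(normcN (g x)); exact: le_normcD.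
Qed.

Lemma cL1_conj f : cL1 f -> cL1 (fun x => (f x)^*).
Proof.
move=> fi; apply: (cL1_le (cmeas_conj fi.1) _ fi) => x.
by rewrite normc_conj.
Qed.

Lemma cintB f g : cL1 f -> cL1 g -> cint (fun x => f x - g x) = cint f - cint g.
Proof.
move=> fi gi; rewrite /cint.
under eq_Rintegral do rewrite complex_ReB.
under [X in _ +i* X]eq_Rintegral do rewrite complex_ImB.
rewrite RintegralB//; [|exact: cL1_Re|exact: cL1_Re].
by rewrite RintegralB//; [exact: cL1_Im|exact: cL1_Im].
Qed.

Lemma cint_conj f : cL1 f -> cint (fun x => (f x)^*) = (cint f)^*.
Proof.
move=> fi; apply/eqP; rewrite eq_complex; apply/andP; split; apply/eqP.
- by rewrite /=; apply: eq_Rintegral => x _; case: (f x).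
- rewrite /= -mulN1r -RintegralZl//; last exact: cL1_Im.
  by apply: eq_Rintegral => x _; rewrite mulN1r; case: (f x).
Qed.

Lemma cintZ (c : R[i]) f : cL1 f -> cint (fun x => c * f x) = c * cint f.
Proof.
move=> fi; have [fR fI] := (cL1_Re fi, cL1_Im fi).
case: c => a b; rewrite /cint.
under eq_Rintegral do rewrite complex_ReM.
under [X in _ +i* X]eq_Rintegral do rewrite complex_ImM.
have Z (k : R) (h : T -> R) : mu.-integrable setT (EFin \o h) ->
    mu.-integrable setT (EFin \o (fun x => k * h x)).
  by move=> hi; exact: (integrableZl measurableT k hi).
rewrite RintegralB//=; [|exact: Z|exact: Z].
rewrite RintegralD//=; [|exact: Z|exact: Z].
by rewrite !RintegralZl.
Qed.

Lemma cintZr (c : R[i]) f : cL1 f -> cint (fun x => f x * c) = cint f * c.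
Proof.
move=> fi; rewrite mulrC -cintZ//; congr cint; apply/funext => x.
by rewrite mulrC.
Qed.

(** The factor 2 comes from bounding the real and imaginary parts separately, each by the L^1
    norm. *)
Lemma normc_cint f : cL1 f -> ((nsq (cint f))%:E <= 2%:E * (L1norm f) ^+ 2)%E.
Proof.
move=> fi; have [fR fI] := (cL1_Re fi, cL1_Im fi).
have -> : L1norm f = (\int[mu]_x Normc.normc (f x))%:E.
  rewrite fineK// ge0_fin_numE ?L1norm_ge0//; exact: fi.2.
rewrite -EFin_expe -EFinM lee_fin /nsq/=.
have le (h : T -> R) : mu.-integrable setT (EFin \o h) ->
   (forall x, `|h x| <= Normc.normc (f x)) ->
   (\int[mu]_x h x) ^+ 2 <= (\int[mu]_x Normc.normc (f x)) ^+ 2.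
  move=> hi hf; rewrite -[X in X <= _](real_normK (num_real _)) lerXn2r ?nnegrE//.
    by apply: Rintegral_ge0 => x _; exact: normc_ge0.
  apply: le_trans (le_normr_Rintegral _ hi) _ => //.
  apply: le_Rintegral => //; last exact: normc_integrable.
  exact: (integrable_norm hi).
rewrite (_ : 2 = 1 + 1 :> R)// mulrDl !mul1r lerD//; apply: le => // x.
- exact: Re_le_normc.
- exact: Im_le_normc.
Qed.

Lemma eq_cint f g : f =1 g -> cint f = cint g.
Proof. by move=> /funext ->. Qed.

Lemma N2_ge0 f : (0 <= N2 f)%E.
Proof. by apply: integral_ge0 => x _; rewrite lee_fin nsq_ge0. Qed.

Lemma eq_N2 f g : f =1 g -> N2 f = N2 g.
Proof. by move=> /funext ->. Qed.

Lemma N2BC f g : N2 (fun x => f x - g x) = N2 (fun x => g x - f x).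
Proof. by apply: eq_integral => x _; rewrite nsqBC. Qed.

Lemma N2_le2 f g h : cmeas f -> cmeas g -> cmeas h ->
  (forall x, nsq (f x) <= 2 * nsq (g x) + 2 * nsq (h x)) ->
  (N2 f <= 2%:E * N2 g + 2%:E * N2 h)%E.
Proof.
move=> mf mg mh fgh.
have n0 (k : T -> R[i]) x : (0 <= (nsq (k x))%:E)%E by rewrite lee_fin nsq_ge0.
have m2 k : cmeas k -> measurable_fun setT (fun x => (nsq (k x))%:E).
  by move=> mk; apply/measurable_EFinP; exact: measurable_nsq.
rewrite -!ge0_integralZl_EFin//; [|exact: m2|exact: m2].
rewrite -ge0_integralD//; first last.
- by apply/measurable_EFinP/measurable_funM => //; exact: measurable_nsq.
- by move=> x _; rewrite mule_ge0.
- by apply/measurable_EFinP/measurable_funM => //; exact: measurable_nsq.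
- by move=> x _; rewrite mule_ge0.
apply: ge0_le_integral => //.
- exact: m2.
- apply/measurable_EFinP/measurable_funD; apply: measurable_funM => //; exact: measurable_nsq.
- by move=> x _; rewrite lee_fin.
Qed.

Lemma N2B_tri f g h : cmeas f -> cmeas g -> cmeas h ->
  (N2 (fun x => f x - h x)%R
   <= 2%:E * N2 (fun x => f x - g x)%R + 2%:E * N2 (fun x => g x - h x)%R)%E.
Proof.
move=> mf mg mh; apply: N2_le2; do ?exact: cmeasB.
by move=> x; exact: nsqB_tri.
Qed.

Lemma N2_eq0_ae f : cmeas f -> N2 f = 0%E -> {ae mu, forall x, f x = 0}.
Proof.
move=> mf f0.
have m2 : measurable_fun setT (fun x => (nsq (f x))%:E).
  by apply/measurable_EFinP; exact: measurable_nsq.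
have /(ae_eq_integral_abs mu measurableT m2) : (\int[mu]_x `|(nsq (f x))%:E| = 0)%E.
  by rewrite -f0; apply: eq_integral => x _; rewrite /= ger0_norm ?nsq_ge0.
by apply: filterS => x /(_ I) [] /= /nsq_eq0.
Qed.

Lemma N2_ae_eq f g : cmeas f -> cmeas g -> {ae mu, forall x, f x = g x} -> N2 f = N2 g.
Proof.
move=> mf mg fg; apply: ge0_ae_eq_integral => //.
- by apply/measurable_EFinP; exact: measurable_nsq.
- by apply/measurable_EFinP; exact: measurable_nsq.
- by move=> x _; rewrite lee_fin nsq_ge0.
- by move=> x _; rewrite lee_fin nsq_ge0.
- by apply: filterS fg => x -> _.
Qed.

Lemma le_N2 f g : cmeas f -> cmeas g -> (forall x, nsq (f x) <= nsq (g x)) ->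
  (N2 f <= N2 g)%E.
Proof.
move=> mf mg fg; apply: ge0_le_integral => //.
- by move=> x _; rewrite lee_fin nsq_ge0.
- by apply/measurable_EFinP; exact: measurable_nsq.
- by apply/measurable_EFinP; exact: measurable_nsq.
- by move=> x _; rewrite lee_fin.
Qed.

Lemma N2Z (c : R[i]) f : cmeas f -> N2 (fun x => c * f x) = ((nsq c)%:E * N2 f)%E.
Proof.
move=> mf; rewrite -ge0_integralZl_EFin//; first last.
- exact: nsq_ge0.
- by apply/measurable_EFinP; exact: measurable_nsq.
- by move=> x _; rewrite lee_fin nsq_ge0.
by apply: eq_integral => x _; rewrite nsqM.
Qed.

End complex_integral.

(** * Fubini's theorem for complex-valued integrands *)

Section fubini_complex.
Context d1 d2 (T1 : measurableType d1) (T2 : measurableType d2) (R : realType).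

Lemma cmeas_comp d d' (T : measurableType d) (T' : measurableType d')
  (f : T -> R[i]) (h : T' -> T) : measurable_fun setT h -> cmeas f ->
  cmeas (fun x => f (h x)).
Proof.
by move=> mh [f1 f2]; split; [exact: (measurableT_comp f1 mh)|exact: (measurableT_comp f2 mh)].
Qed.

Variables (m1 : {sigma_finite_measure set T1 -> \bar R}).
Variables (m2 : {sigma_finite_measure set T2 -> \bar R}).

(** The shape of the double integrals to which Fubini is applied below: a bounded kernel times a
    product of two integrable functions. *)
Lemma cL1_tensor (M : R) (H : T1 * T2 -> R[i]) (f : T1 -> R[i]) (g : T2 -> R[i]) :
  cmeas H -> (forall z, Normc.normc (H z) <= M) -> cL1 m1 f -> cL1 m2 g ->
  cL1 (m1 \x m2)%E (fun z => H z * (f z.1 * g z.2)).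
Proof.
move=> mH HM fi gi; apply: cL1Z mH HM _.
have mf : cmeas (fun z : T1 * T2 => f z.1) by apply: cmeas_comp measurable_fst fi.1.
have mg : cmeas (fun z : T1 * T2 => g z.2) by apply: cmeas_comp measurable_snd gi.1.
split; first exact: cmeasM.
rewrite /L1norm fubini_tonelli1//; last first.
- by move=> z; rewrite lee_fin normc_ge0.
- by apply/measurable_EFinP; apply: measurable_normc; exact: cmeasM.
rewrite /fubini_F /=.
under eq_integral => x _.
  under eq_integral do rewrite Normc.normcM EFinM.
  rewrite ge0_integralZl_EFin//; last 3 first.
  - by move=> y _; rewrite lee_fin normc_ge0.
  - by apply/measurable_EFinP; apply: measurable_normc; exact: gi.1.
  - exact: normc_ge0.
  rewrite -/(L1norm m2 g) -[L1norm _ _]fineK; last first.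
    by rewrite ge0_fin_numE ?L1norm_ge0//; exact: gi.2.
  rewrite muleC.
  over.
rewrite ge0_integralZl_EFin//.
- by apply: lte_mul_pinfty; [rewrite lee_fin fine_ge0// L1norm_ge0|by []|exact: fi.2].
- by move=> y _; rewrite lee_fin normc_ge0.
- by apply/measurable_EFinP; apply: measurable_normc; exact: fi.1.
- by rewrite fine_ge0// L1norm_ge0.
Qed.

Lemma Rintegral_Fubini (h : T1 * T2 -> R) :
  (m1 \x m2)%E.-integrable setT (EFin \o h) ->
  \int[m1]_x (\int[m2]_y h (x, y)) = \int[m2]_y (\int[m1]_x h (x, y)).
Proof.
move=> hi.
have mF := measurable_fubini_F hi; have mG := measurable_fubini_G hi.
rewrite /Rintegral; congr fine.
(* [fine] of the inner integral agrees with the inner integral only where the latter is finite,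
   which integrability of [h] gives for almost every [x]. *)
transitivity (\int[m1]_x (fubini_F m2 (EFin \o h)) x)%E.
  apply: ae_eq_integral => //.
  - by apply/measurable_EFinP; exact: (measurableT_comp (fine_measurable measurableT) mF).
  - apply: filterS (ae_integrable1 hi) => x xi _.
    by rewrite /= fineK//; exact: integrable_fin_num.
transitivity (\int[m2]_y (fubini_G m1 (EFin \o h)) y)%E; first exact: Fubini.
apply: ae_eq_integral => //.
- by apply/measurable_EFinP; exact: (measurableT_comp (fine_measurable measurableT) mG).
- apply: filterS (ae_integrable2 hi) => x xi _.
  by rewrite /= fineK//; exact: integrable_fin_num.
Qed.

Lemma Rintegral_prod (h : T1 * T2 -> R) :
  (m1 \x m2)%E.-integrable setT (EFin \o h) ->
  \int[m1]_x (\int[m2]_y h (x, y)) = \int[(m1 \x m2)%E]_z h z.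
Proof.
move=> hi; have mF := measurable_fubini_F hi.
rewrite /Rintegral; congr fine.
rewrite -integral12_prod_meas1//; apply: ae_eq_integral => //.
- by apply/measurable_EFinP; exact: (measurableT_comp (fine_measurable measurableT) mF).
- apply: filterS (ae_integrable1 hi) => x xi _.
  by rewrite /= fineK//; exact: integrable_fin_num.
Qed.

Lemma cint_prod (G : T1 * T2 -> R[i]) : cL1 (m1 \x m2)%E G ->
  cint (m1 \x m2)%E G = cint m1 (fun x => cint m2 (fun y => G (x, y))).
Proof.
move=> iG; rewrite /cint; congr (_ +i* _) => /=.
- by rewrite (Rintegral_prod (cL1_Re iG)).
- by rewrite (Rintegral_prod (cL1_Im iG)).
Qed.

Lemma cint_Fubini (G : T1 * T2 -> R[i]) : cL1 (m1 \x m2)%E G ->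
  cint m1 (fun x => cint m2 (fun y => G (x, y))) =
  cint m2 (fun y => cint m1 (fun x => G (x, y))).
Proof.
move=> iG; rewrite /cint; congr (_ +i* _) => /=.
- by rewrite (Rintegral_Fubini (cL1_Re iG)).
- by rewrite (Rintegral_Fubini (cL1_Im iG)).
Qed.

(** Integrability is not assumed: the integrals of the positive and negative parts are measurable by
    Tonelli, and their difference is formed in the extended reals before [fine] is applied. *)
Lemma measurable_Rintegral2 (h : T1 * T2 -> R) : measurable_fun setT h ->
  measurable_fun setT (fun x => \int[m2]_y h (x, y)).
Proof.
move=> mh; have mf : measurable_fun setT (EFin \o h) by exact/measurable_EFinP.
suff : measurable_fun setT (fun x => \int[m2]_y (EFin \o h) (x, y))%E.
  exact: (measurableT_comp (fine_measurable measurableT)).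
rewrite (_ : (fun x => _) = (fun x => \int[m2]_y (EFin \o h)^\+ (x, y))
  \- (fun x => \int[m2]_y (EFin \o h)^\- (x, y)))%E; last first.
  apply/funext => x; rewrite [LHS]integralE.
  under eq_integral do rewrite (funepos_comp (EFin \o h) (pair x))/=.
  by under [X in (_ - X)%E = _]eq_integral do rewrite (funeneg_comp (EFin \o h) (pair x))/=.
apply: emeasurable_funB.
- apply: (@measurable_fun_fubini_tonelli_F _ _ _ _ _ m2 ((EFin \o h)^\+)%E) => //.
  exact: measurable_funepos.
- apply: (@measurable_fun_fubini_tonelli_F _ _ _ _ _ m2 ((EFin \o h)^\-)%E) => //.
  exact: measurable_funeneg.
Qed.

Lemma cmeas_cint (G : T1 * T2 -> R[i]) : cmeas G ->
  cmeas (fun x => cint m2 (fun y => G (x, y))).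
Proof.
move=> [G1 G2]; split.
- exact: (measurable_Rintegral2 (h := fun z => complex.Re (G z))).
- exact: (measurable_Rintegral2 (h := fun z => complex.Im (G z))).
Qed.

End fubini_complex.

(** * The Poisson kernel *)

Section poisson_kernel.
Context {R : realType}.
Local Notation mu := (@lebesgue_measure R).
Implicit Types (f F G : R -> R) (e t x y : R).

Lemma is_derive_continuous f (df : R -> R) :
  (forall x : R, is_derive x (1 : R) f (df x)) -> continuous f.
Proof.
move=> fdf x; apply/differentiable_continuous/derivable1_diffP.
by have [] := fdf x.
Qed.

Lemma ge0_FTC_halfline f F (a l : R) : (forall x, 0 <= f x) -> continuous f ->
  (forall x : R, is_derive x (1 : R) F (f x)) -> F x @[x --> +oo] --> l ->
  (\int[mu]_(x in `[a, +oo[) (f x)%:E = (l - F a)%:E)%E.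
Proof.
move=> f0 cf dF Fl; rewrite EFinB; apply: ge0_continuous_FTC2y => //.
- exact: continuous_subspaceT.
- apply: cvg_at_right_filter; exact: is_derive_continuous dF a.
- by move=> x _; rewrite derive1E; have [_] := dF x.
Qed.

Lemma ge0_integral_line G : continuous G -> (forall x, 0 <= G x) ->
  (\int[mu]_x (G x)%:E = \int[mu]_(x in `[0%R, +oo[) (G x)%:E
     + \int[mu]_(x in `[0%R, +oo[) (G (- x))%:E)%E.
Proof.
move=> cG G0.
have mG : measurable_fun setT G by exact: continuous_measurable_fun.
rewrite -[X in (_ + X)%E](ge0_integration_by_substitutionNy (a := 0)); last 2 first.
- exact: continuous_subspaceT.
- by move=> x _; exact: G0.
rewrite oppr0 -integral_itv_bndo_bndc; last first.
  by apply/measurable_EFinP; exact: measurable_funTS.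
rewrite addeC -ge0_integral_setU//=.
- by rewrite -(itv_setU_setT true (0 : R)).
- by apply/measurable_EFinP; exact: measurable_funTS.
- by move=> x _; rewrite lee_fin.
- by rewrite disj_set2E; apply/eqP/seteqP; split => // x /=; rewrite !in_itv/= andbT => -[/lt_geF ->].
Qed.

(** Normalised as the Fourier transform of the weight [expw e] below, so that the total mass is 2
    pi. Its antiderivative 2 atan (t / e) makes the integral over an interval explicit. *)
Definition poisson e t : R := 2 * e / (e ^+ 2 + t ^+ 2).

Lemma poisson_den_gt0 e t : 0 < e -> 0 < e ^+ 2 + t ^+ 2.
Proof. by move=> e0; rewrite ltr_wpDr ?sqr_ge0// exprn_gt0. Qed.

Lemma poisson_ge0 e t : 0 < e -> 0 <= poisson e t.
Proof.
by move=> e0; rewrite divr_ge0 ?mulr_ge0// ltW// poisson_den_gt0.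
Qed.

Lemma poissonN e t : poisson e (- t) = poisson e t.
Proof. by rewrite /poisson sqrrN. Qed.

Lemma poisson_le e t : 0 < e -> poisson e t <= 2 / e.
Proof.
move=> e0; rewrite /poisson ler_pdivrMr ?poisson_den_gt0//.
rewrite mulrDr (_ : 2 / e * e ^+ 2 = 2 * e); last by field; rewrite gt_eqF.
by rewrite lerDl mulr_ge0 ?sqr_ge0// divr_ge0// ltW.
Qed.

Lemma is_derive_poisson e x y : 0 < e ->
  is_derive y (1 : R) (fun y => 2 * atan ((y - x) / e)) (poisson e (x - y)).
Proof.
move=> e0; rewrite /poisson.
have := is_derive1_atan ((y - x) / e).
have d2 : is_derive y (1 : R) (fun y => (y - x) * e^-1) e^-1.
  by apply: is_derive_eq; rewrite scaler0 add0r subr0 /GRing.scale/= mulr1.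
move=> d1.
have d3 := @is_derive1_comp _ atan (fun y => (y - x) * e^-1) y _ _ d1 d2.
have := is_deriveZ 2 d3.
move=> d; apply: (@is_derive_eq _ _ _ _ _ _ _ _ d); rewrite /GRing.scale/=.
field.
by rewrite !gt_eqF//= ?poisson_den_gt0.
Qed.

Lemma continuous_poisson e x : 0 < e -> continuous (fun y => poisson e (x - y)).
Proof.
move=> e0 y; rewrite /poisson.
apply: cvgM; first exact: cvg_cst.
apply: cvgV; first by rewrite gt_eqF// poisson_den_gt0.
apply: cvgD; first exact: cvg_cst.
under eq_fun do rewrite expr2.
by rewrite expr2; apply: cvgM; apply: cvgB => //; exact: cvg_cst.
Qed.

Lemma measurable_poisson e : 0 < e -> measurable_fun setT (@poisson e).
Proof.
move=> e0; have := continuous_measurable_fun (continuous_poisson (x := 0) e0).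
by apply: eq_measurable_fun => y _ ; rewrite sub0r poissonN.
Qed.

Lemma poisson_itv e x (a b : R) : 0 < e -> a < b ->
  (\int[mu]_(y in `]a, b]) (poisson e (x - y))%:E =
   (2 * atan ((b - x) / e) - 2 * atan ((a - x) / e))%:E)%E.
Proof.
move=> e0 ab.
have mp : measurable_fun setT (fun y => (poisson e (x - y))%:E).
  by apply/measurable_EFinP; apply: continuous_measurable_fun; exact: continuous_poisson.
have dF y := is_derive_poisson x y e0.
have cF := is_derive_continuous dF.
rewrite integral_itv_obnd_cbnd; last exact: measurable_funTS.
rewrite (continuous_FTC2 (F := fun y => 2 * atan ((y - x) / e)) ab)//.
- by apply: continuous_subspaceT; exact: continuous_poisson.
- split.
  + by move=> y _; have [] := dF y.
  + exact: cvg_at_right_filter (cF a).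
  + exact: cvg_at_left_filter (cF b).
- by move=> y _; rewrite derive1E; have [_] := dF y.
Qed.

Lemma cvgy_atan_affine x e : 0 < e ->
  2 * atan ((y - x) / e) @[y --> +oo] --> (pi : R).
Proof.
move=> e0; rewrite (_ : (pi : R) = 2 * (pi / 2)); last by field.
apply: cvgM; first exact: cvg_cst.
apply: (cvg_comp _ _ _ (@cvgy_atan R)).
apply: gt0_cvgMly; first by rewrite invr_gt0.
apply/cvgryPge => A; near=> y; rewrite lerBrDr.
by near: y; apply: nbhs_pinfty_ge; rewrite num_real.
Unshelve. all: by end_near. Qed.

Lemma poisson_integral e x : 0 < e -> (\int[mu]_y (poisson e (x - y))%:E = (2 * pi)%:E)%E.
Proof.
move=> e0.
have c1 := @continuous_poisson e x e0.
have c2 : continuous (fun y => poisson e (x - - y)).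
  rewrite (_ : (fun _ => _) = fun y => poisson e (- x - y)); last first.
    by apply/funext => y; rewrite -poissonN opprB addrC.
  exact: continuous_poisson.
have p0 y := @poisson_ge0 e (x - y) e0.
have p0' y := @poisson_ge0 e (x - - y) e0.
rewrite ge0_integral_line//.
rewrite (ge0_FTC_halfline 0 p0 c1 (fun y => is_derive_poisson x y e0) (cvgy_atan_affine x e0)).
have d2 y : is_derive y (1 : R) (fun y => 2 * atan ((y - - x) / e)) (poisson e (x - - y)).
  rewrite -(poissonN _ (x - - y)) opprB (_ : - y - x = - x - y); last by rewrite addrC.
  exact: is_derive_poisson.
rewrite (ge0_FTC_halfline 0 p0' c2 d2 (cvgy_atan_affine (- x) e0)).
(* The two half-lines contribute pi plus and pi minus the same arctangent. *)
rewrite -EFinD; congr EFin; rewrite !sub0r opprK mulNr atanN; ring.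
Qed.

(** The fundamental theorem on a half-line is applied to nonnegative integrands, so cosine and sine
    are shifted by 1. Taking [(al, be)] to be (1, 0) and (0, 1) later recovers the real and
    imaginary parts of the transform. *)
Lemma is_derive_exp_trig e t (al be x : R) : 0 < e ->
  is_derive x (1 : R)
    (fun x => expR (- (e * x)) * (- e^-1 +
      (al * (t * sin (t * x) - e * cos (t * x)) -
       be * (e * sin (t * x) + t * cos (t * x))) / (e ^+ 2 + t ^+ 2)))
    ((1 + (al * cos (t * x) + be * sin (t * x))) * expR (- (e * x))).
Proof.
move=> e0.
have dl (k : R) : is_derive x (1 : R) (fun x => k * x) k.
  by apply: is_derive_eq; rewrite /GRing.scale/= mulr1.
have ds := @is_derive1_comp _ sin (fun x => t * x) x _ _ (is_derive_sin _) (dl t).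
have dc := @is_derive1_comp _ cos (fun x => t * x) x _ _ (is_derive_cos _) (dl t).
have dN : is_derive x (1 : R) (fun x => - (e * x)) (- e).
  exact: (@is_deriveN _ _ _ _ _ _ _ (dl e)).
have dE := @is_derive1_comp _ expR (fun x => - (e * x)) x _ _ (is_derive_expR _) dN.
rewrite /comp /= in ds dc dE.
apply: is_derive_eq; rewrite /GRing.scale/=.
field.
by rewrite !gt_eqF//= ?poisson_den_gt0.
Qed.

End poisson_kernel.

(** * Fourier transform of the two-sided exponential *)

Section fourier_exp.
Context {R : realType}.
Local Notation mu := (@lebesgue_measure R).
Implicit Types (e t x al be : R).

Lemma cvg_expRM e (B : R -> R) (M : R) : 0 < e -> (forall x, `|B x| <= M) ->
  expR (- (e * x)) * B x @[x --> +oo] --> (0 : R).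
Proof.
move=> e0 BM; apply: norm_cvg0.
apply: (squeeze_cvgr (f := fun=> 0) (h := fun x => expR (- (e * x)) * M)).
- apply: nearW => x; rewrite normr_ge0/= normrM ger0_norm ?expR_ge0//.
  by rewrite ler_wpM2l ?expR_ge0.
- exact: cvg_cst.
- rewrite -[X in _ --> X](mul0r M); apply: cvgM; last exact: cvg_cst.
  apply: (@cvg_comp _ _ _ (fun x => e * x) (fun x => expR (- x)) _ (pinfty_nbhs R)); last exact: cvgr_expR.
  by apply: gt0_cvgMry => //; exact: cvg_id.
Qed.

Lemma exp_trig_halfline e t al be : 0 < e ->
  (forall x, 0 <= 1 + (al * cos x + be * sin x)) ->
  (\int[mu]_(x in `[0%R, +oo[) ((1 + (al * cos (t * x) + be * sin (t * x))) * expR (- (e * x)))%:E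
   = (e^-1 + (al * e + be * t) / (e ^+ 2 + t ^+ 2))%:E)%E.
Proof.
move=> e0 h0.
have dF x := is_derive_exp_trig t al be x e0.
have cf : continuous (fun x => (1 + (al * cos (t * x) + be * sin (t * x))) * expR (- (e * x))).
  have lin k : continuous (fun x => k * x : R) by move=> x; apply: cvgM => //; exact: cvg_cst.
  have ccos : continuous (fun x => cos (t * x)).
    by move=> x; apply: continuous_comp; [exact: lin|exact: continuous_cos].
  have csin : continuous (fun x => sin (t * x)).
    by move=> x; apply: continuous_comp; [exact: lin|exact: continuous_sin].
  move=> x; apply: cvgM; last first.
    apply: (@continuous_comp _ _ _ (fun x => - (e * x)) expR); last exact: continuous_expR.
    by apply: cvgN; exact: lin.
  apply: cvgD; first exact: cvg_cst.
  by apply: cvgD; (apply: cvgM; first exact: cvg_cst); [exact: ccos|exact: csin].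
rewrite (ge0_FTC_halfline 0 _ cf dF (l := 0)).
- congr EFin; rewrite !mulr0 oppr0 expR0 sin0 cos0.
  by field; rewrite !gt_eqF//= poisson_den_gt0.
- by move=> x; rewrite mulr_ge0 ?expR_ge0.
- apply: (@cvg_expRM e _ (e^-1 + (`|al| * (`|t| + e) + `|be| * (e + `|t|)) / (e ^+ 2 + t ^+ 2))) => // x.
  have s1 := sin_max (t * x); have c1 := cos_max (t * x).
  rewrite (le_trans (ler_normD _ _))// normrN ger0_norm ?invr_ge0 ?(ltW e0)// lerD2l.
  rewrite normrM (@ger0_norm _ (_ ^-1)); last by rewrite invr_ge0 ltW// poisson_den_gt0.
  rewrite ler_wpM2r//; first by rewrite invr_ge0 ltW// poisson_den_gt0.
  rewrite (le_trans (ler_normB _ _))// !normrM lerD// ler_wpM2l//.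
    rewrite (le_trans (ler_normB _ _))// !normrM (ger0_norm (ltW e0)) lerD//.
    by rewrite ler_piMr.
    by rewrite ler_piMr// ltW.
  rewrite (le_trans (ler_normD _ _))// !normrM (ger0_norm (ltW e0)) lerD//.
  by rewrite ler_piMr// ltW.
  by rewrite ler_piMr.
Qed.

(** Reflecting the negative half-line replaces [be] by [- be], so the sine contributions cancel. *)
Lemma exp_trig_line e t al be : 0 < e ->
  (forall x, 0 <= 1 + (al * cos x + be * sin x)) ->
  (\int[mu]_x ((1 + (al * cos (t * x) + be * sin (t * x))) * expR (- (e * `|x|)))%:E
   = (2 / e + al * poisson e t)%:E)%E.
Proof.
move=> e0 h0.
rewrite ge0_integral_line; first last.
- by move=> x; rewrite mulr_ge0 ?expR_ge0.
- have lin k : continuous (fun x => k * x : R) by move=> x; apply: cvgM => //; exact: cvg_cst.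
  have ccos : continuous (fun x => cos (t * x)).
    by move=> x; apply: continuous_comp; [exact: lin|exact: continuous_cos].
  have csin : continuous (fun x => sin (t * x)).
    by move=> x; apply: continuous_comp; [exact: lin|exact: continuous_sin].
  move=> x; apply: cvgM; last first.
    apply: (@continuous_comp _ _ _ (fun x => - (e * `|x|)) expR); last exact: continuous_expR.
    apply: cvgN; apply: cvgM; first exact: cvg_cst.
    exact: norm_continuous.
  apply: cvgD; first exact: cvg_cst.
  by apply: cvgD; (apply: cvgM; first exact: cvg_cst); [exact: ccos|exact: csin].
transitivity ((e^-1 + (al * e + be * t) / (e ^+ 2 + t ^+ 2))%:E +
   (e^-1 + (al * e + (- be) * t) / (e ^+ 2 + t ^+ 2))%:E)%E.
  congr (_ + _)%E.
    rewrite -(exp_trig_halfline t e0 h0); apply: eq_integral => x.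
    by rewrite inE/= in_itv/= andbT => x0; rewrite ger0_norm.
  rewrite -(exp_trig_halfline t e0); last first.
    by move=> x; have := h0 (- x); rewrite cosN sinN mulrN mulNr.
  apply: eq_integral => x.
  rewrite inE/= in_itv/= andbT => x0; rewrite normrN ger0_norm//.
  by rewrite mulrN cosN sinN mulrN mulNr.
rewrite -EFinD /poisson; congr EFin.
by field; rewrite !gt_eqF//= poisson_den_gt0.
Qed.

End fourier_exp.
(** * Fourier integrals and Plancherel's inequality *)

Section product_formula.
Context {R : realType}.
Local Notation mu1 := (@lebesgue_measure R).
Local Notation mu n := (@lebesgue_Rn R n).

Lemma L1norm_Rn_cons n (F : n.+1.-tuple R -> R[i]) : cmeas F ->
  L1norm (mu n.+1) F = L1norm (mu1 \x mu n)%E (fun p => F (Rn_cons p)).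
Proof.
move=> mF; rewrite /L1norm.
rewrite -[X in integral X]/(pushforward (mu1 \x mu n)%E (@Rn_cons R n)).
rewrite ge0_integral_pushforward//.
- exact: measurable_Rn_cons.
- by apply/measurable_EFinP; exact: measurable_normc.
- by move=> x _; rewrite lee_fin normc_ge0.
Qed.

Lemma cint_Rn_cons n (F : n.+1.-tuple R -> R[i]) : cmeas F ->
  cL1 (mu1 \x mu n)%E (fun p => F (Rn_cons p)) ->
  cint (mu n.+1) F = cint (mu1 \x mu n)%E (fun p => F (Rn_cons p)).
Proof.
move=> mF iF; rewrite /cint /Rintegral.
rewrite -[X in integral X]/(pushforward (mu1 \x mu n)%E (@Rn_cons R n)).
congr (fine _ +i* fine _).
- rewrite integral_pushforward//.
  + exact: measurable_Rn_cons.
  + by apply/measurable_EFinP; exact: mF.1.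
  + by rewrite preimage_setT; exact: cL1_Re iF.
- rewrite integral_pushforward//.
  + exact: measurable_Rn_cons.
  + by apply/measurable_EFinP; exact: mF.2.
  + by rewrite preimage_setT; exact: cL1_Im iF.
Qed.

Lemma cmeas_prod d (T : measurableType d) (I : Type) (s : seq I) (h : I -> T -> R[i]) :
  (forall i, cmeas (h i)) -> cmeas (fun x => \prod_(i <- s) h i x).
Proof.
move=> mh; elim: s => [|i s ih].
  by under eq_fun do rewrite big_nil; exact: cmeas_cst.
by under eq_fun do rewrite big_cons; exact: cmeasM.
Qed.

Lemma cmeas_prod_tnth n (phi : 'I_n -> R -> R[i]) : (forall i, cmeas (phi i)) ->
  cmeas (fun x : n.-tuple R => \prod_(i < n) phi i (tnth x i)).
Proof.
move=> mphi; apply: cmeas_prod => i.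
by apply: cmeas_comp (mphi i); exact: measurable_tnth.
Qed.

(** Induction on the dimension through [Rn_cons]; the explicit kernels below are integrated one
    variable at a time with it. Integrability is proved alongside because Fubini uses it in the
    inductive step. *)
Lemma cint_prod_tnth n (phi : 'I_n -> R -> R[i]) : (forall i, cL1 mu1 (phi i)) ->
  cL1 (mu n) (fun x => \prod_(i < n) phi i (tnth x i)) /\
  cint (mu n) (fun x => \prod_(i < n) phi i (tnth x i)) =
  \prod_(i < n) cint mu1 (phi i).
Proof.
elim: n phi => [|n ih] phi iphi.
  rewrite big_ord0; under eq_fun do rewrite big_ord0.
  split.
    split; first exact: cmeas_cst.
    rewrite /L1norm; under eq_integral do rewrite Normc.normc1.
    by rewrite integral_cst//= diracT mule1 ltry.
  rewrite /cint !Rintegral_cst//; set m0 := (X in _ * fine X +i* _).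
  by rewrite (_ : m0 = 1%E) /= ?mul0r ?mulr1// /m0 /= diracT.
have mF : cmeas (fun x : n.+1.-tuple R => \prod_(i < n.+1) phi i (tnth x i)).
  by apply: cmeas_prod_tnth => i; exact: (iphi i).1.
have [iP cP] := ih (fun i => phi (lift ord0 i)) (fun i => iphi _).
set P := (fun x : n.-tuple R => \prod_(i < n) _) in iP cP.
have FE p : (\prod_(i < n.+1) phi i (tnth (Rn_cons p) i)) = 1 * (phi ord0 p.1 * P p.2).
  rewrite big_ord_recl mul1r; congr (_ * _).
  by apply: eq_bigr => i _; rewrite tnthS.
have iF : cL1 (mu1 \x mu n)%E (fun p => \prod_(i < n.+1) phi i (tnth (Rn_cons p) i)).
  under eq_fun do rewrite FE.
  apply: (@cL1_tensor _ _ _ _ _ _ _ 1 (fun=> 1)) => //.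
  by move=> _; rewrite Normc.normc1.
split.
  split=> //; rewrite L1norm_Rn_cons//; exact: iF.2.
rewrite cint_Rn_cons// cint_prod// big_ord_recl -cP -cintZr//.
by apply: eq_cint => x; rewrite -cintZ//; apply: eq_cint => y; rewrite FE mul1r.
Qed.

Lemma cint_real d (T : measurableType d) (m : {measure set T -> \bar R}) (h : T -> R) :
  cint m (fun x => (h x)%:C) = (\int[m]_x h x)%:C.
Proof. by rewrite /cint /= Rintegral_cst// mul0r. Qed.

Lemma Rintegral_cL1_fine d (T : measurableType d) (m : {measure set T -> \bar R}) (h : T -> R) :
  m.-integrable setT (EFin \o h) -> (\int[m]_x (h x)%:E)%E = (\int[m]_x h x)%:E.
Proof. by move=> hi; rewrite /Rintegral fineK//; exact: integrable_fin_num. Qed.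

Lemma cL1_real d (T : measurableType d) (m : {measure set T -> \bar R}) (h : T -> R) :
  measurable_fun setT h -> (forall x, 0 <= h x) ->
  (\int[m]_x (h x)%:E < +oo)%E -> cL1 m (fun x => (h x)%:C).
Proof.
move=> mh h0 hoo; split; first exact: cmeas_real.
by rewrite /L1norm; under eq_integral do rewrite normc_real ger0_norm//.
Qed.

Definition expw (e x : R) : R := expR (- (e * `|x|)).

Lemma expw_ge0 e x : 0 <= expw e x. Proof. exact: expR_ge0. Qed.

Lemma expw_le1 e x : 0 < e -> expw e x <= 1.
Proof. by move=> e0; rewrite -expR0 ler_expR oppr_le0 mulr_ge0// ltW. Qed.

Lemma measurable_expw e : measurable_fun setT (expw e).
Proof.
apply: measurableT_comp => //; apply: measurableT_comp => //.
by apply: measurable_funM => //; exact: measurableT_comp.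
Qed.

Lemma integral_expw e : 0 < e -> (\int[mu1]_x (expw e x)%:E = (2 / e)%:E)%E.
Proof.
move=> e0.
have := @exp_trig_line R e 0 0 0 e0; rewrite mul0r addr0 => <-.
  by apply: eq_integral => x _; rewrite !mul0r addr0 addr0 mul1r.
by move=> x; rewrite !mul0r !addr0.
Qed.

Lemma cL1_expw e : 0 < e -> cL1 mu1 (fun x => (expw e x)%:C).
Proof.
move=> e0; split; first by apply: cmeas_real; exact: measurable_expw.
rewrite /L1norm; under eq_integral do rewrite normc_real ger0_norm ?expw_ge0//.
by rewrite integral_expw// ltry.
Qed.

Lemma cint_expi_expw e t : 0 < e ->
  cint mu1 (fun x => expi (t * x) * (expw e x)%:C) = (poisson e t)%:C.
Proof.
move=> e0.
have mw := @measurable_expw e.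
have me : @cmeas _ (measurableTypeR R) R (fun x => expi (t * x)).
  by apply: cmeas_expi; exact: measurable_funM.
have i1 : cL1 mu1 (fun x => expi (t * x) * (expw e x)%:C).
  by apply: (cL1Z (M := 1) me); [move=> x; rewrite normc_expi|exact: cL1_expw].
have iw := cL1_Re (cL1_expw e0).
have iR := cL1_Re i1; have iI := cL1_Im i1.
have wE : \int[mu1]_x expw e x = 2 / e by rewrite /Rintegral integral_expw.
have RE x : complex.Re (expi (t * x) * (expw e x)%:C) = cos (t * x) * expw e x.
  by rewrite complex_ReM /= mulr0 subr0.
have IE x : complex.Im (expi (t * x) * (expw e x)%:C) = sin (t * x) * expw e x.
  by rewrite complex_ImM /= mulr0 add0r.
rewrite (_ : (fun x => complex.Re _) = fun x => cos (t * x) * expw e x) in iR; last exact/funext.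
rewrite (_ : (fun x => complex.Im _) = fun x => sin (t * x) * expw e x) in iI; last exact/funext.
rewrite /cint.
under eq_Rintegral do rewrite RE.
under [X in _ +i* X]eq_Rintegral do rewrite IE.
have hc x : 0 <= 1 + (1 * cos x + 0 * sin x) :> R.
  by rewrite mul1r mul0r addr0 -lerBlDl sub0r cos_geN1.
have hs x : 0 <= 1 + (0 * cos x + 1 * sin x) :> R.
  by rewrite mul1r mul0r add0r -lerBlDl sub0r sin_geN1.
(* Cancelling the mass [2 / e] of the weight on both sides removes the shift by 1. *)
congr (_ +i* _).
- have := exp_trig_line t e0 hc.
  under eq_integral do rewrite mul1r mul0r addr0 mulrDl mul1r.
  move=> /(congr1 fine)/= E; move: (RintegralD measurableT iw iR).
  by rewrite wE /Rintegral/= E mul1r => /addrI <-.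
- have := exp_trig_line t e0 hs.
  under eq_integral do rewrite mul1r mul0r add0r mulrDl mul1r.
  move=> /(congr1 fine)/= E; move: (RintegralD measurableT iw iI).
  by rewrite wE /Rintegral/= E mul0r => /addrI <-.
Qed.

End product_formula.

(** * The damping weight, its Poisson kernel, and the multiplication formula *)

Section multiplication_formula.
Context {R : realType} (n : nat).
Local Notation Rn := (n.-tuple R).
Local Notation mu := (@lebesgue_Rn R n).
Implicit Types (u phi : Rn -> R[i]) (x y xi : Rn) (e : R).

Lemma dotC x y : dot x y = dot y x.
Proof. by apply: eq_bigr => i _; rewrite mulrC. Qed.

Lemma measurable_dot d (T : measurableType d) (f g : T -> Rn) :
  measurable_fun setT f -> measurable_fun setT g ->
  measurable_fun setT (fun z => dot (f z) (g z)).
Proof.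
move=> mf mg; apply: measurable_sum => i.
apply: measurable_funM.
- exact: (measurableT_comp (measurable_tnth i) mf).
- exact: (measurableT_comp (measurable_tnth i) mg).
Qed.

Lemma expi_sum (I : Type) (s : seq I) (h : I -> R) :
  expi (\sum_(i <- s) h i) = \prod_(i <- s) expi (h i).
Proof.
elim: s => [|i s ih]; first by rewrite !big_nil expi0.
by rewrite !big_cons expiD ih.
Qed.

Lemma real_complex_prod (I : Type) (s : seq I) (h : I -> R) :
  (\prod_(i <- s) h i)%:C = \prod_(i <- s) (h i)%:C.
Proof. exact: (big_morph (real_complex R) (rmorphM _) (rmorph1 _)). Qed.

(** A product over the coordinates rather than a function of the Euclidean norm, so that its
    transform is the product [Kn] of one-dimensional Poisson kernels. *)
Definition Wn e xi : R := \prod_(i < n) expw e (tnth xi i).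

Definition Kn e x y : R := \prod_(i < n) poisson e (tnth x i - tnth y i).

Lemma Wn_ge0 e xi : 0 <= Wn e xi.
Proof. by apply: prodr_ge0 => i _; exact: expw_ge0. Qed.

Lemma Wn_le1 e xi : 0 < e -> Wn e xi <= 1.
Proof.
by move=> e0; apply: prodr_ile1 => i _; rewrite expw_ge0 expw_le1.
Qed.

Lemma Kn_ge0 e x y : 0 < e -> 0 <= Kn e x y.
Proof. by move=> e0; apply: prodr_ge0 => i _; exact: poisson_ge0. Qed.

Lemma KnC e x y : Kn e x y = Kn e y x.
Proof. by apply: eq_bigr => i _; rewrite -poissonN opprB. Qed.

Lemma Kn_le e x y : 0 < e -> Kn e x y <= (2 / e) ^+ n.
Proof.
move=> e0; rewrite -[X in _ ^+ X](card_ord n) -prodr_const.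
by apply: ler_prod => i _; rewrite poisson_ge0//= poisson_le.
Qed.

Lemma measurable_prod_fun d (T : measurableType d) (I : Type) (s : seq I) (h : I -> T -> R) :
  (forall i, measurable_fun setT (h i)) -> measurable_fun setT (fun z => \prod_(i <- s) h i z).
Proof.
move=> mh; elim: s => [|i s ih].
  by under eq_fun do rewrite big_nil; exact: measurable_cst.
by under eq_fun do rewrite big_cons; exact: measurable_funM.
Qed.

Lemma measurable_Wn e : measurable_fun setT (Wn e).
Proof.
apply: measurable_prod_fun => i.
exact: (measurableT_comp (@measurable_expw R e) (measurable_tnth i)).
Qed.

Lemma measurable_Kn e : 0 < e -> measurable_fun setT (fun z : Rn * Rn => Kn e z.1 z.2).
Proof.
move=> e0; apply: measurable_prod_fun => i.
apply: (measurableT_comp (measurable_poisson e0)).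
apply: measurable_funB.
- exact: (measurableT_comp (measurable_tnth i) measurable_fst).
- exact: (measurableT_comp (measurable_tnth i) measurable_snd).
Qed.

Lemma cL1_Wn e : 0 < e -> cL1 mu (fun xi => (Wn e xi)%:C).
Proof.
move=> e0; have [+ _] := @cint_prod_tnth R n (fun _ r => (expw e r)%:C) (fun=> cL1_expw e0).
by under eq_fun do rewrite -real_complex_prod.
Qed.

Lemma cint_expi_Wn e x y : 0 < e ->
  cint mu (fun xi => expi (- dot y xi) * (expi (dot x xi) * (Wn e xi)%:C)) = (Kn e x y)%:C.
Proof.
move=> e0.
have iphi i : cL1 (@lebesgue_measure R)
    (fun t => expi ((tnth x i - tnth y i) * t) * (expw e t)%:C).
  have me : @cmeas _ (measurableTypeR R) R (fun t => expi ((tnth x i - tnth y i) * t)).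
    by apply: cmeas_expi; exact: measurable_funM.
  by apply: (cL1Z (M := 1) me); [move=> t; rewrite normc_expi|exact: cL1_expw].
rewrite real_complex_prod; under eq_bigr do rewrite -cint_expi_expw//.
have [_ <-] := (@cint_prod_tnth R n _ iphi).
apply: eq_cint => xi; rewrite big_split/= -expi_sum -real_complex_prod mulrA -expiD.
congr (expi _ * _); rewrite /dot -sumrN -big_split/=; apply: eq_bigr => i _.
by rewrite mulrBl addrC.
Qed.

Lemma cL1_poisson e (t : R) : 0 < e ->
  cL1 (@lebesgue_measure R) (fun r => (poisson e (t - r))%:C).
Proof.
move=> e0; apply: cL1_real.
- by apply: continuous_measurable_fun; exact: continuous_poisson.
- by move=> ?; exact: poisson_ge0.
- by rewrite poisson_integral// ltry.
Qed.

Lemma cL1_Kn e x : 0 < e -> cL1 mu (fun y => (Kn e x y)%:C).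
Proof.
move=> e0; have [+ _] := @cint_prod_tnth R n (fun i t => (poisson e (tnth x i - t))%:C)
  (fun i => cL1_poisson _ e0).
by under eq_fun do rewrite -real_complex_prod.
Qed.

Lemma integral_Kn e x : 0 < e -> (\int[mu]_y (Kn e x y)%:E)%E = ((2 * pi) ^+ n)%:E.
Proof.
move=> e0; have [_ +] := @cint_prod_tnth R n (fun i t => (poisson e (tnth x i - t))%:C)
  (fun i => cL1_poisson _ e0).
under eq_cint do rewrite -real_complex_prod.
rewrite cint_real; under eq_bigr do rewrite cint_real.
rewrite -real_complex_prod => -[E].
rewrite Rintegral_cL1_fine; last exact: cL1_Re (cL1_Kn x e0).
congr EFin; rewrite E -[X in _ ^+ X](card_ord n) -prodr_const.
by apply: eq_bigr => i _; rewrite /Rintegral poisson_integral.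
Qed.

Lemma cmeas_fourier_int u : cmeas u -> cmeas (fourier_int u).
Proof.
move=> mut; apply: (@cmeas_cint _ _ _ _ _ mu (fun z : Rn * Rn => expi (- dot z.1 z.2) * u z.2)).
apply: cmeasM; last by apply: cmeas_comp mut; exact: measurable_snd.
apply: cmeas_expi; apply: measurableT_comp => //; apply: measurable_dot => //.
Qed.

Lemma cL1_expiM u (h : Rn -> R) : measurable_fun setT h -> cL1 mu u ->
  cL1 mu (fun x => expi (h x) * u x).
Proof.
move=> mh iu; apply: (cL1Z (M := 1)) => //; first exact: cmeas_expi.
by move=> x; rewrite normc_expi.
Qed.

Lemma measurable_dotr x : measurable_fun setT (fun y => dot x y).
Proof. exact: measurable_dot. Qed.

Lemma cL1_expi_dot x u : cL1 mu u -> cL1 mu (fun y => expi (dot x y) * u y).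
Proof. exact: (cL1_expiM (measurable_dotr x)). Qed.

Lemma cL1_expiN_dot x u : cL1 mu u -> cL1 mu (fun y => expi (- dot x y) * u y).
Proof. exact: (cL1_expiM (h := fun y => - dot x y) (measurable_funN (measurable_dotr x))). Qed.

Lemma fourier_int_bounded u : cL1 mu u -> exists M : R, forall xi, nsq (fourier_int u xi) <= M.
Proof.
move=> iu; have fu : L1norm mu u \is a fin_num by rewrite ge0_fin_numE ?L1norm_ge0//; exact: iu.2.
exists (2 * (fine (L1norm mu u)) ^+ 2) => xi.
have iE : cL1 mu (fun x => expi (- dot xi x) * u x).
  exact: cL1_expiN_dot.
rewrite -lee_fin (le_trans (normc_cint iE))//.
rewrite EFinM EFin_expe fineK// /L1norm.
by under eq_integral do rewrite Normc.normcM normc_expi mul1r.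
Qed.

(** Both sides are iterated integrals of [expi (- dot xi x) * (phi xi * u x)], whose exponential is
    symmetric in the two variables. *)
Lemma multiplication_formula u phi : cL1 mu u -> cL1 mu phi ->
  cint mu (fun xi => fourier_int u xi * phi xi) =
  cint mu (fun x => u x * fourier_int phi x).
Proof.
move=> iu iphi.
pose G (z : Rn * Rn) := expi (- dot z.1 z.2) * (phi z.1 * u z.2).
have iG : cL1 (mu \x mu)%E G.
  apply: (@cL1_tensor _ _ _ _ _ _ _ 1) => //.
  - by apply: cmeas_expi; apply: measurableT_comp => //; exact: measurable_dot.
  - by move=> z; rewrite normc_expi.
have := cint_Fubini iG.
rewrite /G/= => E; transitivity (cint mu (fun x => cint mu (fun y => G (x, y)))).
  apply: eq_cint => xi.
  rewrite -[fourier_int u xi]/(cint mu (fun x => expi (- dot xi x) * u x)) -cintZr; last first.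
    exact: cL1_expiN_dot.
  by apply: eq_cint => x; rewrite /G/=; ring.
rewrite /G/= E; apply: eq_cint => x.
rewrite -[fourier_int phi x]/(cint mu (fun y => expi (- dot x y) * phi y)) -cintZ; last first.
  exact: cL1_expiN_dot.
by apply: eq_cint => xi; rewrite dotC; ring.
Qed.

(** The multiplication formula for the modulated weight, whose transform is the Poisson kernel
    centred at [x]. The weight makes the left integral converge although [fourier_int u] is only
    known to be bounded. *)
Lemma fourier_int_Wn e u x : 0 < e -> cL1 mu u ->
  cint mu (fun xi => expi (dot x xi) * (fourier_int u xi * (Wn e xi)%:C)) =
  cint mu (fun y => u y * (Kn e x y)%:C).
Proof.
move=> e0 iu.
have iphi : cL1 mu (fun xi => expi (dot x xi) * (Wn e xi)%:C).
  by apply: cL1_expi_dot; exact: cL1_Wn.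
under eq_cint do rewrite mulrCA.
rewrite multiplication_formula//; apply: eq_cint => y; congr (_ * _).
exact: cint_expi_Wn.
Qed.

End multiplication_formula.

(** * Plancherel's inequality on the intersection of L^1 and L^2 *)

Section plancherel.
Context {R : realType} (n : nat).
Local Notation Rn := (n.-tuple R).
Local Notation mu := (@lebesgue_Rn R n).
Implicit Types (u phi : Rn -> R[i]) (x y xi : Rn) (e : R).

(** [Kn] is symmetric with mass [(2 * pi) ^+ n] in each variable, so by Tonelli each of the two
    summands contributes half of the right side. *)
Lemma integral_nsqKn e u : 0 < e -> cmeas u ->
  (\int[(mu \x mu)%E]_z (2^-1 * (nsq (u z.1) + nsq (u z.2)) * Kn e z.1 z.2)%:E =
   ((2 * pi) ^+ n)%:E * N2 mu u)%E.
Proof.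
move=> e0 mut.
have mK := measurable_Kn (n := n) e0.
have mn1 : measurable_fun setT (fun z : Rn * Rn => nsq (u z.1)).
  exact: (measurableT_comp (measurable_nsq mut) measurable_fst).
have mn2 : measurable_fun setT (fun z : Rn * Rn => nsq (u z.2)).
  exact: (measurableT_comp (measurable_nsq mut) measurable_snd).
pose g1 (z : Rn * Rn) := (2^-1 * nsq (u z.1) * Kn e z.1 z.2)%:E.
pose g2 (z : Rn * Rn) := (2^-1 * nsq (u z.2) * Kn e z.1 z.2)%:E.
have g10 z : (0 <= g1 z)%E by rewrite lee_fin !mulr_ge0 ?nsq_ge0 ?Kn_ge0.
have g20 z : (0 <= g2 z)%E by rewrite lee_fin !mulr_ge0 ?nsq_ge0 ?Kn_ge0.
have mg1 : measurable_fun setT g1.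
  by apply/measurable_EFinP; do 2 (apply: measurable_funM => //).
have mg2 : measurable_fun setT g2.
  by apply/measurable_EFinP; do 2 (apply: measurable_funM => //).
have half x : (\int[mu]_y (2^-1 * nsq (u x) * Kn e x y)%:E =
    (2^-1 * (2 * pi) ^+ n)%:E * (nsq (u x))%:E)%E.
  under eq_integral do rewrite EFinM.
  rewrite ge0_integralZl_EFin//.
  - by rewrite integral_Kn// -!EFinM mulrAC.
  - by move=> y _; rewrite lee_fin Kn_ge0.
  - by apply/measurable_EFinP; exact: (measurableT_comp mK (measurable_pair1 x)).
  - by rewrite mulr_ge0 ?nsq_ge0.
have pi0 : 0 <= 2^-1 * (2 * pi) ^+ n :> R.
  by rewrite mulr_ge0// exprn_ge0// mulr_ge0// pi_ge0.
have int : (\int[mu]_x ((2^-1 * (2 * pi) ^+ n)%:E * (nsq (u x))%:E) =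
   (2^-1 * (2 * pi) ^+ n)%:E * N2 mu u)%E.
  rewrite ge0_integralZl_EFin//.
  - by move=> x _; rewrite lee_fin nsq_ge0.
  - by apply/measurable_EFinP; exact: measurable_nsq.
transitivity (\int[(mu \x mu)%E]_z (g1 z + g2 z))%E.
  by apply: eq_integral => z _; rewrite /g1 /g2 -EFinD -mulrDl mulrDr.
rewrite ge0_integralD// fubini_tonelli1// fubini_tonelli2// /fubini_F /fubini_G /g1 /g2 /=.
under eq_integral do rewrite half.
under [X in (_ + X)%E]eq_integral => y _.
  under eq_integral do rewrite KnC.
  rewrite half.
  over.
rewrite int -ge0_muleDl ?lee_fin// -EFinD; congr (_%:E * _)%E.
by rewrite -mulrDl (_ : 2^-1 + 2^-1 = 1 :> R) ?mul1r//; field.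
Qed.

Lemma normc_Kn_le e x y : 0 < e -> Normc.normc (Kn e x y)%:C <= (2 / e) ^+ n.
Proof. by move=> e0; rewrite normc_real ger0_norm ?Kn_ge0// Kn_le. Qed.

Lemma cL1_Kn_mul e u x : 0 < e -> cL1 mu u -> cL1 mu (fun y => (Kn e x y)%:C * u y).
Proof.
move=> e0 iu; have mK : cmeas (fun y => (Kn e x y)%:C).
  by apply: cmeas_real; exact: (measurableT_comp (measurable_Kn e0) (measurable_pair1 x)).
exact: (cL1Z mK (fun y => normc_Kn_le x y e0) iu).
Qed.

Lemma cL1_mulKn e u x : 0 < e -> cL1 mu u -> cL1 mu (fun y => u y * (Kn e x y)%:C).
Proof. by move=> e0 /(cL1_Kn_mul x e0); under eq_fun do rewrite mulrC. Qed.

(** The multiplication formula, tested on the conjugate of the damped transform, identifies the left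
    side with the quadratic form of [Kn] at [u]; [Re_mulconj_le] then bounds its integrand by that
    of [integral_nsqKn]. *)
Lemma integral_nsq_fourier_Wn e u : 0 < e -> cL1 mu u -> (N2 mu u < +oo)%E ->
  (\int[mu]_xi (nsq (fourier_int u xi) * Wn e xi)%:E <= ((2 * pi) ^+ n)%:E * N2 mu u)%E.
Proof.
move=> e0 iu u2.
have mut := iu.1; have mF := cmeas_fourier_int mut.
have [M FM] := fourier_int_bounded iu.
have nF xi : Normc.normc (fourier_int u xi) <= Num.sqrt M.
  by rewrite normcE2 ler_wsqrtr.
have iFW : cL1 mu (fun xi => fourier_int u xi * (Wn e xi)%:C).
  exact: (cL1Z mF nF (cL1_Wn n e0)).
pose phi xi := (fourier_int u xi)^* * (Wn e xi)%:C.
have iphi : cL1 mu phi.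
  apply: (cL1Z (cmeas_conj mF) (M := Num.sqrt M)); last exact: cL1_Wn.
  by move=> xi; rewrite normc_conj.
have iFphi : cL1 mu (fun xi => fourier_int u xi * phi xi).
  exact: (cL1Z mF nF).
have FphiE xi : fourier_int u xi * phi xi = (nsq (fourier_int u xi) * Wn e xi)%:C.
  by rewrite /phi mulrA mulc_conj rmorphM.
have step1 : (\int[mu]_xi (nsq (fourier_int u xi) * Wn e xi)%:E)%E =
    (complex.Re (cint mu (fun xi => fourier_int u xi * phi xi)))%:E.
  under [in RHS]eq_cint do rewrite FphiE.
  rewrite cint_real Rintegral_cL1_fine//.
  have iN : cL1 mu (fun xi => (nsq (fourier_int u xi) * Wn e xi)%:C).
    by rewrite -(funext FphiE).
  exact: cL1_Re iN.
(* Conjugation reverses the sign in the exponential, so the forward transform of [phi] is the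
   conjugate of a damped inverse integral. *)
have FphiK x : fourier_int phi x = (cint mu (fun y => u y * (Kn e x y)%:C))^*.
  rewrite -fourier_int_Wn// -cint_conj; last exact: cL1_expi_dot.
  apply: eq_cint => xi; rewrite expiN /phi !conj_mul.
  by rewrite conj_real.
pose G (z : Rn * Rn) := (Kn e z.1 z.2)%:C * (u z.1 * (u z.2)^*).
have iG : cL1 (mu \x mu)%E G.
  apply: (@cL1_tensor _ _ _ _ _ _ _ ((2 / e) ^+ n) _ u (fun y => (u y)^*)) => //.
  - by apply: cmeas_real; exact: measurable_Kn.
  - by move=> z; rewrite normc_real ger0_norm ?Kn_ge0// Kn_le.
  - exact: cL1_conj.
have iuK x := cL1_mulKn x e0 iu.
have step2 : cint mu (fun xi => fourier_int u xi * phi xi) = cint (mu \x mu)%E G.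
  rewrite multiplication_formula// cint_prod//; apply: eq_cint => x.
  rewrite FphiK -cint_conj// -cintZ; last exact: cL1_conj.
  apply: eq_cint => y; rewrite /G/= conj_mul conj_real; ring.
rewrite step1 step2 /cint/= -Rintegral_cL1_fine; last exact: cL1_Re.
rewrite -(integral_nsqKn e0 mut).
apply: le_integral => //.
- exact: cL1_Re.
- apply/integrableP; split.
    apply/measurable_EFinP; apply: measurable_funM; last exact: measurable_Kn.
    apply: measurable_funM => //; apply: measurable_funD.
    + exact: (measurableT_comp (measurable_nsq mut) measurable_fst).
    + exact: (measurableT_comp (measurable_nsq mut) measurable_snd).
  have g0 z : 0 <= 2^-1 * (nsq (u z.1) + nsq (u z.2)) * Kn e z.1 z.2.
    by apply: mulr_ge0; [apply: mulr_ge0 => //; apply: addr_ge0; exact: nsq_ge0|exact: Kn_ge0].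
  under eq_integral do rewrite gee0_abs ?lee_fin//.
  rewrite integral_nsqKn//; apply: lte_mul_pinfty => //.
  by rewrite lee_fin exprn_ge0// mulr_ge0// pi_ge0.
- move=> z _; rewrite lee_fin /G complex_ReM/= mul0r subr0 mulrC.
  by rewrite ler_wpM2r ?Kn_ge0// Re_mulconj_le.
Qed.

Definition eps (k : nat) : R := k.+1%:R^-1.

Lemma eps_gt0 k : 0 < eps k. Proof. by rewrite invr_gt0. Qed.

Lemma cvg_eps : eps k @[k --> \oo] --> (0 : R).
Proof. exact: cvg_harmonic. Qed.

Lemma cvg_prodr (I : Type) (s : seq I) (h : I -> nat -> R) (l : I -> R) :
  (forall i, h i k @[k --> \oo] --> l i) ->
  \prod_(i <- s) h i k @[k --> \oo] --> \prod_(i <- s) l i.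
Proof.
move=> hl; elim: s => [|i s ih].
  by rewrite big_nil; under eq_cvg do rewrite big_nil; exact: cvg_cst.
by rewrite big_cons; under eq_cvg do rewrite big_cons; apply: cvgM.
Qed.

Lemma cvg_Wn xi : Wn (eps k) xi @[k --> \oo] --> (1 : R).
Proof.
have := @cvg_prodr _ (index_enum 'I_n) (fun i k => expw (eps k) (tnth xi i)) (fun=> 1).
rewrite big1_eq; apply=> i.
rewrite /expw -[X in _ --> X]expR0.
apply: (@cvg_comp _ _ _ (fun k => - (eps k * `|tnth xi i|)) expR _ (nbhs (0 : R))).
  2: exact: continuous_expR.
rewrite -oppr0; apply: cvgN; rewrite -(mul0r `|tnth xi i|).
by apply: cvgM; [exact: cvg_eps|exact: cvg_cst].
Qed.

(** Fatou's lemma along the damping [Wn (eps k)], which tends to 1 while the bound stays independent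
    of [k]. *)
Lemma plancherel_le u : cL1 mu u -> (N2 mu u < +oo)%E ->
  (N2 mu (fourier_int u) <= ((2 * pi) ^+ n)%:E * N2 mu u)%E.
Proof.
move=> iu u2; have mF := cmeas_fourier_int iu.1.
pose f k xi := (nsq (fourier_int u xi) * Wn (eps k) xi)%:E.
have f0 k xi : (0 <= f k xi)%E by rewrite lee_fin mulr_ge0 ?nsq_ge0 ?Wn_ge0.
have mf k : measurable_fun setT (f k).
  apply/measurable_EFinP; apply: measurable_funM; last exact: measurable_Wn.
  exact: measurable_nsq.
have fE xi : limn_einf (f ^~ xi) = (nsq (fourier_int u xi))%:E.
  have c : f ^~ xi @ \oo --> (nsq (fourier_int u xi))%:E.
    apply: cvg_EFin; first exact: nearW.
    rewrite /f -[X in _ --> X]mulr1; apply: cvgM; first exact: cvg_cst.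
    exact: cvg_Wn.
  by have [-> _] := cvg_limn_einf_sup c.
rewrite /N2; under eq_integral do rewrite -fE.
apply: le_trans (fatou mu measurableT mf (fun k xi _ => f0 k xi)) _.
rewrite limn_einf_lim.
apply: lime_le; first exact: is_cvg_einfs.
apply: nearW => k.
apply: le_trans (ereal_inf_lbound _) (integral_nsq_fourier_Wn (eps_gt0 k) iu u2).
by exists k => /=.
Qed.

End plancherel.

(** * Extension to L^2 *)

Section L2_limits.
Context d (T : measurableType d) (R : realType).
Variable mu : {measure set T -> \bar R}.

Lemma ecvg0P (u : nat -> \bar R) : (forall k, (0 <= u k)%E) ->
  u k @[k --> \oo] --> 0%E <->
  (forall e : R, 0 < e -> \forall k \near \oo, (u k <= e%:E)%E).
Proof.
move=> u0; split.
  move/fine_cvgP => [ufin /cvgrPdist_le uc] e e0.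
  near=> k; have uf : u k \is a fin_num by near: k.
  rewrite -(fineK uf) lee_fin.
  have : `|0 - fine (u k)| <= e by near: k; exact: uc.
  by rewrite sub0r normrN ger0_norm// fine_ge0.
move=> h; apply/fine_cvgP; split.
  apply: filterS (h 1 ltr01) => k uk.
  by rewrite ge0_fin_numE//; apply: le_lt_trans uk _; rewrite ltry.
apply/cvgrPdist_le => e e0; apply: filterS (h e e0) => k uk /=.
rewrite sub0r normrN ger0_norm ?fine_ge0// -lee_fin fineK//.
by rewrite ge0_fin_numE//; apply: le_lt_trans uk _; rewrite ltry.
Unshelve. all: by end_near. Qed.

(** By monotone convergence the sum of the series has finite integral, hence is finite almost
    everywhere, and there its terms tend to 0. Completeness of L^2 and the final estimate on block
    sums both rest on this. *)
Lemma ae_cvg0_summable (h : nat -> T -> R) (M : R) :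
  (forall k, measurable_fun setT (h k)) -> (forall k x, 0 <= h k x) ->
  (forall K, \sum_(0 <= k < K) \int[mu]_x (h k x)%:E <= M%:E)%E ->
  {ae mu, forall x, h k x @[k --> \oo] --> (0 : R)}.
Proof.
move=> mh h0 hM.
have mhE k : measurable_fun setT (fun x => (h k x)%:E) by exact/measurable_EFinP.
have h0E k x : [set: T] x -> (0 <= (h k x)%:E)%E by rewrite lee_fin.
have iS : mu.-integrable setT (fun x => (\sum_(0 <= k <oo) (h k x)%:E)%E).
  apply/integrableP; split.
    by apply: ge0_emeasurable_sum => // k x xT _; exact: h0E.
  have S0 x : (0 <= \sum_(0 <= k <oo) (h k x)%:E)%E.
    by apply: nneseries_ge0 => k _ _; rewrite lee_fin.
  under eq_integral do rewrite gee0_abs//.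
  rewrite integral_nneseries//; apply: (@le_lt_trans _ _ M%:E); last by rewrite ltry.
  apply: lime_le.
    by apply: is_cvg_nneseries => k _ _; apply: integral_ge0 => x _; rewrite lee_fin.
  by apply: nearW => K; exact: hM.
apply: filterS (integrable_ae measurableT iS) => x /(_ I) Sfin.
apply: (@cvg_series_cvg_0 R R^o).
apply: nondecreasing_is_cvgn.
  by apply/nondecreasing_seqP => k; rewrite seriesSr lerDl.
exists (fine (\sum_(0 <= k <oo) (h k x)%:E)%E) => _ [K _ <-].
rewrite -lee_fin fineK// seriesEnat /= -sumEFin.
by apply: nneseries_lim_ge => k _ _; rewrite lee_fin.
Qed.

Lemma cvgn_geometric_increments (a : nat -> R) (S : R) :
  (forall k, `|a k.+1 - a k| <= S * 2^-1 ^+ k) -> cvgn a.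
Proof.
move=> ha.
have -> : a = (fun=> a 0%N) + series (telescope a).
  by apply/funext => k; rewrite [LHS]eq_sum_telescope.
apply: is_cvgD; first exact: is_cvg_cst.
apply: normed_cvg.
apply: (@series_le_cvg _ _ (geometric S 2^-1)).
- by move=> k /=.
- by move=> k /=; rewrite (le_trans _ (ha k)).
- by move=> k; exact: ha.
- by apply: is_cvg_geometric_series; rewrite ger0_norm// invf_lt1// ltr1n.
Qed.

Lemma geometric_sum_le (z : R) K : 0 <= z -> z < 1 ->
  \sum_(0 <= k < K) z ^+ k <= (1 - z)^-1.
Proof.
move=> z0 z1; have : z != 1 by rewrite lt_eqF.
move=> /(geometric_seriesE 1) /(congr1 (fun f => f K)) /=.
rewrite seriesEnat /= mul1r; under eq_bigr do rewrite mul1r.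
move=> ->; rewrite ler_piMl ?invr_ge0 ?subr_ge0 ?(ltW z1)//.
by rewrite lerBlDr lerDl exprn_ge0.
Qed.

(** This allows a limit to be defined everywhere by a measurable formula, the upper limit, and
    identified wherever convergence holds. *)
Lemma cvg_limn_esup_fine (a : nat -> R) : cvgn a ->
  a @ \oo --> fine (limn_esup (EFin \o a)).
Proof.
move=> /cvg_ex[l al].
have [_ ->] := cvg_limn_einf_sup (cvg_EFin (nearW _ (fun k => erefl (EFin (a k) \is a fin_num))) al).
exact: al.
Qed.

Lemma cvg_nsqB (u : nat -> R[i]) (z l : R[i]) :
  complex.Re (u k) @[k --> \oo] --> complex.Re l ->
  complex.Im (u k) @[k --> \oo] --> complex.Im l ->
  nsq (z - u k) @[k --> \oo] --> nsq (z - l).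
Proof.
move=> cR cI; rewrite /nsq complex_ReB complex_ImB.
under eq_fun do rewrite complex_ReB complex_ImB !expr2.
by apply: cvgD; rewrite expr2; apply: cvgM; apply: cvgB => //; exact: cvg_cst.
Qed.

Lemma measurable_fun_limn_einf (f : nat -> T -> \bar R) :
  (forall k, measurable_fun setT (f k)) ->
  measurable_fun setT (fun x => limn_einf (f ^~ x)).
Proof.
move=> mf; rewrite (_ : (fun _ => _) = -%E \o (fun x => limn_esup (fun k => (- f k x)%E))).
  apply: measurableT_comp => //; apply: measurable_fun_limn_esup => k.
  exact: measurableT_comp.
by apply/funext => x /=; rewrite (limn_esupN (f ^~ x)) oppeK.
Qed.

(** Riesz-Fischer with a geometric rate. Multiplying the squared increments by [4 ^+ k] leaves
    integrals of order [2^-1 ^+ k], which are summable; hence almost everywhere the increments are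
    at most a constant times [2^-1 ^+ k], and the sequence converges. Fatou's lemma carries the rate
    over to the limit. *)
Lemma N2_complete (w : nat -> T -> R[i]) (M : R) :
  (forall k, cmeas (w k)) ->
  (forall j k, (j <= k)%N -> (N2 mu (fun x => w j x - w k x)%R <= (M * 8^-1 ^+ j)%:E)%E) ->
  exists2 g, cmeas g &
    forall j, (N2 mu (fun x => w j x - g x)%R <= (M * 8^-1 ^+ j)%:E)%E.
Proof.
move=> mw hw.
have M0 : 0 <= M.
  by rewrite -lee_fin -[M]mulr1; apply: le_trans (hw 0%N 0%N isT); exact: N2_ge0.
pose gR x := fine (limn_esup (fun k => (complex.Re (w k x))%:E)).
pose gI x := fine (limn_esup (fun k => (complex.Im (w k x))%:E)).
have mgR : measurable_fun setT gR.
  apply: (measurableT_comp (fine_measurable measurableT)).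
  by apply: measurable_fun_limn_esup => k; apply/measurable_EFinP; exact: (mw k).1.
have mgI : measurable_fun setT gI.
  apply: (measurableT_comp (fine_measurable measurableT)).
  by apply: measurable_fun_limn_esup => k; apply/measurable_EFinP; exact: (mw k).2.
pose g x : R[i] := gR x +i* gI x.
have mg : cmeas g by split.
have mn (f : T -> R[i]) : cmeas f -> measurable_fun setT (fun x => (nsq (f x))%:E).
  by move=> mf; apply/measurable_EFinP; exact: measurable_nsq.
have wg : {ae mu, forall x, complex.Re (w k x) @[k --> \oo] --> gR x /\
    complex.Im (w k x) @[k --> \oo] --> gI x}.
  have : {ae mu, forall x, (4 ^+ k * nsq (w k x - w k.+1 x)) @[k --> \oo] --> (0 : R)}.
    apply: (@ae_cvg0_summable _ (2 * M)).
    - move=> k; apply: measurable_funM => //; apply: measurable_nsq; exact: cmeasB.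
    - by move=> k x; rewrite mulr_ge0 ?nsq_ge0// exprn_ge0.
    - move=> K; apply: (@le_trans _ _ (\sum_(0 <= k < K) (M * 2^-1 ^+ k)%:E)%E).
        apply: lee_sum => k _.
        under eq_integral do rewrite EFinM.
        rewrite ge0_integralZl_EFin//; last 2 first.
        + by move=> x _; rewrite lee_fin nsq_ge0.
        + by apply: mn; exact: cmeasB.
        apply: (@le_trans _ _ ((4 ^+ k)%:E * (M * 8^-1 ^+ k)%:E)%E).
          by apply: lee_wpmul2l; [rewrite lee_fin exprn_ge0|exact: hw].
        rewrite -EFinM lee_fin mulrCA -exprMn.
        by rewrite (_ : 4 * 8^-1 = 2^-1 :> R)//; field.
      rewrite sumEFin lee_fin -mulr_sumr mulrC ler_wpM2r//.
      apply: le_trans (geometric_sum_le K _ _) _; rewrite ?invr_ge0 ?invf_lt1 ?ltr1n//.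
      by rewrite le_eqVlt; apply/orP; left; apply/eqP; field.
  apply: filterS => x /(cvgP (0 : R)) /(@cvg_seq_bounded R R^o) [M' [M'r hM']].
  pose S := `|M'| + 1.
  have hS k : nsq (w k x - w k.+1 x) <= (Num.sqrt S * 2^-1 ^+ k) ^+ 2.
    have S0 : 0 <= S by rewrite addr_ge0.
    rewrite exprMn sqr_sqrtr// -exprM mulnC exprM (_ : 2^-1 ^+ 2 = 4^-1 :> R); last by field.
    have M'S : M' < S by rewrite (le_lt_trans (ler_norm _))// ltrDl.
    have /= := hM' S M'S k I.
    rewrite ger0_norm ?mulr_ge0 ?exprn_ge0 ?nsq_ge0// => h4.
    by rewrite exprVn ler_pdivlMr ?exprn_gt0// mulrC.
  have comp (p : R[i] -> R) : (forall z v, p (z - v) = p z - p v) ->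
     (forall z, p z ^+ 2 <= nsq z) -> cvgn (fun k => p (w k x)).
    move=> pB pn; apply: (@cvgn_geometric_increments _ (Num.sqrt S)) => k.
    rewrite -ler_sqr ?nnegrE ?mulr_ge0 ?exprn_ge0 ?sqrtr_ge0//.
    by rewrite real_normK ?num_real// -pB (le_trans (pn _))// nsqBC.
  have cR : complex.Re (w k x) @[k --> \oo] --> gR x.
    apply: cvg_limn_esup_fine; apply: comp => [z v|z]; first exact: complex_ReB.
    by rewrite lerDl sqr_ge0.
  have cI : complex.Im (w k x) @[k --> \oo] --> gI x.
    apply: cvg_limn_esup_fine; apply: comp => [z v|z]; first exact: complex_ImB.
    by rewrite lerDr sqr_ge0.
  by [].
exists g => // j.
have -> : N2 mu (fun x => w j x - g x) =
   (\int[mu]_x limn_einf (fun k => (nsq (w j x - w k x))%:E))%E.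
  apply: ge0_ae_eq_integral => //.
  - by apply: mn; exact: cmeasB.
  - by apply: measurable_fun_limn_einf => k; apply: mn; exact: cmeasB.
  - by move=> x _; rewrite lee_fin nsq_ge0.
  - move=> x _; rewrite limn_einf_lim; apply: lime_ge; first exact: is_cvg_einfs.
    by apply: nearW => k; apply: le_ereal_inf_tmp => _ [m _ <-]; rewrite lee_fin nsq_ge0.
  apply: filterS wg => x [cR cI] _; apply/esym.
  suff c : (fun k => (nsq (w j x - w k x))%:E) @ \oo --> (nsq (w j x - g x))%:E.
    by have [-> _] := cvg_limn_einf_sup c.
  apply: cvg_EFin; first exact: nearW.
  exact: cvg_nsqB.
apply: le_trans (fatou mu measurableT _ _) _.
- by move=> k; apply: mn; exact: cmeasB.
- by move=> k x _; rewrite lee_fin nsq_ge0.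
rewrite limn_einf_lim; apply: lime_le; first exact: is_cvg_einfs.
(* The infimum over the tail from [k] is at most the value at [maxn j k], an index to which [hw]
   applies. *)
apply: nearW => k; apply: le_trans (ereal_inf_lbound _) (hw j (maxn j k) (leq_maxl _ _)).
by exists (maxn j k) => //=; exact: leq_maxr.
Qed.

End L2_limits.

(** * The L^2 norm and its square *)

Section L2_norms.
Context (R : realType) (n : nat).
Local Notation Rn := (n.-tuple R).
Local Notation mu := (@lebesgue_Rn R n).
Implicit Types (f g u v : Rn -> R[i]).

Lemma cLnorm1E f : cLnorm 1%:E f = L1norm mu f.
Proof.
rewrite /cLnorm Lnorm1; apply: eq_integral => x _ /=.
by rewrite ger0_norm// normc_ge0.
Qed.

Lemma cLnorm2E f : cLnorm 2%:E f = (N2 mu f `^ 2^-1)%E.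
Proof.
rewrite /cLnorm unlock /=; congr (_ `^ _)%E; apply: eq_integral => x _ /=.
by rewrite ger0_norm ?normc_ge0// powR_mulrn ?normc_ge0// normc_sqr.
Qed.

Lemma poweR_half_le (x : \bar R) (e : R) : (0 <= x)%E -> 0 < e ->
  (x `^ 2^-1 <= e%:E)%E = (x <= (e ^+ 2)%:E)%E.
Proof.
move=> x0 e0; case: x x0 => [r r0| |//].
  rewrite poweR_EFin !lee_fin powR12_sqrt//.
  by rewrite -[RHS]ler_sqrt ?exprn_ge0 ?(ltW e0)// sqrtr_sqr ger0_norm// ltW.
by rewrite poweRyr ?invr_eq0// !leye_eq.
Qed.

Lemma cLnorm2_lty f : (cLnorm 2%:E f < +oo)%E <-> (N2 mu f < +oo)%E.
Proof.
rewrite cLnorm2E; split=> [|h]; last exact: poweR_lty.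
case: (N2 mu f) (N2_ge0 mu f) => [r _ _|_|//]; first by rewrite ltry.
by rewrite poweRyr ?invr_eq0.
Qed.

Lemma cLnorm2_cvg0 (u : nat -> Rn -> R[i]) :
  cLnorm 2%:E (u k) @[k --> \oo] --> 0%E <-> N2 mu (u k) @[k --> \oo] --> 0%E.
Proof.
under eq_cvg do rewrite cLnorm2E.
split=> /(ecvg0P _) h; apply/ecvg0P => [k|e e0].
- exact: N2_ge0.
- have e2 : 0 < Num.sqrt e by rewrite sqrtr_gt0.
  apply: filterS (h (fun=> poweR_ge0 _ _) _ e2) => k.
  by rewrite poweR_half_le ?N2_ge0// sqr_sqrtr// ltW.
- exact: poweR_ge0.
- apply: filterS (h (fun k => N2_ge0 mu (u k)) _ (exprn_gt0 2 e0)) => k.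
  by rewrite poweR_half_le ?N2_ge0.
Qed.

Definition L2 f := cmeas f /\ (N2 mu f < +oo)%E.

Lemma cLp2E f : cLp 2%:E f <-> L2 f.
Proof. by rewrite /cLp /L2 /= cLnorm2_lty. Qed.

Lemma cLp1E f : cLp 1%:E f <-> cL1 mu f.
Proof. by rewrite /cLp /cL1 /= cLnorm1E. Qed.

Lemma L2B f g : L2 f -> L2 g -> L2 (fun x => f x - g x).
Proof.
move=> [mf f2] [mg g2]; split; first exact: cmeasB.
have := @N2_le2 _ _ _ mu _ _ _ (cmeasB mf mg) mf mg (fun x => nsqB_le (f x) (g x)).
move=> /le_lt_trans; apply.
by rewrite lte_add_pinfty// lte_mul_pinfty.
Qed.

Lemma is_L2_extensionP (F : (Rn -> R[i]) -> Rn -> R[i]) f g :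
  is_L2_extension F f g <-> L2 g /\ exists u : nat -> Rn -> R[i],
    [/\ forall k, cL1 mu (u k) /\ L2 (u k),
        N2 mu (fun x => u k x - f x) @[k --> \oo] --> 0%E &
        N2 mu (fun x => F (u k) x - g x) @[k --> \oo] --> 0%E].
Proof.
split=> -[/cLp2E g2 [u [u12 uf ug]]]; split=> //; exists u; split.
- by move=> k; have [/cLp1E ? /cLp2E] := u12 k.
- exact/cLnorm2_cvg0.
- exact/cLnorm2_cvg0.
- by move=> k; have [? ?] := u12 k; split; [apply/cLp1E|apply/cLp2E].
- exact/cLnorm2_cvg0.
- exact/cLnorm2_cvg0.
Qed.

End L2_norms.

(** * Extension by density of an operator bounded in L^2 *)

Section L2_extension.
Context (R : realType) (n : nat).
Local Notation Rn := (n.-tuple R).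
Local Notation mu := (@lebesgue_Rn R n).
Implicit Types (f g u v : Rn -> R[i]) (F : (Rn -> R[i]) -> Rn -> R[i]).

(** The properties of the two Fourier integrals on which the extension by density relies, shared by
    both transforms. [C] bounds squared norms. *)
Definition L2_bounded_op F (C : R) : Prop := [/\ 0 <= C,
  forall u v, cL1 mu u -> cL1 mu v -> forall x, F (fun y => u y - v y) x = F u x - F v x,
  forall u, cL1 mu u -> cmeas (F u) &
  forall u, cL1 mu u -> L2 u -> (N2 mu (F u) <= C%:E * N2 mu u)%E].

Lemma N2_subrr f : N2 mu (fun x => f x - f x) = 0%E.
Proof. by rewrite /N2; under eq_integral do rewrite subrr nsq0; rewrite integral0. Qed.

Lemma N2B_tri_le f g h (a b : R) : cmeas f -> cmeas g -> cmeas h ->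
  (N2 mu (fun x => f x - g x)%R <= a%:E)%E -> (N2 mu (fun x => g x - h x)%R <= b%:E)%E ->
  (N2 mu (fun x => f x - h x)%R <= (2 * a + 2 * b)%:E)%E.
Proof.
move=> mf mg mh fa gb; apply: le_trans (N2B_tri mu mf mg mh) _.
apply: (@le_trans _ _ (2%:E * a%:E + 2%:E * b%:E)%E); last by rewrite -!EFinM -EFinD.
by apply: leeD; rewrite lee_pmul2l.
Qed.

Lemma is_L2_extension_self F C u : L2_bounded_op F C -> cL1 mu u -> L2 u ->
  is_L2_extension F u (F u).
Proof.
move=> [C0 FB Fm FC] u1 u2; apply/is_L2_extensionP; split.
  split; first exact: Fm.
  apply: le_lt_trans (FC u u1 u2) _.
  by apply: lte_mul_pinfty => //; exact: u2.2.
exists (fun=> u); split=> //.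
- by apply: cvg_near_cst; apply: nearW => k; exact: N2_subrr.
- by apply: cvg_near_cst; apply: nearW => k; exact: N2_subrr.
Qed.

(** The comparison passes through [F (u k)] and [F (u' k)] for arbitrary approximating sequences.
    The distance of [f] and [f'] is doubled by each of four triangle inequalities, which gives
    [16 * C]; for [f' = f] this is uniqueness up to a null set. *)
Lemma L2_extension_le F C f g f' g' : L2_bounded_op F C -> L2 f -> L2 f' ->
  is_L2_extension F f g -> is_L2_extension F f' g' ->
  (N2 mu (fun x => g x - g' x)%R <= (16 * C)%:E * N2 mu (fun x => f x - f' x)%R)%E.
Proof.
move=> [C0 FB Fm FC] f2 f2' /is_L2_extensionP[g2 [u [u12 /(ecvg0P (fun k => N2_ge0 _ _)) uf /(ecvg0P (fun k => N2_ge0 _ _)) ug]]].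
move=> /is_L2_extensionP[g2' [u' [u12' /(ecvg0P (fun k => N2_ge0 _ _)) uf' /(ecvg0P (fun k => N2_ge0 _ _)) ug']]].
apply/lee_addgt0Pr => e e0.
(* [6 + 24 * C] is the total multiple of [e1] accumulated by the triangle inequalities below. *)
pose e1 := e / (6 + 24 * C).
have d0 : 0 < 6 + 24 * C by rewrite ltr_wpDr// mulr_ge0.
have e10 : 0 < e1 by rewrite divr_gt0.
near \oo => k.
have h1 : (N2 mu (fun x => u k x - f x)%R <= e1%:E)%E by near: k; exact: uf.
have h2 : (N2 mu (fun x => F (u k) x - g x)%R <= e1%:E)%E by near: k; exact: ug.
have h3 : (N2 mu (fun x => u' k x - f' x)%R <= e1%:E)%E by near: k; exact: uf'.
have h4 : (N2 mu (fun x => F (u' k) x - g' x)%R <= e1%:E)%E by near: k; exact: ug'.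
have [[u1 u2] [u1' u2']] := (u12 k, u12' k).
have mFu := Fm _ u1; have mFu' := Fm _ u1'.
have F12 : (N2 mu (fun x => F (u k) x - F (u' k) x)%R <=
    C%:E * N2 mu (fun x => u k x - u' k x)%R)%E.
  rewrite (@eq_N2 _ _ _ mu _ (F (fun y => u k y - u' k y))); last by move=> x; rewrite FB.
  by apply: FC; [exact: cL1B|exact: L2B].
have [mf mf'] := (f2.1, f2'.1).
have Dfin : N2 mu (fun x => f x - f' x) \is a fin_num.
  by rewrite ge0_fin_numE ?N2_ge0//; have [] := L2B f2 f2'.
rewrite -(fineK Dfin); set D := fine _.
have hD : (N2 mu (fun x => f x - f' x)%R <= D%:E)%E by rewrite /D fineK.
rewrite N2BC in h2; rewrite N2BC in h3.
have t1 := N2B_tri_le mf mf' u1'.1 hD h3.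
have t2 := N2B_tri_le u1.1 mf u1'.1 h1 t1.
have t3 : (N2 mu (fun x => F (u k) x - F (u' k) x)%R
    <= (C * (2 * e1 + 2 * (2 * D + 2 * e1)))%:E)%E.
  by apply: le_trans F12 _; rewrite EFinM lee_wpmul2l// lee_fin.
have t4 := N2B_tri_le mFu mFu' g2'.1 t3 h4.
have := N2B_tri_le g2.1 mFu g2'.1 h2 t4.
move=> /le_trans; apply; rewrite -EFinM -EFinD lee_fin.
rewrite [X in _ <= _ + X](_ : e = e1 * (6 + 24 * C)); last by rewrite /e1 divfK// gt_eqF.
by rewrite le_eqVlt; apply/orP; left; apply/eqP; ring.
Unshelve. all: by end_near. Qed.

(** Cutting [f] off to an exhaustion by sets of finite measure gives L^1 functions because c <= 1 +
    c^2. The indices are then chosen to achieve the rate that [N2_complete] asks for. *)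
Lemma L2_truncation f : L2 f -> exists u : nat -> Rn -> R[i],
  (forall k, cL1 mu (u k) /\ L2 (u k)) /\
  forall k, (N2 mu (fun x => u k x - f x)%R <= (8^-1 ^+ k)%:E)%E.
Proof.
move=> [mf f2].
have /sigma_finiteP[B [TB ndB Boo]] := sigma_finiteT mu.
pose v k x : R[i] := (\1_(B k) x)%:C * f x.
have mv k : cmeas (v k).
  apply: cmeasM => //; apply: cmeas_real; apply: measurable_indic; exact: (Boo k).1.
have ind01 k x : \1_(B k) x = 0 :> R \/ \1_(B k) x = 1 :> R.
  by rewrite indicE; case: (x \in B k); [right|left].
have v2 k : L2 (v k).
  split=> //; apply: le_lt_trans f2; apply: le_N2 => // x.
  rewrite /v nsqM nsq_real; case: (ind01 k x) => ->.
    by rewrite expr0n mul0r nsq_ge0.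
  by rewrite expr1n mul1r.
have v1 k : cL1 mu (v k).
  split=> //.
  apply: (@le_lt_trans _ _ (\int[mu]_x ((\1_(B k) x)%:E + (nsq (f x))%:E))%E).
    apply: ge0_le_integral => //.
    + by move=> x _; rewrite lee_fin normc_ge0.
    + by apply/measurable_EFinP; exact: measurable_normc.
    + apply/measurable_EFinP/measurable_funD; last exact: measurable_nsq.
      by apply: measurable_indic; exact: (Boo k).1.
    + move=> x _; rewrite -EFinD lee_fin /v Normc.normcM normc_real.
      case: (ind01 k x) => ->.
        by rewrite normr0 mul0r add0r nsq_ge0.
      rewrite normr1 mul1r -normc_sqr.
      set a := Normc.normc _; have : 0 <= (a - 1) ^+ 2 + a ^+ 2 + 1.
        by rewrite !addr_ge0 ?sqr_ge0.
      by rewrite -subr_ge0 (_ : 1 + a ^+ 2 - a = ((a - 1) ^+ 2 + a ^+ 2 + 1) / 2)//;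
        [move=> h; rewrite divr_ge0|field].
  have i0 x : [set: Rn] x -> (0 <= (\1_(B k) x)%:E :> \bar R)%E by rewrite lee_fin.
  have mi : measurable_fun setT (fun x => (\1_(B k) x)%:E : \bar R).
    by apply/measurable_EFinP; apply: measurable_indic; exact: (Boo k).1.
  have n0 x : [set: Rn] x -> (0 <= (nsq (f x))%:E)%E by rewrite lee_fin nsq_ge0.
  have mn : measurable_fun setT (fun x => (nsq (f x))%:E).
    by apply/measurable_EFinP; exact: measurable_nsq.
  rewrite (ge0_integralD mu measurableT i0 mi n0 mn).
  rewrite integral_indic// ?setIT; last exact: (Boo k).1.
  by apply: lte_add_pinfty => //; exact: (Boo k).2.
have cv : N2 mu (fun x => v k x - f x) @[k --> \oo] --> 0%E.
  rewrite (_ : 0%E = (\int[mu]_x 0)%E); last by rewrite integral0.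
  apply: (@dominated_cvg _ _ _ mu setT _ _ _ (fun x => (nsq (f x))%:E)) => //.
  - by move=> k; apply/measurable_EFinP; apply: measurable_nsq; exact: cmeasB.
  - move=> x _; apply: cvg_near_cst.
    have [N _ BN] : (\bigcup_k B k) x by rewrite -TB.
    exists N => // k /= Nk; rewrite /v indicE mem_set ?mul1r ?subrr ?nsq0//.
    by move: BN; exact/subsetPset/ndB.
  - apply/integrableP; split; first by apply/measurable_EFinP; exact: measurable_nsq.
    by under eq_integral do rewrite gee0_abs ?lee_fin ?nsq_ge0//.
  - move=> k x _; rewrite gee0_abs ?lee_fin ?nsq_ge0// /v.
    case: (ind01 k x) => ->; first by rewrite mul0r sub0r nsqN.
    by rewrite mul1r subrr nsq0 nsq_ge0.
have /choice[j hj] : forall k, exists j, (N2 mu (fun x => v j x - f x)%R <= (8^-1 ^+ k)%:E)%E.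
  move=> k; move/(ecvg0P (fun k => N2_ge0 _ _)) : cv => /(_ (8^-1 ^+ k)).
  rewrite exprn_gt0// => /(_ isT) [N _ hN]; exists N; exact: hN (leqnn N).
by exists (fun k => v (j k)); split=> // k; split.
Qed.

Lemma is_L2_extension_ex F C f : L2_bounded_op F C -> L2 f ->
  exists g, is_L2_extension F f g.
Proof.
move=> bF f2; have [C0 FB Fm FC] := bF.
have [u [u12 uf]] := L2_truncation f2.
have mFu k : cmeas (F (u k)) by apply: Fm; exact: (u12 k).1.
(* For j <= k the squared distance of [u j] and [u k] is at most [2 * 8^-1 ^+ j + 2 * 8^-1 ^+ k],
   hence at most [4 * 8^-1 ^+ j]; this is the origin of [4 * C]. *)
have [|g mg hg] := @N2_complete _ _ _ mu (fun k => F (u k)) (4 * C) mFu.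
  move=> j k jk.
  rewrite (@eq_N2 _ _ _ mu _ (F (fun y => u j y - u k y))); last first.
    by move=> x; rewrite FB//; [exact: (u12 j).1|exact: (u12 k).1].
  apply: (le_trans (FC _ (cL1B (u12 j).1 (u12 k).1) (L2B (u12 j).2 (u12 k).2))).
  have uf' := uf k; rewrite N2BC in uf'.
  have := N2B_tri_le (u12 j).1.1 f2.1 (u12 k).1.1 (uf j) uf'.
  move=> h; apply: (@le_trans _ _ (C%:E * (4 * 8^-1 ^+ j)%:E)%E); last first.
    by rewrite -EFinM lee_fin mulrCA mulrA.
  rewrite lee_wpmul2l// ?lee_fin//; apply: le_trans h _; rewrite lee_fin.
  have : 8^-1 ^+ k <= 8^-1 ^+ j :> R by rewrite ler_wiXn2l// ?invr_ge0// invf_le1// ler1n.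
  lra.
have u0 : (forall k, 0 <= N2 mu (fun x => F (u k) x - g x)%R)%E by move=> k; exact: N2_ge0.
have geo (M : R) : 0 <= M -> M * 8^-1 ^+ k @[k --> \oo] --> (0 : R).
  by move=> M0; apply: cvg_geometric; rewrite ger0_norm// invf_lt1// ltr1n.
have sq (a : nat -> \bar R) M : 0 <= M -> (forall k, (0 <= a k)%E) ->
    (forall k, (a k <= (M * 8^-1 ^+ k)%:E)%E) -> a k @[k --> \oo] --> 0%E.
  move=> M0 a0 ha; apply: (@squeeze_cvge _ _ _ _ (fun=> 0%E) _ (fun k => (M * 8^-1 ^+ k)%:E)).
  - by apply: nearW => k; rewrite a0 ha.
  - exact: cvg_cst.
  - by apply: cvg_EFin; [exact: nearW|exact: geo].
exists g; apply/is_L2_extensionP; split; last first.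
  exists u; split=> //.
  - apply: (sq _ 1) => // k; first exact: N2_ge0.
    by rewrite mul1r.
  - by apply: (sq _ (4 * C)) => //; rewrite mulr_ge0.
split=> //.
have /L2B : L2 (F (u 0%N)).
  split=> //; apply: le_lt_trans (FC _ (u12 0%N).1 (u12 0%N).2) _.
  by apply: lte_mul_pinfty => //; exact: (u12 0%N).2.2.
have d2 : L2 (fun x => F (u 0%N) x - g x).
  split; first exact: cmeasB.
  by apply: le_lt_trans (hg 0%N) _; rewrite ltry.
move=> /(_ _ d2) [_]; rewrite (@eq_N2 _ _ _ mu _ (g))// => x.
by rewrite opprB addrC subrK.
Qed.

(** Existence ensures that the choice made by [xget] is a genuine extension and not the default
    value. *)
Lemma L2_extensionP F C f : L2_bounded_op F C -> L2 f ->
  is_L2_extension F f (L2_extension F f).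
Proof.
move=> bF f2; have [g gE] := is_L2_extension_ex bF f2.
by rewrite /L2_extension; case: xgetP => [h -> //|/(_ g)].
Qed.

End L2_extension.

(** * Fourier inversion *)

Section boxes.
Context (R : realType) (n : nat).
Local Notation Rn := (n.-tuple R).
Local Notation mu := (@lebesgue_Rn R n).

Definition boxset (c : 'I_n -> set R) : set Rn := [set x | forall i, c i (tnth x i)].

(** A pi-system that generates the sigma-algebra. [ocitv] includes the empty interval, as closure
    under intersection demands. *)
Definition boxes : set (set Rn) :=
  [set A | exists2 c : 'I_n -> set R, (forall i, ocitv (c i)) & A = boxset c].

Lemma ocitv_measurable (c : set R) : ocitv c -> measurable (c : set (measurableTypeR R)).
Proof. by move=> oc; apply: sub_sigma_algebra. Qed.

Lemma measurable_boxset c : (forall i, measurable (c i : set (measurableTypeR R))) ->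
  measurable (boxset c).
Proof.
move=> mc; rewrite (_ : boxset c = \bigcap_(i in [set: 'I_n]) ((fun x => tnth x i) @^-1` c i)).
  apply: fin_bigcap_measurable => // i _; rewrite -[X in measurable X]setTI.
  by apply: measurable_tnth => //; exact: mc.
by apply/seteqP; split => [x cx i _|x cx i]; [exact: cx|exact: (cx i I)].
Qed.

Lemma boxes_setI : setI_closed boxes.
Proof.
move=> _ _ [c oc ->] [c' oc' ->]; exists (fun i => c i `&` c' i).
  by move=> i; exact: ocitvI.
apply/seteqP; split => [x [cx cx'] i|x cx]; first by split.
by split=> i; have [] := cx i.
Qed.

Definition cube (N : nat) : set Rn := boxset (fun=> `](- N.+1%:R), N.+1%:R]%classic).

Lemma boxes_cube N : boxes (cube N).
Proof. by exists (fun=> `](- N.+1%:R), N.+1%:R]%classic) => // i; exact: is_ocitv. Qed.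

Lemma cube_cover (x : Rn) : exists N0, forall N, (N0 <= N)%N -> cube N x.
Proof.
pose M := \sum_(i < n) `|tnth x i|.
exists (Num.truncn M) => N MN i /=.
have MN1 : M < N.+1%:R.
  by rewrite (lt_le_trans (truncnS_gt M))// ler_nat.
have xM : `|tnth x i| <= M.
  by rewrite /M (bigD1 i)//= lerDl sumr_ge0.
rewrite in_itv/=; move: (le_lt_trans xM MN1); rewrite ltr_norml => /andP[-> /ltW ->].
by [].
Qed.

(** For a fixed coordinate, the sets [C] whose slab is generated by boxes form a sigma-algebra. It
    contains the half-open intervals, since a slab is the countable union of its intersections with
    the cubes. *)
Lemma measurable_boxes : (measurable : set (set Rn)) = <<s boxes >>.
Proof.
apply/seteqP; split; last first.
  apply: smallest_sub; first exact: sigma_algebra_measurable.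
  by move=> _ [c oc ->]; apply: measurable_boxset => i; exact: ocitv_measurable.
apply: smallest_sub; first exact: smallest_sigma_algebra.
move=> A; rewrite /= -bigcup_seq => -[i _ [B mB <-]].
pose H := [set C : set (measurableTypeR R) | <<s boxes >> [set x : Rn | C (tnth x i)]].
rewrite setTI; suff : measurable `<=` H by apply.
apply: smallest_sub.
  have [s0 sC sU] := smallest_sigma_algebra setT boxes.
  split.
  - by rewrite /H/= (_ : [set x | _] = set0).
  - by move=> C HC; rewrite /H /= (_ : [set x | _] = setT `\` [set x : Rn | C (tnth x i)]);
      [exact: sC|].
  - move=> F HF; rewrite /H /= (_ : [set x | _] = \bigcup_k [set x : Rn | F k (tnth x i)]).
      by apply: sU => k; exact: HF.
    by [].
move=> C oC; rewrite /H /=.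
have [s0 sC sU] := smallest_sigma_algebra setT boxes.
rewrite (_ : [set x | _] = \bigcup_N
   (boxset (fun j => if j == i then C else setT) `&` cube N)); last first.
  apply/seteqP; split => x.
    move=> Cx; have [N hN] := cube_cover x; exists N => //; split; last exact: hN (leqnn N).
    by move=> j; case: eqP => // ->.
  by move=> [N _ [/(_ i)]]; rewrite eqxx.
apply: sU => N; apply: sub_sigma_algebra.
exists (fun j => (if j == i then C else setT) `&` `](- N.+1%:R), N.+1%:R]%classic).
  move=> j; case: eqP => _; first by apply: ocitvI => //; exact: is_ocitv.
  by rewrite setTI; exact: is_ocitv.
apply/seteqP; split => [x [cx cx'] j|x cx]; first by split; [exact: cx|exact: cx'].
by split=> j; have [] := cx j.
Qed.

(** Dynkin's pi-lambda theorem for the class of sets over which [P] has integral 0. The total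
    integral is a separate hypothesis because in positive dimension the whole space is not a box; it
    yields stability under complements. *)
Lemma ae0_of_boxes (P : Rn -> R) : mu.-integrable setT (EFin \o P) ->
  (\int[mu]_x (P x)%:E = 0)%E ->
  (forall A, boxes A -> \int[mu]_(x in A) (P x)%:E = 0)%E ->
  {ae mu, forall x, P x = 0}.
Proof.
move=> iP P0 Pb.
have H : forall A, measurable A -> (\int[mu]_(x in A) (P x)%:E = 0)%E.
  pose H := [set A : set Rn | measurable A /\ (\int[mu]_(x in A) (P x)%:E = 0)%E].
  suff HH : <<s boxes >> `<=` H by move=> A; rewrite measurable_boxes => /HH [].
  have iPA A : measurable A -> mu.-integrable A (EFin \o P).
    by move=> mA; apply: integrableS iP.
  have bm A : boxes A -> measurable A.
    by move=> bA; rewrite measurable_boxes; exact: sub_sigma_algebra.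
  apply: lambda_system_subset.
  - exact: boxes_setI.
  - apply/dynkin_lambda_system; split.
    + by split.
    + move=> A [mA A0]; split; first exact: measurableC.
      have := @integral_setU _ _ _ mu _ _ (EFin \o P) mA (measurableC mA).
      rewrite setUv => /(_ (measurable_int _ iP)).
      rewrite disj_set2E setICr eqxx => /(_ isT).
      by rewrite /comp A0 add0e P0 => <-.
    + move=> F tF HF; split; first by apply: bigcupT_measurable => k; have [] := HF k.
      rewrite (integral_bigcup (g := EFin \o P))//.
      * rewrite (eq_eseriesr (g := fun=> 0%E)); last by move=> k _; have [] := HF k.
        by rewrite eseries0.
      * by move=> k; have [] := HF k.
      * by apply: iPA; apply: bigcupT_measurable => k; have [] := HF k.
  - by move=> A bA; split; [exact: bm|exact: Pb].
  - by [].
have := @integral_ae_eq _ _ _ mu setT measurableT (cst 0%E) (EFin \o P) iP.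
move=> /(_ (measurable_cst _)).
have E A : A `<=` setT -> measurable A -> (\int[mu]_(x in A) (EFin \o P) x = \int[mu]_(x in A) cst 0%E x)%E.
  by move=> _ mA; rewrite integral0; exact: H.
by move=> /(_ E); apply: filterS => x /(_ I) /= [].
Qed.

End boxes.

(** * L^2 bounds for the two Fourier integrals *)

Section fourier_bounded.
Context (R : realType) (n : nat).
Local Notation Rn := (n.-tuple R).
Local Notation mu := (@lebesgue_Rn R n).
Implicit Types (f g u v : Rn -> R[i]).

Lemma L2_bounded_fourier_int : L2_bounded_op (@fourier_int R n) ((2 * pi) ^+ n).
Proof.
split.
- by rewrite exprn_ge0// mulr_ge0// pi_ge0.
- move=> u v u1 v1 x; rewrite /fourier_int -[RHS]cintB; last 2 first.
  + exact: cL1_expiN_dot.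
  + exact: cL1_expiN_dot.
  by apply: eq_cint => y; rewrite mulrBr.
- by move=> u u1; apply: cmeas_fourier_int; exact: u1.1.
- by move=> u u1 [_ u2]; exact: plancherel_le.
Qed.

Lemma N2_conj f : N2 mu (fun x => (f x)^*) = N2 mu f.
Proof. by apply: eq_integral => x _; rewrite nsq_conj. Qed.

(** Conjugation turns the inverse integral into the forward one, so measurability and Plancherel's
    inequality carry over. *)
Lemma fourier_inv_intE g x : cL1 mu g -> fourier_inv_int g x =
  ((2 * pi) ^- n)%:C * (fourier_int (fun y => (g y)^*) x)^*.
Proof.
move=> g1; rewrite /fourier_inv_int; congr (_ * _).
rewrite -[fourier_int _ x]/(cint mu (fun y => expi (- dot x y) * (g y)^*)) -cint_conj; last first.
  by apply: cL1_expiN_dot; exact: cL1_conj.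
by apply: eq_cint => y; rewrite conj_mul expiN !conjCK dotC.
Qed.

Lemma L2_bounded_fourier_inv_int : exists C, L2_bounded_op (@fourier_inv_int R n) C.
Proof.
exists (nsq ((2 * pi) ^- n)%:C * (2 * pi) ^+ n); split.
- by rewrite mulr_ge0 ?nsq_ge0// exprn_ge0// mulr_ge0// pi_ge0.
- move=> u v u1 v1 x; rewrite /fourier_inv_int -mulrBr; congr (_ * _).
  have h w : cL1 mu w -> cL1 mu (fun xi => expi (dot xi x) * w xi).
    by move=> w1; under eq_fun do rewrite dotC; exact: cL1_expi_dot.
  rewrite -[RHS]cintB; [|exact: h|exact: h].
  by apply: eq_cint => y; rewrite mulrBr.
- move=> u u1; have -> : fourier_inv_int u = (fun x => ((2 * pi) ^- n)%:C * (fourier_int (fun y => (u y)^*) x)^*).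
    by apply/funext => x; rewrite fourier_inv_intE.
  apply: cmeasM; first exact: cmeas_cst.
  by apply: cmeas_conj; apply: cmeas_fourier_int; apply: cmeas_conj; exact: u1.1.
- move=> u u1 [_ u2]; have u1' := cL1_conj u1.
  have m1 := cmeas_fourier_int u1'.1.
  rewrite (@eq_N2 _ _ _ mu _ (fun x => ((2 * pi) ^- n)%:C * (fourier_int (fun y => (u y)^*) x)^*)); last first.
    by move=> x; rewrite fourier_inv_intE.
  rewrite N2Z; last exact: cmeas_conj.
  rewrite N2_conj EFinM -muleA; apply: lee_wpmul2l; first by rewrite lee_fin nsq_ge0.
  rewrite -(N2_conj u); apply: plancherel_le => //.
  by rewrite N2_conj.
Qed.

(** * The Poisson kernel integrated over a box *)

Variables (a b : 'I_n -> R).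
Hypothesis ab : forall i, a i < b i.

Definition Bab : set Rn := boxset (fun i => `]a i, b i]%classic).

(** Written as a product over the coordinates so that [cint_prod_tnth] applies. *)
Definition indB (x : Rn) : R := \prod_(i < n) \1_(`]a i, b i]%classic : set R) (tnth x i).

Lemma indBE x : indB x = \1_Bab x.
Proof.
rewrite indicE; case: (boolP (x \in Bab)) => [|].
  rewrite inE => Bx; rewrite /indB big1// => i _; rewrite indicE mem_set//; exact: Bx.
move=> /negP; rewrite inE => /existsNP[i xi].
by rewrite /indB (bigD1 i)//= indicE memNset// mul0r.
Qed.

Lemma indB01 x : indB x = 0 \/ indB x = 1.
Proof. by rewrite indBE indicE; case: (_ \in _); [right|left]. Qed.

Lemma cL1_indicator_itv (c d : R) :
  cL1 (@lebesgue_measure R) (fun r => (\1_(`]c, d]%classic : set R) r)%:C).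
Proof.
apply: cL1_real.
- by apply: measurable_indic; exact: measurable_itv.
- by move=> r.
- rewrite integral_indic// setIT.
  apply: (@le_lt_trans _ _ (@lebesgue_measure R [set` `]c, d]])) => //.
  by rewrite lebesgue_measure_itv/=; case: ifP => _; rewrite ?ltry// -EFinB ltry.
Qed.

Lemma cL1_indB : cL1 mu (fun x => (indB x)%:C).
Proof.
have [+ _] := @cint_prod_tnth R n (fun i r => (\1_(`]a i, b i]%classic : set R) r)%:C)
  (fun i => cL1_indicator_itv _ _).
by under eq_fun do rewrite -real_complex_prod.
Qed.

(** The integral of [Kn e] over the box in one of its variables, evaluated with the arctangent
    antiderivative. *)
Definition Phi (e : R) (y : Rn) : R :=
  \prod_(i < n) (2 * atan ((b i - tnth y i) / e) - 2 * atan ((a i - tnth y i) / e)).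

Lemma cint_indB_Kn e y : 0 < e ->
  cint mu (fun x => (Kn e x y * indB x)%:C) = (Phi e y)%:C.
Proof.
move=> e0.
have h i : cL1 (@lebesgue_measure R)
   (fun r => (\1_(`]a i, b i]%classic : set R) r * poisson e (tnth y i - r))%:C).
  have mp : measurable_fun setT (fun r : measurableTypeR R => poisson e (tnth y i - r)).
    by apply: continuous_measurable_fun; exact: continuous_poisson.
  have := cL1Z (M := 2 / e) (cmeas_real mp) _ (cL1_indicator_itv (a i) (b i)).
  have pl r : Normc.normc (poisson e (tnth y i - r))%:C <= 2 / e.
    by rewrite normc_real ger0_norm ?poisson_ge0// poisson_le.
  move=> /(_ pl); congr (cL1 _ _); apply/funext => r.
  by rewrite -rmorphM mulrC.
have [_ E] := @cint_prod_tnth R n _ h.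
transitivity (cint mu (fun x => \prod_(i < n) (\1_(`]a i, b i]%classic : set R) (tnth x i) *
    poisson e (tnth y i - tnth x i))%:C)).
  apply: eq_cint => x; rewrite -real_complex_prod big_split/= KnC mulrC.
  by [].
rewrite E /Phi real_complex_prod; apply: eq_bigr => i _; rewrite cint_real; congr (_ %:C).
rewrite /Rintegral.
under eq_integral do rewrite EFinM.
have := poisson_itv (tnth y i) e0 (ab i) => /(congr1 fine) /= <-; congr fine.
rewrite [RHS]integral_mkcond; apply: eq_integral => r _.
rewrite patchE indicE; case: (_ \in _); by rewrite ?mul1e ?mul0e.
Qed.

(** Fubini moves the smoothing from the arbitrary [u] to the indicator of the box. *)
Lemma cint_indB_conv e u : 0 < e -> cL1 mu u ->
  cint mu (fun x => (indB x)%:C * cint mu (fun y => u y * (Kn e x y)%:C)) =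
  cint mu (fun y => u y * (Phi e y)%:C).
Proof.
move=> e0 u1.
have mK := measurable_Kn (n := n) e0.
have nK (x y : Rn) := normc_Kn_le x y e0.
pose G (z : Rn * Rn) := (Kn e z.1 z.2)%:C * ((indB z.1)%:C * u z.2).
have iG : cL1 (mu \x mu)%E G.
  apply: (@cL1_tensor _ _ _ _ _ _ _ ((2 / e) ^+ n) _ (fun x => (indB x)%:C) u) => //.
  exact: cL1_indB.
have E := cint_Fubini iG.
transitivity (cint mu (fun x => cint mu (fun y => G (x, y)))).
  apply: eq_cint => x; rewrite -cintZ; last exact: cL1_mulKn.
  by apply: eq_cint => y; rewrite /G/=; ring.
rewrite E.
apply: eq_cint => y.
rewrite -(cint_indB_Kn y e0).
rewrite -[RHS]cintZ; last first.
  have := cL1_Kn_mul y e0 cL1_indB; congr (cL1 _ _); apply/funext => x.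
  by rewrite KnC -rmorphM.
by apply: eq_cint => x; rewrite /G/= rmorphM/=; ring.
Qed.

End fourier_bounded.

(** * Inversion tested on a single box *)

Section inversion.
Context (R : realType) (n : nat).
Local Notation Rn := (n.-tuple R).
Local Notation mu := (@lebesgue_Rn R n).
Implicit Types (f g u v : Rn -> R[i]).

Lemma cvg_atan_eps (c : R) : 0 < c -> atan (c / eps k) @[k --> \oo] --> (pi / 2 : R).
Proof.
move=> c0; under eq_fun do rewrite /eps invrK.
have h : (k.+1%:R : R) @[k --> \oo] --> +oo.
  by rewrite (cvg_shiftS (fun k => k%:R : R)); exact: cvgr_idn.
have l : c * x @[x --> +oo] --> +oo by apply: gt0_cvgMry => //; exact: cvg_id.
exact: (cvg_comp _ _ h (cvg_comp _ _ l (@cvgy_atan R))).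
Qed.

Lemma cvg_atan_epsN (c : R) : c < 0 -> atan (c / eps k) @[k --> \oo] --> (- (pi / 2) : R).
Proof.
move=> c0; rewrite (_ : (fun _ => _) = fun k => - atan (- c / eps k)); last first.
  by apply/funext => k; rewrite mulNr atanN opprK.
by apply: cvgN; apply: cvg_atan_eps; rewrite oppr_gt0.
Qed.

Variables (a b : 'I_n -> R).
Hypothesis ab : forall i, a i < b i.

Lemma Phi_le (e : R) y : 0 < e -> `|Phi a b e y| <= (2 * pi) ^+ n.
Proof.
move=> e0; rewrite -[X in _ ^+ X](card_ord n) -prodr_const normr_prod.
apply: ler_prod => i _; rewrite normr_ge0/=.
have := atan_ltpi2 ((b i - tnth y i) / e); have := atan_gtNpi2 ((b i - tnth y i) / e).
have := atan_ltpi2 ((a i - tnth y i) / e); have := atan_gtNpi2 ((a i - tnth y i) / e).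
move: (atan _) (atan _) => p q; move: (pi : R) => w h1 h2 h3 h4.
by rewrite ler_norml; apply/andP; split; lra.
Qed.

(** Off the boundary hyperplanes each arctangent tends to pi/2 or - pi/2 according to the side of
    the endpoint. In a coordinate inside the interval the two limits add up to 2 pi, outside they
    cancel. *)
Lemma Phi_cvg y : (forall i, tnth y i != a i /\ tnth y i != b i) ->
  Phi a b (eps k) y @[k --> \oo] --> (2 * pi) ^+ n * indB a b y.
Proof.
move=> yab.
have -> : (2 * pi) ^+ n * indB a b y =
    \prod_(i < n) (2 * pi * \1_(`]a i, b i]%classic : set R) (tnth y i)).
  by rewrite big_split/= prodr_const card_ord.
apply: (@cvg_prodr R 'I_n (index_enum 'I_n) (fun i k =>
  2 * atan ((b i - tnth y i) / eps k) - 2 * atan ((a i - tnth y i) / eps k))) => i.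
have [ya yb] := yab i; rewrite indicE.
have lim (p q : R) : atan ((b i - tnth y i) / eps k) @[k --> \oo] --> p ->
   atan ((a i - tnth y i) / eps k) @[k --> \oo] --> q ->
   2 * atan ((b i - tnth y i) / eps k) - 2 * atan ((a i - tnth y i) / eps k) @[k --> \oo] --> 2 * p - 2 * q.
  by move=> hp hq; apply: cvgB; apply: cvgM => //; exact: cvg_cst.
have abi := ab i.
have [yai|ayi] := ltP (tnth y i) (a i).
  rewrite memNset; last by rewrite /= in_itv/=; move=> /andP[]; rewrite ltNge (ltW yai).
  rewrite mulr0 -(subrr (2 * (pi / 2))); apply: lim; apply: cvg_atan_eps; rewrite subr_gt0//.
  exact: lt_trans abi.
have {}ayi : a i < tnth y i by rewrite lt_neqAle eq_sym ya.
have [byi|ybi] := ltP (b i) (tnth y i).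
  rewrite memNset; last by rewrite /= in_itv/=; move=> /andP[_]; rewrite leNgt byi.
  rewrite mulr0 -(subrr (2 * - (pi / 2))); apply: lim; apply: cvg_atan_epsN; rewrite subr_lt0//.
have {}ybi : tnth y i < b i by rewrite lt_neqAle yb.
rewrite mem_set; last by rewrite /= in_itv/= ayi ltW.
rewrite mulr1 (_ : 2 * pi = 2 * (pi / 2) - 2 * - (pi / 2)); last by field.
by apply: lim; [apply: cvg_atan_eps|apply: cvg_atan_epsN]; rewrite ?subr_gt0 ?subr_lt0.
Qed.

(** The hyperplane is a box with one side reduced to a point; the convention that 0 times infinity
    is 0 absorbs the unbounded sides. *)
Lemma negligible_slice (i : 'I_n) (c : R) : {ae mu, forall y : Rn, tnth y i != c}.
Proof.
pose A (j : 'I_n) : set R := if j == i then [set c] else setT.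
have mA j : measurable (A j : set (measurableTypeR R)).
  by rewrite /A; case: eqP => _; [exact: measurable_set1|exact: measurableT].
exists [set x : Rn | forall j, A j (tnth x j)]; split.
- exact: (measurable_boxset mA).
- rewrite lebesgue_Rn_box// (bigD1 i)//= {1}/A eqxx lebesgue_measure_set1 mul0e.
  by [].
- move=> y /= /negP; rewrite negbK => /eqP yc j; rewrite /A.
  by case: eqP => // ->.
Qed.

Lemma ae_boundary : {ae mu, forall y : Rn, forall i, tnth y i != a i /\ tnth y i != b i}.
Proof.
apply: filter_forall => i.
by apply: filterS2 (negligible_slice i (a i)) (negligible_slice i (b i)) => y.
Qed.

(** On a set of finite measure L^2 convergence implies L^1 convergence; here
    [c <= l + l^-1 * c ^+ 2] stands in for Cauchy-Schwarz. *)
Lemma L1norm_indB_cvg0 (p : nat -> Rn -> R[i]) : (forall k, cmeas (p k)) ->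
  N2 mu (p k) @[k --> \oo] --> 0%E ->
  L1norm mu (fun x => (indB a b x)%:C * p k x) @[k --> \oo] --> 0%E.
Proof.
move=> mp /(ecvg0P (fun k => N2_ge0 _ _)) p0.
have mI : measurable_fun setT (indB a b) by case: (cL1_indB a b) => -[].
have [M M0 IM] : exists2 M : R, 0 <= M & (\int[mu]_x (indB a b x)%:E = M%:E)%E.
  exists (\int[mu]_x indB a b x).
    by apply: Rintegral_ge0 => x _; case: (indB01 a b x) => ->.
  by rewrite Rintegral_cL1_fine//; exact: (cL1_Re (cL1_indB a b)).
apply/ecvg0P => [k|e e0]; first exact: L1norm_ge0.
(* This [l] makes the mass term [l * M] at most [e / 2]; the threshold [l * (e / 2)] for [N2] makes
   the other term at most [e / 2]. *)
pose l := e / (2 * (M + 1)).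
have l0 : 0 < l by rewrite divr_gt0// mulr_gt0// ltr_wpDl.
have le0 : 0 < l * (e / 2) by rewrite mulr_gt0// divr_gt0.
apply: filterS (p0 _ le0) => k pk.
have il0 : 0 <= l^-1 by rewrite invr_ge0 ltW.
apply: (@le_trans _ _ (\int[mu]_x (l%:E * (indB a b x)%:E + l^-1%:E * (nsq (p k x))%:E))%E).
  apply: ge0_le_integral => //.
  - by move=> x _; rewrite lee_fin normc_ge0.
  - apply/measurable_EFinP; apply: measurable_normc; apply: cmeasM => //; exact: cmeas_real.
  - apply/measurable_EFinP; apply: measurable_funD; apply: measurable_funM => //.
    exact: measurable_nsq.
  - move=> x _; rewrite -!EFinM -EFinD lee_fin Normc.normcM normc_real.
    case: (indB01 a b x) => ->.
      by rewrite normr0 mul0r mulr0 add0r mulr_ge0 ?nsq_ge0.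
    rewrite normr1 mul1r mulr1 -normc_sqr; set c := Normc.normc _.
    have : 0 <= l^-1 * ((c - l) ^+ 2 + l * c) by rewrite mulr_ge0// addr_ge0 ?sqr_ge0// mulr_ge0 ?normc_ge0// ltW.
    rewrite -[in X in _ -> X]subr_ge0 (_ : l^-1 * _ = l + l^-1 * c ^+ 2 - c)//.
    by field; rewrite gt_eqF.
have h1 x : [set: Rn] x -> (0 <= l%:E * (indB a b x)%:E)%E.
  by move=> _; rewrite -EFinM lee_fin mulr_ge0 ?(ltW l0)//; case: (indB01 a b x) => ->.
have h2 x : [set: Rn] x -> (0 <= l^-1%:E * (nsq (p k x))%:E)%E.
  by move=> _; rewrite -EFinM lee_fin mulr_ge0 ?nsq_ge0.
have m1 : measurable_fun setT (fun x => l%:E * (indB a b x)%:E)%E.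
  by apply/measurable_EFinP; exact: measurable_funM.
have m2 : measurable_fun setT (fun x => l^-1%:E * (nsq (p k x))%:E)%E.
  by apply/measurable_EFinP; apply: measurable_funM => //; exact: measurable_nsq.
rewrite (ge0_integralD mu measurableT h1 m1 h2 m2).
rewrite !ge0_integralZl_EFin//; first last.
- by rewrite ltW.
- by apply/measurable_EFinP.
- by move=> x _; rewrite lee_fin; case: (indB01 a b x) => ->.
- by apply/measurable_EFinP; exact: measurable_nsq.
- by move=> x _; rewrite lee_fin nsq_ge0.
rewrite IM; apply: (@le_trans _ _ (l%:E * M%:E + l^-1%:E * (l * (e / 2))%:E)%E).
  by apply: leeD => //; rewrite lee_pmul2l// lte_fin invr_gt0.
rewrite -!EFinM -EFinD lee_fin mulKf ?gt_eqF//.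
have -> : e = l * (2 * (M + 1)) by rewrite /l divfK// gt_eqF// mulr_gt0// ltr_wpDl.
rewrite (_ : l * M + _ = l * (2 * M + 1)); last by field.
by rewrite ler_wpM2l ?(ltW l0)//; lra.
Qed.

Lemma cL1_indB_L2 p : L2 p -> cL1 mu (fun x => (indB a b x)%:C * p x).
Proof.
move=> [mp p2].
have mI : measurable_fun setT (indB a b) by case: (cL1_indB a b) => -[].
have mIp : cmeas (fun x => (indB a b x)%:C * p x) by apply: cmeasM => //; exact: cmeas_real.
split=> //.
have i0 x : [set: Rn] x -> (0 <= (indB a b x)%:E)%E.
  by move=> _; rewrite lee_fin; case: (indB01 a b x) => ->.
have n0 x : [set: Rn] x -> (0 <= (nsq (p x))%:E)%E by rewrite lee_fin nsq_ge0.
have mi : measurable_fun setT (fun x => (indB a b x)%:E) by apply/measurable_EFinP.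
have mn : measurable_fun setT (fun x => (nsq (p x))%:E).
  by apply/measurable_EFinP; exact: measurable_nsq.
apply: (@le_lt_trans _ _ (\int[mu]_x ((indB a b x)%:E + (nsq (p x))%:E))%E).
  apply: ge0_le_integral => //.
  - by move=> x _; rewrite lee_fin normc_ge0.
  - by apply/measurable_EFinP; exact: measurable_normc.
  - by apply/measurable_EFinP; apply: measurable_funD => //; exact: measurable_nsq.
  - move=> x _; rewrite -EFinD lee_fin Normc.normcM normc_real.
    case: (indB01 a b x) => ->; first by rewrite normr0 mul0r add0r nsq_ge0.
    rewrite normr1 mul1r -normc_sqr; set c := Normc.normc _.
    have := sqr_ge0 (c - 1); have := sqr_ge0 c; lra.
rewrite (ge0_integralD mu measurableT i0 mi n0 mn); apply: lte_add_pinfty => //.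
have := cL1_Re (cL1_indB a b) => /integrableP[_]; apply: le_lt_trans.
apply: ge0_le_integral => //; first exact: measurableT_comp.
by move=> x _; exact: lee_abs.
Qed.

Lemma nsq_cint_cvg0 (p : nat -> Rn -> R[i]) : (forall k, cL1 mu (p k)) ->
  L1norm mu (p k) @[k --> \oo] --> 0%E -> nsq (cint mu (p k)) @[k --> \oo] --> (0 : R).
Proof.
move=> ip /(ecvg0P (fun k => L1norm_ge0 _ _)) p0.
apply/cvgrPdist_le => e e0.
have e20 : 0 < Num.sqrt (e / 2) by rewrite sqrtr_gt0 divr_gt0.
apply: filterS (p0 _ e20) => k pk.
rewrite sub0r normrN ger0_norm ?nsq_ge0// -lee_fin.
apply: le_trans (normc_cint (ip k)) _.
have fp : L1norm mu (p k) \is a fin_num.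
  by rewrite ge0_fin_numE ?L1norm_ge0//; exact: (ip k).2.
move: pk; rewrite -(fineK fp) -EFin_expe -EFinM !lee_fin => pk.
rewrite mulrC -ler_pdivlMr// -(@sqr_sqrtr _ (e / 2)) ?divr_ge0 ?(ltW e0)//.
by rewrite ler_sqr// ?nnegrE ?sqrtr_ge0// fine_ge0// L1norm_ge0.
Qed.

Lemma measurable_Phi k : measurable_fun setT (Phi a b (eps k)).
Proof.
apply: measurable_prod_fun => i.
have m c : measurable_fun setT (fun y : Rn => 2 * atan ((c - tnth y i) / eps k) : R).
  apply: measurable_funM => //; apply: measurableT_comp.
    by apply: continuous_measurable_fun; exact: continuous_atan.
  by apply: measurable_funM => //; apply: measurable_funB => //; exact: measurable_tnth.
by apply: measurable_funB.
Qed.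

(** Dominated convergence with majorant 2 |u|, as the normalised [Phi] and the indicator are both at
    most 1 in absolute value. *)
Lemma L1norm_Phi_cvg0 u : cL1 mu u ->
  L1norm mu (fun y => u y * ((2 * pi) ^- n * Phi a b (eps k) y - indB a b y)%:C) @[k --> \oo] --> 0%E.
Proof.
move=> u1.
have mI : measurable_fun setT (indB a b) by case: (cL1_indB a b) => -[].
have pi0 : 0 < 2 * pi :> R by rewrite mulr_gt0// pi_gt0.
have mPhi k := measurable_Phi k.
pose F k y := (Normc.normc (u y * ((2 * pi) ^- n * Phi a b (eps k) y - indB a b y)%:C))%:E.
have mF k : measurable_fun setT (F k).
  apply/measurable_EFinP; apply: measurable_normc; apply: cmeasM; first exact: u1.1.
  by apply: cmeas_real; apply: measurable_funB => //; exact: measurable_funM.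
pose g y := (Normc.normc (u y) * 2)%:E.
have ig : mu.-integrable setT g.
  have := integrableZr measurableT 2 (normc_integrable u1).
  by apply: eq_integrable => // y _; rewrite /g EFinM.
have := @dominated_convergence _ _ _ mu setT measurableT F (fun=> 0%E) g mF (measurable_cst _).
case=> //.
- apply: filterS ae_boundary => y yab _.
  rewrite /F; under eq_fun do rewrite Normc.normcM normc_real.
  apply: cvg_EFin; first exact: nearW.
  rewrite -(mulr0 (Normc.normc (u y))); apply: cvgM; first exact: cvg_cst.
  rewrite -[X in _ --> X](normr0 R); apply: cvg_norm.
  rewrite -(subrr (indB a b y)); apply: cvgB; last exact: cvg_cst.
  rewrite -[X in _ --> X](mulKf (lt0r_neq0 (exprn_gt0 n pi0))).
  by apply: cvgM; [exact: cvg_cst|exact: Phi_cvg].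
- apply/aeW => y k _; rewrite /F /g gee0_abs ?lee_fin ?normc_ge0//.
  rewrite Normc.normcM normc_real ler_wpM2l ?normc_ge0//.
  rewrite (le_trans (ler_normB _ _))// (_ : 2 = 1 + 1 :> R)// lerD//.
    rewrite normrM normfV normrX (gtr0_norm pi0) mulrC ler_pdivrMr ?exprn_gt0// mul1r.
    exact: (Phi_le _ (eps_gt0 k)).
  by case: (indB01 a b y) => ->; rewrite ?normr0 ?normr1.
- by move=> _ _; rewrite integral0.
Qed.

(* Testing against the indicator of a box moves the Poisson kernel onto the box,
   where its limit is explicit. *)
Lemma cint_indB_inversion u v : cL1 mu u -> L2 u ->
  is_L2_extension (@fourier_inv_int R n) (fourier_int u) v ->
  cint mu (fun x => (indB a b x)%:C * (v x - u x)) = 0.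
Proof.
move=> u1 u2 hv.
have bF := L2_bounded_fourier_int R n.
have [C bV] := L2_bounded_fourier_inv_int R n.
have mIc : cmeas (fun x : Rn => (indB a b x)%:C) by case: (cL1_indB a b).
have [M uM] := fourier_int_bounded u1.
have mh := cmeas_fourier_int u1.1.
have h2 : L2 (fourier_int u).
  split=> //; apply: le_lt_trans (plancherel_le u1 u2.2) _.
  by apply: lte_mul_pinfty => //; [rewrite lee_fin exprn_ge0// mulr_ge0// pi_ge0|exact: u2.2].
have v2 : L2 v by have /is_L2_extensionP [] := hv.
(* The damped transform is in L^1 and in L^2, so the inverse integral itself may be applied to it;
   [fourier_int u] is only known to be bounded and in L^2. *)
pose h k xi := fourier_int u xi * (Wn (eps k) xi)%:C.
have mW k : cmeas (fun xi : Rn => (Wn (eps k) xi)%:C) by apply: cmeas_real; exact: measurable_Wn.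
have h1 k : cL1 mu (h k).
  apply: (cL1Z (M := Num.sqrt M)) => //; last exact: cL1_Wn (eps_gt0 k).
  by move=> xi; rewrite normcE2 ler_wsqrtr.
have W01 k (xi : Rn) : 0 <= Wn (eps k) xi <= 1 by rewrite Wn_ge0 Wn_le1 ?eps_gt0.
have hk2 k : L2 (h k).
  split; first exact: cmeasM.
  apply: le_lt_trans h2.2; apply: le_N2 => //; first exact: cmeasM.
  move=> xi; rewrite /h nsqM nsq_real ler_piMr ?nsq_ge0//.
  by have /andP[w0 w1] := W01 k xi; rewrite exprn_ile1.
have hcv : N2 mu (fun xi => h k xi - fourier_int u xi) @[k --> \oo] --> 0%E.
  rewrite (_ : 0%E = (\int[mu]_x 0)%E); last by rewrite integral0.
  apply: (@dominated_cvg _ _ _ mu setT _ _ _ (fun x => (nsq (fourier_int u x))%:E)) => //.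
  - by move=> k; apply/measurable_EFinP; apply: measurable_nsq; apply: cmeasB => //; exact: cmeasM.
  - move=> xi _; apply: cvg_EFin; first exact: nearW.
    have E k : nsq (h k xi - fourier_int u xi) = nsq (fourier_int u xi) * (Wn (eps k) xi - 1) ^+ 2.
      by rewrite /h -[X in _ - X]mulr1 -mulrBr nsqM -(rmorph1 (real_complex R)) -rmorphB nsq_real.
    under eq_fun do rewrite E.
    rewrite -(mulr0 (nsq (fourier_int u xi))); apply: cvgM; first exact: cvg_cst.
    have w0 : Wn (eps k) xi - 1 @[k --> \oo] --> (0 : R).
      by rewrite -(subrr (1 : R)); apply: cvgB; [exact: cvg_Wn|exact: cvg_cst].
    by under eq_fun do rewrite expr2; rewrite -(mulr0 (0 : R)); exact: cvgM.
  - apply/integrableP; split; first by apply/measurable_EFinP; exact: measurable_nsq.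
    under eq_integral do rewrite gee0_abs ?lee_fin ?nsq_ge0//.
    exact: h2.2.
  - move=> k xi _; rewrite gee0_abs ?lee_fin ?nsq_ge0//.
    rewrite /h -[X in _ - X]mulr1 -mulrBr nsqM -(rmorph1 (real_complex R)) -rmorphB nsq_real.
    rewrite ler_piMr ?nsq_ge0// -sqrrN exprn_ile1// ?opprB ?subr_ge0 ?lerBlDr ?lerDl;
      by have /andP[] := W01 k xi.
have mVh k : cmeas (fourier_inv_int (h k)) by case: bV => _ _ + _; apply.
(* [v] and the inverse integral of [h k] both represent extensions, so [L2_extension_le] reduces
   their distance to that of [fourier_int u] and [h k]. *)
have Vcv : N2 mu (fun x => v x - fourier_inv_int (h k) x) @[k --> \oo] --> 0%E.
  have C0 : 0 <= 16 * C by case: bV => C0 _ _ _; rewrite mulr_ge0.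
  apply: (@squeeze_cvge _ _ _ _ (fun=> 0%E) _
    (fun k => (16 * C)%:E * N2 mu (fun xi => h k xi - fourier_int u xi)%R)%E).
  - apply: nearW => k; rewrite N2_ge0/=.
    rewrite N2BC.
    apply: (L2_extension_le bV (hk2 k) h2 _ hv).
    exact: is_L2_extension_self bV (h1 k) (hk2 k).
  - exact: cvg_cst.
  - by rewrite -[X in _ --> X](mule0 (16 * C)%:E); apply: cvgeZl.
pose c : R[i] := ((2 * pi) ^- n)%:C.
have cu1 : cL1 mu (fun y => c * u y).
  by apply: (cL1Z (M := Normc.normc c) (h := fun=> c)) => //; exact: cmeas_cst.
(* Damped inversion is convolution with the Poisson kernel; over the box it becomes [u] tested
   against the normalised [Phi]. *)
have conv k : cint mu (fun x => (indB a b x)%:C * fourier_inv_int (h k) x) =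
    cint mu (fun y => u y * ((2 * pi) ^- n * Phi a b (eps k) y)%:C).
  transitivity (cint mu (fun y => c * u y * (Phi a b (eps k) y)%:C)); last first.
    by apply: eq_cint => y; rewrite rmorphM/= -/c; ring.
  rewrite -cint_indB_conv ?eps_gt0//; apply: eq_cint => x; congr (_ * _).
  transitivity (c * cint mu (fun y => u y * (Kn (eps k) x y)%:C)); last first.
    rewrite -cintZ; last by apply: cL1_mulKn => //; exact: eps_gt0.
    by apply: eq_cint => y; rewrite mulrA.
  rewrite -fourier_int_Wn ?eps_gt0// /fourier_inv_int -/c; congr (_ * _).
  by apply: eq_cint => xi; rewrite dotC.
have vV2 k : L2 (fun x => v x - fourier_inv_int (h k) x).
  apply: L2B => //; split=> //; case: bV => C0 _ _ bV.
  apply: le_lt_trans (bV _ (h1 k) (hk2 k)) _.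
  by apply: lte_mul_pinfty => //; exact: (hk2 k).2.
have V2 k : L2 (fourier_inv_int (h k)).
  split=> //; case: bV => C0 _ _ bV.
  apply: le_lt_trans (bV _ (h1 k) (hk2 k)) _.
  by apply: lte_mul_pinfty => //; exact: (hk2 k).2.
have iB p (p2 : L2 p) := cL1_indB_L2 p2.
have pi0 : 0 < 2 * pi :> R by rewrite mulr_gt0// pi_gt0.
have iPhi k : cL1 mu (fun y => u y * ((2 * pi) ^- n * Phi a b (eps k) y)%:C).
  under eq_fun do rewrite mulrC.
  apply: (cL1Z (M := 1) (h := fun y => ((2 * pi) ^- n * Phi a b (eps k) y)%:C)) => //.
    by apply: cmeas_real; apply: measurable_funM => //; exact: measurable_Phi.
  move=> y; rewrite normc_real normrM normfV normrX (gtr0_norm pi0) mulrC.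
  by rewrite ler_pdivrMr ?exprn_gt0// mul1r; exact: (Phi_le _ (eps_gt0 k)).
have cv1 := nsq_cint_cvg0 (fun k => iB _ (vV2 k)) (L1norm_indB_cvg0 (fun k => (vV2 k).1) Vcv).
have iu : cL1 mu (fun y => u y * (indB a b y)%:C).
  by have := iB _ u2; under eq_fun do rewrite mulrC.
have i2 k : cL1 mu (fun y => u y * ((2 * pi) ^- n * Phi a b (eps k) y - indB a b y)%:C).
  have := cL1B (iPhi k) iu; congr (cL1 _ _); apply/funext => y.
  by rewrite rmorphB/= mulrBr.
have cv2 := nsq_cint_cvg0 i2 (L1norm_Phi_cvg0 u1).
set alpha := cint _ _.
(* [alpha] does not depend on [k], while both terms on the right tend to 0. *)
have split_alpha k : alpha = cint mu (fun x => (indB a b x)%:C * (v x - fourier_inv_int (h k) x)) +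
   cint mu (fun y => u y * ((2 * pi) ^- n * Phi a b (eps k) y - indB a b y)%:C).
  have E1 : alpha = cint mu (fun x => (indB a b x)%:C * v x) - cint mu (fun x => (indB a b x)%:C * u x).
    rewrite -cintB; [|exact: iB|exact: iB].
    by apply: eq_cint => x; rewrite mulrBr.
  have E2 : cint mu (fun x => (indB a b x)%:C * (v x - fourier_inv_int (h k) x)) =
     cint mu (fun x => (indB a b x)%:C * v x) - cint mu (fun x => (indB a b x)%:C * fourier_inv_int (h k) x).
    rewrite -cintB; [|exact: iB|exact: iB].
    by apply: eq_cint => x; rewrite mulrBr.
  have E3 : cint mu (fun y => u y * ((2 * pi) ^- n * Phi a b (eps k) y - indB a b y)%:C) =
     cint mu (fun y => u y * ((2 * pi) ^- n * Phi a b (eps k) y)%:C) - cint mu (fun x => (indB a b x)%:C * u x).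
    rewrite -cintB; [|exact: iPhi|exact: iB].
    by apply: eq_cint => y; rewrite rmorphB/= mulrBr; congr (_ - _); rewrite mulrC.
  by rewrite E1 E2 E3 conv addrA subrK.
apply: nsq_eq0; apply/eqP; rewrite eq_le nsq_ge0 andbT.
have lim0 : 2 * nsq (cint mu (fun x => (indB a b x)%:C * (v x - fourier_inv_int (h k) x))) +
   2 * nsq (cint mu (fun y => u y * ((2 * pi) ^- n * Phi a b (eps k) y - indB a b y)%:C)) @[k --> \oo] --> (0 : R).
  rewrite -(addr0 (0 : R)) -[X in _ --> X + _](mulr0 2) -[X in _ --> _ + X](mulr0 2).
  by apply: cvgD; (apply: cvgM; first exact: cvg_cst).
rewrite -(cvg_lim _ lim0)//; apply: limr_ge; first by apply/cvg_ex; eexists; exact: lim0.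
by apply: nearW => k; rewrite (split_alpha k) nsqD_le.
Qed.

End inversion.

(** * Inversion almost everywhere *)

Section fourier_inversion.
Context (R : realType) (n : nat).
Local Notation Rn := (n.-tuple R).
Local Notation mu := (@lebesgue_Rn R n).
Implicit Types (f g u v : Rn -> R[i]).

Lemma cint_boxes_inversion u v A : cL1 mu u -> L2 u ->
  is_L2_extension (@fourier_inv_int R n) (fourier_int u) v -> boxes A ->
  cL1 mu (fun x => (\1_A x)%:C * (v x - u x)) /\
  cint mu (fun x => (\1_A x)%:C * (v x - u x)) = 0.
Proof.
move=> u1 u2 hv [c oc ->].
have v2 : L2 v by have /is_L2_extensionP [] := hv.
(* A box with an empty side is treated apart, because [cint_indB_inversion] assumes [a i < b i] in
   every coordinate. *)
have [[i ci0]|/forallNP cN0] := pselect (exists i, c i = set0).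
  have E0 : (fun x : Rn => (\1_(boxset c) x)%:C * (v x - u x)) = (fun _ => 0 * 0).
    apply/funext => x; rewrite indicE memNset ?mul0r ?mulr0//.
    by move=> /(_ i); rewrite ci0.
  rewrite E0; split; last first.
    by rewrite mul0r /cint !Rintegral_cst//= mul0r.
  split; first by rewrite mul0r; exact: cmeas_cst.
  by rewrite /L1norm; under eq_integral do rewrite mul0r Normc.normc0; rewrite integral0.
have /choice[ab hab] : forall i, exists p : R * R, p.1 < p.2 /\ c i = `]p.1, p.2]%classic.
  move=> i; have /ocitvP[c0|[p p12 ->]] := oc i; first by have := cN0 i.
  by exists p.
pose a i := (ab i).1; pose b i := (ab i).2.
have ltab i : a i < b i by have [] := hab i.
have cE : boxset c = Bab a b.
  by congr boxset; apply/funext => i; have [] := hab i.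
have iE : (fun x => (\1_(boxset c) x)%:C * (v x - u x)) =
          (fun x => (indB a b x)%:C * (v x - u x)).
  by apply/funext => x; rewrite cE indBE.
rewrite iE; split; first by apply: cL1_indB_L2; exact: L2B.
exact: cint_indB_inversion.
Qed.

(** [w] is integrable on boxes but perhaps not globally, so [ae0_of_boxes] is applied to its
    restriction to each cube, one real component at a time. A box meets a cube in a box, and only
    countably many null sets are discarded. *)
Lemma ae0_of_cint_boxes (w : Rn -> R[i]) :
  (forall A, boxes A -> cL1 mu (fun x => (\1_A x)%:C * w x) /\
    cint mu (fun x => (\1_A x)%:C * w x) = 0) ->
  {ae mu, forall x, w x = 0}.
Proof.
move=> hw.
have comp (p : R[i] -> R) :
    (forall (r : R) z, p (r%:C * z) = r * p z) ->
    (forall g, cL1 mu g -> mu.-integrable setT (EFin \o (fun x => p (g x)))) ->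
    (forall g, cint mu g = 0 -> \int[mu]_x p (g x) = 0) ->
    {ae mu, forall x, p (w x) = 0}.
  move=> pM ip p0.
  have main A : boxes A -> mu.-integrable setT (EFin \o (fun x => \1_A x * p (w x))) /\
      (\int[mu]_x (\1_A x * p (w x))%:E = 0)%E.
    move=> /hw [h1 h2].
    have E : (fun x => p ((\1_A x)%:C * w x)) = (fun x => \1_A x * p (w x)).
      by apply/funext => x; rewrite pM.
    have i1 := ip _ h1; rewrite E in i1; split=> //.
    by rewrite Rintegral_cL1_fine//; have := p0 _ h2; rewrite E => ->.
  have cubeae N : {ae mu, forall x, \1_(@cube R n N) x * p (w x) = 0}.
    have [i1 i2] := main _ (@boxes_cube R n N).
    apply: ae0_of_boxes => // A bA.
    have [_ <-] := main _ (boxes_setI bA (@boxes_cube R n N)).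
    rewrite integral_mkcond; apply: eq_integral => x _.
    rewrite patchE indicI /=.
    by rewrite [\1_A x]indicE; case: (x \in A); rewrite ?mul1r ?mul0r.
  have /ae_foralln := cubeae; apply: filterS => x hx.
  have [N hN] := cube_cover x; have := hx N.
  by rewrite indicE mem_set ?mul1r//; exact: hN.
have hR : {ae mu, forall x, complex.Re (w x) = 0}.
  apply: comp.
  - by move=> r z; rewrite complex_ReM /= mul0r subr0.
  - exact: cL1_Re.
  - by move=> g; rewrite /cint => -[].
have hI : {ae mu, forall x, complex.Im (w x) = 0}.
  apply: comp.
  - by move=> r z; rewrite complex_ImM /= mul0r addr0.
  - exact: cL1_Im.
  - by move=> g; rewrite /cint => -[].
apply: filterS2 hR hI => x; case: (w x) => p q /= -> ->.
by [].
Qed.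

Lemma inversion_L1_L2 u v : cL1 mu u -> L2 u ->
  is_L2_extension (@fourier_inv_int R n) (fourier_int u) v -> {ae mu, forall x, v x = u x}.
Proof.
move=> u1 u2 hv.
have := ae0_of_cint_boxes (fun A => cint_boxes_inversion u1 u2 hv (A := A)).
by apply: filterS => x /eqP; rewrite subr_eq0 => /eqP.
Qed.

Lemma L2_fourier f : L2 f -> L2 (fourier f).
Proof.
by move=> f2; have /is_L2_extensionP [] := L2_extensionP (L2_bounded_fourier_int R n) f2.
Qed.

Lemma L2_fourier_inv g : L2 g -> L2 (fourier_inv g).
Proof.
move=> g2; have [C bV] := L2_bounded_fourier_inv_int R n.
by have /is_L2_extensionP [] := L2_extensionP bV g2.
Qed.

Lemma fourier_inv_le : exists2 C : R, 0 <= C & forall g g', L2 g -> L2 g' ->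
  (N2 mu (fun x => fourier_inv g x - fourier_inv g' x)%R
    <= C%:E * N2 mu (fun x => g x - g' x)%R)%E.
Proof.
have [C bV] := L2_bounded_fourier_inv_int R n.
exists (16 * C); first by case: bV => C0 _ _ _; rewrite mulr_ge0.
by move=> g g' g2 g2'; apply: (L2_extension_le bV) => //; exact: (L2_extensionP bV).
Qed.

(** Density, along the sequence [u] that defines [fourier f]: it approximates [f] while its
    transforms approximate [fourier f], and inversion is known for each [u k]. *)
Lemma fourierK f : L2 f -> {ae mu, forall x, fourier_inv (fourier f) x = f x}.
Proof.
move=> f2; have [C bV] := L2_bounded_fourier_inv_int R n.
have h2 := L2_fourier f2; have v2 := L2_fourier_inv h2.
have hV := L2_extensionP bV h2.
have /is_L2_extensionP[_ [u [u12 /(ecvg0P (fun k => N2_ge0 _ _)) uf /(ecvg0P (fun k => N2_ge0 _ _)) Fu]]] :=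
  L2_extensionP (L2_bounded_fourier_int R n) f2.
have C0 : 0 <= C by case: bV.
suff N0 : N2 mu (fun x => fourier_inv (fourier f) x - f x) = 0%E.
  have := N2_eq0_ae (cmeasB v2.1 f2.1) N0.
  by apply: filterS => x /eqP; rewrite subr_eq0 => /eqP.
apply/eqP; rewrite eq_le N2_ge0 andbT; apply/lee_addgt0Pr => e e0; rewrite add0e.
(* The final triangle inequality doubles the bounds [16 * C * e1] and [e1]. *)
pose e1 := e / (2 + 32 * C).
have d0 : 0 < 2 + 32 * C by rewrite ltr_wpDr// mulr_ge0.
have e10 : 0 < e1 by rewrite divr_gt0.
near \oo => k.
have h1 : (N2 mu (fun x => u k x - f x)%R <= e1%:E)%E by near: k; exact: uf.
have hF : (N2 mu (fun x => fourier_int (u k) x - fourier f x)%R <= e1%:E)%E by near: k; exact: Fu.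
have [u1 u2] := u12 k.
have Fu2 : L2 (fourier_int (u k)).
  split; first exact: cmeas_fourier_int u1.1.
  apply: le_lt_trans (plancherel_le u1 u2.2) _.
  by apply: lte_mul_pinfty => //; [rewrite lee_fin exprn_ge0// mulr_ge0// pi_ge0|exact: u2.2].
have [v hv] := is_L2_extension_ex bV Fu2.
have vu := inversion_L1_L2 u1 u2 hv.
have v2' : L2 v by have /is_L2_extensionP [] := hv.
have t1 : (N2 mu (fun x => fourier_inv (fourier f) x - v x)%R <= (16 * C * e1)%:E)%E.
  apply: le_trans (L2_extension_le bV h2 Fu2 hV hv) _.
  rewrite (EFinM (16 * C) e1); apply: lee_wpmul2l; first by rewrite lee_fin mulr_ge0.
  by rewrite N2BC.
have t2 : (N2 mu (fun x => v x - f x)%R <= e1%:E)%E.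
  rewrite (@N2_ae_eq _ _ _ mu _ (fun x => u k x - f x))//.
  - exact: cmeasB v2'.1 f2.1.
  - exact: cmeasB u1.1 f2.1.
  - by apply: filterS vu => x ->.
apply: le_trans (N2B_tri_le v2.1 v2'.1 f2.1 t1 t2) _; rewrite lee_fin.
rewrite (_ : e = e1 * (2 + 32 * C)); last by rewrite /e1 divfK// gt_eqF.
by rewrite le_eqVlt; apply/orP; left; apply/eqP; ring.
Unshelve. all: by end_near. Qed.

End fourier_inversion.

(** * Dyadic chaining *)

Section chaining.
Context {R : realType}.

Lemma lipschitz_of_derive (f df : R -> R) (p q : R) :
  (forall x : R, is_derive x (1 : R) f (df x)) -> (forall x, `|df x| <= 1) ->
  (f p - f q) ^+ 2 <= (p - q) ^+ 2.
Proof.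
move=> fd df1; wlog qp : p q / q <= p.
  move=> h; have [|/ltW] := leP q p; first exact: h.
  by move/h; rewrite -sqrrN opprB -[X in _ <= X]sqrrN opprB.
have cf : {within `[q, p], continuous f}.
  by apply: continuous_subspaceT; exact: is_derive_continuous fd.
have [c _ ->] := @MVT_segment R f df q p qp (fun x _ => fd x) cf.
rewrite exprMn ler_piMl ?sqr_ge0//.
by rewrite -(real_normK (num_real _)) exprn_ile1.
Qed.

Definition min1sq (x : R) := Num.min 1 (x ^+ 2).

Lemma min1sq_ge0 x : 0 <= min1sq x.
Proof. by rewrite /min1sq le_min ler01 sqr_ge0. Qed.

Lemma le_min1sq x y : `|x| <= `|y| -> min1sq x <= min1sq y.
Proof.
move=> xy; rewrite /min1sq le_min ge_min lexx/= ge_min; apply/orP; right.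
by rewrite -(real_normK (num_real x)) -(real_normK (num_real y)) lerXn2r.
Qed.

(** The bound 4 is trivial on the unit circle; for close arguments cosine and sine are each
    1-Lipschitz. *)
Lemma nsq_expiB_le (p q : R) : nsq (expi p - expi q) <= 4 * min1sq (p - q).
Proof.
have h1 : nsq (expi p - expi q) <= 4.
  by rewrite (le_trans (nsqB_le _ _))// !nsq_expi; lra.
have h2 : nsq (expi p - expi q) <= 2 * (p - q) ^+ 2.
  rewrite /nsq complex_ReB complex_ImB /= (_ : 2 = 1 + 1 :> R)// mulrDl !mul1r lerD//.
  - apply: (@lipschitz_of_derive cos (fun x => - sin x)) => x.
    by rewrite normrN sin_max.
  - by apply: (@lipschitz_of_derive sin cos) => x; exact: cos_max.
rewrite /min1sq; have [_|_] := leP 1 ((p - q) ^+ 2); first by rewrite mulr1.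
have := sqr_ge0 (p - q); lra.
Qed.

(** The terms grow geometrically until 2^l reaches z and decay afterwards. Instead of locating the
    switch, each term is dominated by an increment of [Phi], which covers the growth, plus a
    decrement of [Psi], which covers the decay; both telescope to at most 2 z. *)
Lemma dyadic_sum_le (z : R) (L : nat) : 0 <= z ->
  \sum_(0 <= l < L) Num.min (2 ^+ l) (z ^+ 2 / 2 ^+ l) <= 4 * z.
Proof.
move=> z0.
pose Phi l := Num.min (2 ^+ l) (2 * z) : R.
pose Psi l := Num.min (2 * z) (2 * z ^+ 2 / 2 ^+ l) : R.
have step l : Num.min (2 ^+ l) (z ^+ 2 / 2 ^+ l) <= (Phi l.+1 - Phi l) + (Psi l - Psi l.+1).
  rewrite /Phi /Psi (exprS 2 l); set x : R := 2 ^+ l.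
  have x0 : 0 < x by rewrite exprn_gt0.
  have -> : 2 * z ^+ 2 / (2 * x) = z ^+ 2 / x by field; rewrite gt_eqF.
  have -> : 2 * z ^+ 2 / x = 2 * (z ^+ 2 / x) by rewrite mulrA.
  have [xz|zx] := leP x z.
    have w1 : z <= z ^+ 2 / x by rewrite ler_pdivlMr// expr2 ler_wpM2l.
    have -> : Num.min (2 * x) (2 * z) = 2 * x by rewrite min_l// ler_pM2l.
    have -> : Num.min x (2 * z) = x by rewrite min_l//; lra.
    have -> : Num.min (2 * z) (2 * (z ^+ 2 / x)) = 2 * z by rewrite min_l// ler_pM2l.
    have h1 : Num.min x (z ^+ 2 / x) <= x by rewrite ge_min lexx.
    have h2 : Num.min (2 * z) (z ^+ 2 / x) <= 2 * z by rewrite ge_min lexx.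
    lra.
  have w1 : z ^+ 2 / x <= z by rewrite ler_pdivrMr// expr2 ler_wpM2l// ltW.
  have -> : Num.min (2 * z) (2 * (z ^+ 2 / x)) = 2 * (z ^+ 2 / x) by rewrite min_r// ler_pM2l.
  have -> : Num.min (2 * z) (z ^+ 2 / x) = z ^+ 2 / x by rewrite min_r//; lra.
  have -> : Num.min (2 * x) (2 * z) = 2 * z by rewrite min_r// ler_pM2l// ltW.
  have h1 : Num.min x (z ^+ 2 / x) <= z ^+ 2 / x by rewrite ge_min lexx orbT.
  have h2 : Num.min x (2 * z) <= 2 * z by rewrite ge_min lexx orbT.
  lra.
apply: (@le_trans _ _ (\sum_(0 <= l < L) ((Phi l.+1 - Phi l) + (Psi l - Psi l.+1)))).
  by apply: ler_sum => l _; exact: step.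
rewrite big_split/= telescope_sumr//.
rewrite (eq_bigr (fun l => - (Psi l.+1 - Psi l))); last by move=> l _; rewrite opprB.
rewrite sumrN telescope_sumr// opprB.
have h1 : Phi L <= 2 * z by rewrite /Phi ge_min lexx orbT.
have h2 : 0 <= Phi 0%N by rewrite /Phi le_min expr0 ler01 mulr_ge0.
have h3 : Psi 0%N <= 2 * z by rewrite /Psi ge_min lexx.
have h4 : 0 <= Psi L by rewrite /Psi le_min !mulr_ge0 ?sqr_ge0 ?invr_ge0 ?exprn_ge0.
lra.
Qed.

(* One passes from [p / 2 ^ i] to 0 by removing the binary digits of [p] one by one;
   the geometric weights come from [nsq_addle]. *)
Lemma dyadic_chain (F : R -> R[i]) (T q : R) (i p : nat) : 0 < q -> q < 1 -> (p < 2 ^ i)%N ->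
  nsq (F (p%:R / 2 ^+ i * T) - F 0) <=
  (1 - q)^-1 * \sum_(0 <= k < i) q ^- (i - k) * \sum_(0 <= p < 2 ^ k)
      nsq (F ((2 * p + 1)%:R / 2 ^+ k.+1 * T) - F (p%:R / 2 ^+ k * T)).
Proof.
move=> q0 q1; have q1' : 0 < (1 - q)^-1 by rewrite invr_gt0 subr_gt0.
pose Q k : R := \sum_(0 <= p < 2 ^ k)
      nsq (F ((2 * p + 1)%:R / 2 ^+ k.+1 * T) - F (p%:R / 2 ^+ k * T)).
have Q0 k : 0 <= Q k by apply: sumr_ge0 => *; exact: nsq_ge0.
elim: i p => [|i ih] p pi.
  move: pi; rewrite expn0 ltnS leqn0 => /eqP ->.
  by rewrite big_nil mulr0 !mul0r subrr nsq0.
have rec : \sum_(0 <= k < i.+1) q ^- (i.+1 - k) * Q k =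
    q^-1 * (\sum_(0 <= k < i) q ^- (i - k) * Q k + Q i).
  rewrite big_nat_recr//= subSnn expr1 mulrDr; congr (_ + _).
  rewrite mulr_sumr big_nat [RHS]big_nat; apply: eq_bigr => k /andP[_ ki].
  by rewrite subSn ?(ltnW ki)// exprS invfM mulrA.
set W := \sum_(0 <= k < i) q ^- (i - k) * Q k in rec.
rewrite -/(Q _); under eq_bigr do rewrite -/(Q _).
rewrite rec.
have W0 : 0 <= W by apply: sumr_ge0 => k _; rewrite mulr_ge0// invr_ge0 exprn_ge0// ltW.
have qi : 1 <= q^-1 by rewrite invf_ge1// ltW.
have hp : (p./2 < 2 ^ i)%N.
  by move: pi; rewrite expnS -{1}(odd_double_half p) -muln2; case: (odd p) => /= *; lia.
have := ih _ hp; under eq_bigr do rewrite -/(Q _).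
rewrite -/W => ihW.
have same : (p./2)%:R / 2 ^+ i = (2 * p./2)%:R / 2 ^+ i.+1 :> R.
  by rewrite natrM exprS; field; rewrite gt_eqF// exprn_gt0.
have [podd|peven] := boolP (odd p); last first.
  have -> : p%:R / 2 ^+ i.+1 = (p./2)%:R / 2 ^+ i :> R.
    by rewrite same -{1}(odd_double_half p) (negbTE peven) add0n mul2n.
  apply: le_trans ihW _; rewrite ler_pM2l//.
  by rewrite (@le_trans _ _ (W + Q i)) ?lerDl// ler_peMl// addr_ge0.
have pE : p = (2 * p./2 + 1)%N.
  by rewrite -{1}(odd_double_half p) podd mul2n addnC.
have term : nsq (F (p%:R / 2 ^+ i.+1 * T) - F ((p./2)%:R / 2 ^+ i * T)) <= Q i.
  rewrite {1}pE /Q (big_cat_nat (n := p./2))//=; last exact: ltnW.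
  rewrite [X in _ <= _ + X]big_ltn// addrCA lerDl addr_ge0//; apply: sumr_ge0 => *; exact: nsq_ge0.
(* The walk from the parent [p./2] to 0 is charged [q^-1] and the removed digit [(1 - q)^-1], so a
   digit pays [(1 - q)^-1] once and [q^-1] for each finer scale. *)
rewrite -(subrK (F ((p./2)%:R / 2 ^+ i * T)) (F _)) -addrA addrC.
apply: le_trans (nsq_addle _ _ q0 q1) _.
have -> : (1 - q)^-1 * (q^-1 * (W + Q i)) =
    q^-1 * ((1 - q)^-1 * W) + (1 - q)^-1 * (q^-1 * Q i) by ring.
apply: lerD; first by rewrite ler_wpM2l// invr_ge0 ltW.
by rewrite ler_pM2l//; apply: le_trans term _; rewrite ler_peMl.
Qed.

Variables (sigma A : R).
Hypotheses (sigma0 : 0 < sigma) (sigma1 : sigma < 1) (A0 : 0 < A).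

(* With r = sigma / (1 - sigma), this is A * 2 ^ (- l / r). *)
Definition scale (l : nat) : R := A * (2 ^- l) `^ sigma^-1 * 2 ^+ l.

(* The common ratio that remains when the weights rate ^ (- j) are paired with the
   gain (2 ^ sigma / 2) ^ j of dyadic_multiplier_le. *)
Definition rate : R := Num.sqrt (2 `^ sigma / 2).

Lemma rate_gt0 : 0 < rate.
Proof. by rewrite sqrtr_gt0 divr_gt0// powR_gt0. Qed.

Lemma rate_lt1 : rate < 1.
Proof.
rewrite -sqrtr1 ltr_sqrt// ltr_pdivrMr// mul1r -[X in _ < X](powRr1 (ler0n _ 2)).
by rewrite /powR gt_eqF// ltr_expR ltr_pM2r// ln_gt0// ltr1n.
Qed.

(** The argument of [min1sq] is the power 1/sigma of [W], that is, of (2^j A y)^sigma / 2^l. Since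
    sigma < 1, raising a number of [0, 1] to the power 1/sigma only decreases it, so [W] itself may
    be used; this gives the form summed by [dyadic_sum_le]. The factor 2^(-j) reflects the smaller
    number of differences at the coarser scale. *)
Lemma dyadic_multiplier_le (l j : nat) (y : R) : (j <= l)%N -> 0 <= y ->
  2 ^+ (l - j) * min1sq (scale l / 2 ^+ (l - j) * y) <=
  2 ^- j * Num.min (2 ^+ l) (((2 ^+ j * A * y) `^ sigma) ^+ 2 / 2 ^+ l).
Proof.
move=> jl y0; set k := (l - j)%N.
pose B := 2 ^+ j * A * y.
have B0 : 0 <= B by rewrite !mulr_ge0// ?exprn_ge0// ltW.
pose W := B `^ sigma * 2 ^- l.
have W0 : 0 <= W by rewrite mulr_ge0 ?powR_ge0// invr_ge0 exprn_ge0.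
have lE : 2 ^+ l = 2 ^+ k * 2 ^+ j :> R by rewrite -exprD subnK.
have k0 : 0 < 2 ^+ k :> R by rewrite exprn_gt0.
have j0 : 0 < 2 ^+ j :> R by rewrite exprn_gt0.
have XE : scale l / 2 ^+ k * y = W `^ sigma^-1.
  rewrite /W powRM ?powR_ge0 ?invr_ge0 ?exprn_ge0// -powRrM mulfV ?gt_eqF// powRr1//.
  by rewrite /scale /B lE; field; rewrite gt_eqF.
have XW : min1sq (scale l / 2 ^+ k * y) <= Num.min 1 (W ^+ 2).
  rewrite XE /min1sq le_min ge_min lexx/=.
  have [W1|W1] := leP W 1; last first.
    rewrite ge_min; apply/orP; left.
    by rewrite exprn_ege1// ltW.
  rewrite ge_min; apply/orP; right; rewrite lerXn2r ?nnegrE ?powR_ge0//.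
  have [->|Wn0] := eqVneq W 0; first by rewrite powR0// invr_eq0 gt_eqF.
  apply: ge1r_powR; first by rewrite lt_neqAle eq_sym Wn0 W0.
  by rewrite invf_ge1// ltW.
apply: (@le_trans _ _ (2 ^+ k * Num.min 1 (W ^+ 2))); first by rewrite ler_pM2l.
rewrite minr_pMr ?(ltW k0)// minr_pMr ?invr_ge0 ?(ltW j0)// mulr1.
rewrite le_eqVlt; apply/orP; left; apply/eqP; congr Num.min.
- by rewrite lE; field; rewrite gt_eqF.
- by rewrite /W -/B lE; field; rewrite !gt_eqF.
Qed.

(** For fixed [j] the sum over [l] is at most 2^(-j) 4 (2^j A y)^sigma, which is 4 (A y)^sigma times
    the [2 * j]-th power of [rate]; the weight cancels half of that power, and a geometric series in
    [j] remains. *)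
Lemma dyadic_multiplier_sum (L : nat) (y : R) : 0 <= y ->
  \sum_(0 <= l < L) \sum_(0 <= j < l.+1)
     rate ^- j * (2 ^+ (l - j) * min1sq (scale l / 2 ^+ (l - j) * y)) <=
  4 * (A * y) `^ sigma * (1 - rate)^-1.
Proof.
move=> y0; have q0 := rate_gt0; have q1 := rate_lt1.
have Ay0 : 0 <= A * y by rewrite mulr_ge0// ltW.
pose b l j : R := rate ^- j * (2 ^- j * Num.min (2 ^+ l) (((2 ^+ j * A * y) `^ sigma) ^+ 2 / 2 ^+ l)).
have b0 l j : 0 <= b l j.
  rewrite mulr_ge0 ?invr_ge0 ?exprn_ge0 ?(ltW q0)// mulr_ge0 ?invr_ge0 ?exprn_ge0//.
  by rewrite le_min exprn_ge0//= mulr_ge0 ?sqr_ge0// invr_ge0 exprn_ge0.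
(* The triangle [j <= l] is enlarged to a square so that the two sums can be exchanged. *)
apply: (@le_trans _ _ (\sum_(0 <= l < L) \sum_(0 <= j < L) b l j)).
  rewrite big_nat [leRHS]big_nat; apply: ler_sum => l /andP[_ lL].
  rewrite (big_cat_nat (n := l.+1) (leq0n _) lL)/= -[leLHS]addr0 lerD//; last first.
    by apply: sumr_ge0 => *; exact: b0.
  rewrite big_nat [leRHS]big_nat; apply: ler_sum => j /andP[_ jl].
  by rewrite ler_wpM2l ?invr_ge0 ?exprn_ge0 ?(ltW q0)// dyadic_multiplier_le.
rewrite exchange_big_nat/=.
apply: (@le_trans _ _ (\sum_(0 <= j < L) 4 * (A * y) `^ sigma * rate ^+ j)).
  apply: ler_sum => j _.
  rewrite -!mulr_sumr.
  apply: (@le_trans _ _ (rate ^- j * (2 ^- j * (4 * (2 ^+ j * A * y) `^ sigma)))).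
    rewrite ler_wpM2l ?invr_ge0 ?exprn_ge0 ?(ltW q0)// ler_wpM2l ?invr_ge0 ?exprn_ge0//.
    by apply: dyadic_sum_le; exact: powR_ge0.
  have pE : (2 ^+ j) `^ sigma = (2 `^ sigma) ^+ j.
    by rewrite -powR_mulrn// -[RHS]powR_mulrn ?powR_ge0// powRAC.
  have -> : 2 ^+ j * A * y = 2 ^+ j * (A * y) by rewrite mulrA.
  rewrite powRM ?exprn_ge0// pE.
  have rj : rate ^+ j * rate ^+ j = (2 `^ sigma) ^+ j / 2 ^+ j.
    by rewrite -exprMn -expr2 sqr_sqrtr ?divr_ge0 ?powR_ge0// expr_div_n.
  have rj0 : rate ^+ j != 0 by rewrite gt_eqF// exprn_gt0.
  rewrite le_eqVlt; apply/orP; left; apply/eqP.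
  transitivity (rate ^- j * ((2 `^ sigma) ^+ j / 2 ^+ j) * (4 * (A * y) `^ sigma)).
    by rewrite -!mulrA; congr (_ * _); ring.
  by rewrite -rj mulKf// mulrC.
rewrite -mulr_sumr ler_wpM2l ?mulr_ge0 ?powR_ge0//.
by apply: geometric_sum_le => //; exact: ltW.
Qed.

End chaining.

(** * L^2 estimate of the weighted block sums *)

Section maximal_sum.
Context (R : realType).

Lemma ge0_integral_wsum d (T : measurableType d) (mu : {measure set T -> \bar R})
  (I : Type) (s : seq I) (c : I -> R) (g : I -> T -> R) :
  (forall i, 0 <= c i) -> (forall i x, 0 <= g i x) -> (forall i, measurable_fun setT (g i)) ->
  (\int[mu]_x (\sum_(i <- s) c i * g i x)%:E = \sum_(i <- s) (c i)%:E * \int[mu]_x (g i x)%:E)%E.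
Proof.
move=> c0 g0 mg.
under eq_integral do rewrite -sumEFin.
rewrite ge0_integral_sum//.
- apply: eq_bigr => i _; under eq_integral do rewrite EFinM.
  rewrite ge0_integralZl_EFin//.
  + by move=> x _; rewrite lee_fin.
  + exact/measurable_EFinP.
- by move=> i; apply/measurable_EFinP; exact: measurable_funM.
- by move=> i x _; rewrite lee_fin mulr_ge0.
Qed.

Lemma sume_const_nat (x : \bar R) (m : nat) : (0 <= x)%E ->
  (\sum_(0 <= i < m) x = m%:R%:E * x)%E.
Proof.
move=> x0; elim: m => [|m ih]; first by rewrite big_nil mul0e.
by rewrite big_nat_recr//= ih -natr1 EFinD ge0_muleDl ?lee_fin// mul1e.
Qed.

Variables (n : nat).
Local Notation Rn := (n.-tuple R).
Local Notation mu := (@lebesgue_Rn R n).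

Lemma enorm_ge0 (x : Rn) : 0 <= enorm x.
Proof. exact: sqrtr_ge0. Qed.

Lemma measurable_enorm : measurable_fun setT (@enorm R n).
Proof.
apply: measurableT_comp.
  by apply: continuous_measurable_fun; exact: sqrt_continuous.
exact: measurable_dot.
Qed.

Variables (a s : R) (f : Rn -> R[i]).
Hypotheses (a0 : 0 < a) (s0 : 0 < s) (sa : s < a / 2) (fs : sobolev s f).

Let h := fourier f.
Let y (xi : Rn) := enorm xi `^ a.
(** The exponent for which [y] to the power [sigma] is |xi|^(2s). *)
Let sigma := 2 * s / a.

Lemma sigma_gt0 : 0 < sigma.
Proof. by rewrite /sigma divr_gt0// mulr_gt0. Qed.

Lemma sigma_lt1 : sigma < 1.
Proof. rewrite /sigma ltr_pdivrMr// mul1r; move: sa; lra. Qed.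

Let f2 : L2 f. Proof. by apply/cLp2E; case: fs. Qed.
Let h2 : L2 h. Proof. exact: L2_fourier. Qed.
Let y0 xi : 0 <= y xi. Proof. exact: powR_ge0. Qed.

Lemma measurable_symbol : measurable_fun setT y.
Proof. exact: (measurableT_comp (measurable_powR a) measurable_enorm). Qed.
Let my := measurable_symbol.

Let g (t : R) (xi : Rn) := expi (t * y xi) * h xi.

Lemma L2_propagated t : L2 (g t).
Proof.
have mg : cmeas (g t).
  by apply: cmeasM; [apply: cmeas_expi; exact: measurable_funM|exact: h2.1].
split=> //; apply: le_lt_trans h2.2; apply: le_N2 => //; first exact: h2.1.
by move=> xi; rewrite nsqM nsq_expi mul1r.
Qed.

Let S t := schrodinger a t f.

Lemma L2_schrodinger t : L2 (S t).
Proof. by apply: L2_fourier_inv; exact: L2_propagated. Qed.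

Lemma schrodinger0 : {ae mu, forall x, S 0 x = f x}.
Proof.
have -> : S 0 = fourier_inv h.
  by congr fourier_inv; apply/funext => xi; rewrite mul0r expi0 mul1r.
exact: fourierK.
Qed.

(** |xi|^(2s) is at most (1 + |xi|^2)^s, the weight in the Sobolev norm. *)
Lemma sobolev_moment : exists M : R,
  (\int[mu]_xi (y xi `^ sigma * nsq (h xi))%:E <= M%:E)%E.
Proof.
have [_ +] := fs; rewrite /sobolev_norm => /lty_poweRy; rewrite invr_eq0 pnatr_eq0 => /(_ isT).
under eq_integral do rewrite normc_sqr.
set J := integral _ _ _ => Joo.
have J0 : (0 <= J)%E.
  by apply: integral_ge0 => xi _; rewrite lee_fin mulr_ge0 ?powR_ge0 ?nsq_ge0.
exists (fine J); rewrite fineK ?ge0_fin_numE//.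
have mn : measurable_fun setT (fun xi => nsq (h xi)) := measurable_nsq h2.1.
apply: ge0_le_integral => //.
- by move=> xi _; rewrite lee_fin mulr_ge0 ?powR_ge0 ?nsq_ge0.
- apply/measurable_EFinP; apply: measurable_funM => //.
  exact: (measurableT_comp (measurable_powR _) my).
- apply/measurable_EFinP; apply: measurable_funM => //.
  apply: (measurableT_comp (measurable_powR _)); apply: measurable_funD => //.
  by apply: measurable_funX; exact: measurable_enorm.
- move=> xi _; rewrite lee_fin ler_wpM2r ?nsq_ge0//.
  rewrite /y -powRrM (_ : a * sigma = 2 * s); last by rewrite /sigma; field; rewrite gt_eqF.
  rewrite powRrM powR_mulrn ?enorm_ge0//.
  apply: ge0_ler_powR; rewrite ?nnegrE ?addr_ge0 ?sqr_ge0 ?(ltW s0)//.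
  by rewrite lerDr.
Qed.

Variable A : R.
Hypothesis A0 : 0 < A.
Let q := rate sigma.
Let T := scale sigma A.
Let q0 : 0 < q. Proof. exact: rate_gt0. Qed.
Let q1 : q < 1. Proof. exact: rate_lt1 sigma_lt1. Qed.

(** Endpoints of the [p]-th difference at scale [k] of block [l]. The L^2 estimate sees only their
    distance, so the digit steps and the rounding of [t m] can be treated together. *)
Variables tau tau' : nat -> nat -> nat -> R.
Hypothesis tautau' : forall l k p, (k <= l)%N -> (p < 2 ^ k)%N ->
  `|tau l k p - tau' l k p| <= T l / 2 ^+ k.

Definition block_sum (l k : nat) (x : Rn) : R :=
  \sum_(0 <= p < 2 ^ k) nsq (S (tau l k p) x - S (tau' l k p) x).

(** [j = l - k] counts scales from the finest one, in agreement with the weights [q ^- (i - k)] of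
    [dyadic_chain]. *)
Definition level_sum (l : nat) (x : Rn) : R :=
  \sum_(0 <= j < l.+1) q ^- j * block_sum l (l - j) x.

Let cB t t' : cmeas (fun x => S t x - S t' x).
Proof. by apply: cmeasB; [exact: (L2_schrodinger t).1|exact: (L2_schrodinger t').1]. Qed.

Lemma block_sum_ge0 l k x : 0 <= block_sum l k x.
Proof. by apply: sumr_ge0 => *; exact: nsq_ge0. Qed.

Lemma measurable_block_sum l k : measurable_fun setT (block_sum l k).
Proof. by apply: measurable_sum => p; exact: measurable_nsq (cB _ _). Qed.

Lemma level_sum_ge0 l x : 0 <= level_sum l x.
Proof.
by apply: sumr_ge0 => j _; rewrite mulr_ge0 ?block_sum_ge0// invr_ge0 exprn_ge0// ltW.
Qed.

Lemma measurable_level_sum l : measurable_fun setT (level_sum l).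
Proof.
by apply: measurable_sum => j; apply: measurable_funM => //; exact: measurable_block_sum.
Qed.

Let mult l k xi := min1sq (T l / 2 ^+ k * y xi) * nsq (h xi).

Let mult0 l k xi : 0 <= mult l k xi.
Proof. by rewrite mulr_ge0 ?nsq_ge0 ?min1sq_ge0. Qed.

Let mmult l k : measurable_fun setT (mult l k).
Proof.
apply: measurable_funM; last exact: measurable_nsq h2.1.
rewrite /min1sq; apply: measurable_minr => //.
by apply: measurable_funX; exact: measurable_funM.
Qed.

Lemma T_ge0 l : 0 <= T l.
Proof. by rewrite /T /scale !mulr_ge0 ?powR_ge0 ?exprn_ge0// ltW. Qed.

Lemma N2_schrodinger_le : exists2 C : R, 0 <= C & forall l k p, (k <= l)%N -> (p < 2 ^ k)%N ->
  (N2 mu (fun x => S (tau l k p) x - S (tau' l k p) x)%R <= C%:E * \int[mu]_xi (mult l k xi)%:E)%E.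
Proof.
have [C C0 CV] := fourier_inv_le R n.
exists (C * 4); first by rewrite mulr_ge0.
move=> l k p kl pk.
apply: le_trans (CV _ _ (L2_propagated _) (L2_propagated _)) _.
rewrite (EFinM C 4) -muleA; apply: lee_wpmul2l; first by rewrite lee_fin.
rewrite -ge0_integralZl_EFin//; last 2 first.
- by move=> xi _; rewrite lee_fin.
- by apply/measurable_EFinP.
apply: ge0_le_integral => //.
- by move=> xi _; rewrite lee_fin nsq_ge0.
- apply/measurable_EFinP; apply: measurable_nsq; apply: cmeasB.
  + exact: (L2_propagated _).1.
  + exact: (L2_propagated _).1.
- by apply/measurable_EFinP; exact: measurable_funM.
- move=> xi _; rewrite -EFinM lee_fin /g -mulrBl nsqM /mult mulrA.
  rewrite ler_wpM2r ?nsq_ge0//; apply: le_trans (nsq_expiB_le _ _) _.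
  rewrite ler_pM2l//; apply: le_min1sq.
  have X0 : 0 <= T l / 2 ^+ k * y xi by rewrite mulr_ge0// divr_ge0 ?exprn_ge0 ?T_ge0.
  rewrite (ger0_norm X0) -mulrBl normrM (ger0_norm (y0 xi)) ler_wpM2r//.
  exact: tautau'.
Qed.

(** All 2^(l-j) differences at scale [l - j] obey the same multiplier bound. Summing over the blocks
    before integrating gives |h|^2 times the double sum of [dyadic_multiplier_sum], so the total is
    at most [D] times the Sobolev moment, however many blocks are taken. *)
Lemma level_sum_cvg0 : {ae mu, forall x, level_sum l x @[l --> \oo] --> (0 : R)}.
Proof.
have [C C0 CN] := N2_schrodinger_le.
have [M hM] := sobolev_moment.
pose D := C * (4 * A `^ sigma * (1 - q)^-1).
have D0 : 0 <= D.
  by rewrite !mulr_ge0 ?powR_ge0// invr_ge0 subr_ge0 ltW.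
apply: (@ae_cvg0_summable _ _ _ mu _ (D * M)).
- exact: measurable_level_sum.
- exact: level_sum_ge0.
move=> L.
pose c l j : R := C * (q ^- j * 2 ^+ (l - j)).
have c0 l j : 0 <= c l j by rewrite !mulr_ge0 ?invr_ge0 ?exprn_ge0// ltW.
have qj0 j : 0 <= q ^- j by rewrite invr_ge0 exprn_ge0// ltW.
have step l : (\int[mu]_x (level_sum l x)%:E <=
    \int[mu]_xi (\sum_(0 <= j < l.+1) c l j * mult l (l - j) xi)%:E)%E.
  rewrite (@ge0_integral_wsum _ _ mu _ _ (fun j => q ^- j) (fun j => block_sum l (l - j)) qj0
    (fun j => block_sum_ge0 l (l - j)) (fun j => measurable_block_sum l (l - j))).
  rewrite (@ge0_integral_wsum _ _ mu _ _ (c l) (fun j => mult l (l - j)) (c0 l)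
    (fun j => mult0 l (l - j)) (fun j => mmult l (l - j))).
  apply: lee_sum => j _.
  rewrite /c mulrCA EFinM -muleA; apply: lee_wpmul2l; first by rewrite lee_fin.
  rewrite /block_sum.
  under eq_integral do under eq_bigr do rewrite -[nsq _]mul1r.
  rewrite (@ge0_integral_wsum _ _ mu _ _ (fun=> 1) (fun p x => nsq (S (tau l (l - j) p) x - S (tau' l (l - j) p) x)))//.
  - apply: (@le_trans _ _ (\sum_(0 <= p < 2 ^ (l - j)) (C%:E * \int[mu]_xi (mult l (l - j) xi)%:E))%E).
      rewrite big_nat [leRHS]big_nat; apply: lee_sum => p /andP[_ pj].
      by rewrite mul1e; apply: CN => //; exact: leq_subr.
    rewrite sume_const_nat; last by rewrite mule_ge0// integral_ge0// => xi _; rewrite lee_fin.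
    by rewrite natrX muleA -EFinM mulrC.
  - by move=> p x; exact: nsq_ge0.
  - by move=> p; exact: measurable_nsq (cB _ _).
have cm0 l xi : 0 <= \sum_(0 <= j < l.+1) c l j * mult l (l - j) xi.
  by apply: sumr_ge0 => j _; rewrite mulr_ge0.
have mcm l : measurable_fun setT (fun xi => \sum_(0 <= j < l.+1) c l j * mult l (l - j) xi).
  by apply: measurable_sum => j; exact: measurable_funM.
apply: (@le_trans _ _ (\int[mu]_xi (D * (y xi `^ sigma * nsq (h xi)))%:E)%E); last first.
  under eq_integral do rewrite EFinM.
  rewrite ge0_integralZl_EFin//; first by rewrite (EFinM D M) lee_wpmul2l.
  - by move=> xi _; rewrite lee_fin mulr_ge0 ?powR_ge0 ?nsq_ge0.
  - apply/measurable_EFinP; apply: measurable_funM; last exact: measurable_nsq h2.1.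
    exact: (measurableT_comp (measurable_powR _) my).
apply: (@le_trans _ _ (\sum_(0 <= l < L) 1%:E *
    \int[mu]_xi (\sum_(0 <= j < l.+1) c l j * mult l (l - j) xi)%:E)%E).
  by apply: lee_sum => l _; rewrite mul1e; exact: step.
rewrite -(@ge0_integral_wsum _ _ mu _ _ (fun=> 1)
  (fun l xi => \sum_(0 <= j < l.+1) c l j * mult l (l - j) xi))//.
apply: ge0_le_integral => //.
- by move=> xi _; rewrite lee_fin; apply: sumr_ge0 => l _; rewrite mul1r.
- by apply/measurable_EFinP; apply: measurable_sum => l; exact: measurable_funM.
- apply/measurable_EFinP; apply: measurable_funM => //.
  apply: measurable_funM; last exact: measurable_nsq h2.1.
  exact: (measurableT_comp (measurable_powR _) my).
- move=> xi _; rewrite lee_fin.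
  have E : \sum_(0 <= l < L) 1 * (\sum_(0 <= j < l.+1) c l j * mult l (l - j) xi) =
    C * (\sum_(0 <= l < L) \sum_(0 <= j < l.+1)
      q ^- j * (2 ^+ (l - j) * min1sq (T l / 2 ^+ (l - j) * y xi))) * nsq (h xi).
    rewrite mulr_sumr mulr_suml; apply: eq_bigr => l _; rewrite mul1r.
    rewrite mulr_sumr mulr_suml; apply: eq_bigr => j _; rewrite /c /mult; ring.
  rewrite E mulrA ler_wpM2r ?nsq_ge0// /D -mulrA ler_wpM2l//.
  have := dyadic_multiplier_sum sigma_gt0 sigma_lt1 A0 L (y0 xi).
  rewrite powRM ?(ltW A0)// => /le_trans; apply.
  by rewrite le_eqVlt; apply/orP; left; apply/eqP; rewrite -/q; ring.
Qed.

End maximal_sum.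

(** * Decay of the times from the weak-type hypothesis *)

Section weak_sequence.
Context {R : realType}.

Lemma counting_initial_segment (m : nat) : (counting `I_m = m%:R%:E :> \bar R)%E.
Proof.
rewrite /counting asboolT; last exact: finite_II.
by rewrite (@card_fset_set _ _ m).
Qed.

(** By monotonicity the first [m.+1] times all exceed half of [t m], so the counting bound at that
    level gives t_m <= 2 C^(1/r) (m+1)^(-1/r). The identity 1/r = 1/sigma - 1 then turns 2^(-l/r)
    into the form of [scale]. *)
Lemma weak_l_lt_scale (a s : R) (t : nat -> R) : 0 < a -> 0 < s -> s < a / 2 ->
  (forall m, 0 < t m) -> (forall m, t m.+1 < t m) ->
  weak_l (2 * s / (a - 2 * s)) t ->
  exists2 A, 0 < A & forall l m, (2 ^ l <= m.+1)%N -> t m < scale (2 * s / a) A l.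
Proof.
move=> a0 s0 sa t0 tdec [C hC].
set r := 2 * s / (a - 2 * s) in hC.
have r0 : 0 < r by rewrite divr_gt0 ?mulr_gt0//; lra.
have as0 : a - 2 * s != 0 by rewrite gt_eqF//; lra.
have tle i j : (i <= j)%N -> t j <= t i.
  elim: j => [|j ih]; first by rewrite leqn0 => /eqP ->.
  rewrite leq_eqVlt => /predU1P[-> //|]; rewrite ltnS => /ih.
  by apply: le_trans; exact: ltW.
have key m : m.+1%:R <= C * (t m / 2) `^ (- r).
  have b0 : 0 < t m / 2 by rewrite divr_gt0.
  rewrite -lee_fin -counting_initial_segment; apply: le_trans (hC _ b0).
  apply: le_measure; rewrite ?inE//.
  by move=> j /= jm; rewrite (lt_le_trans _ (tle j m jm))//; have := t0 m; lra.
have C0 : 0 < C.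
  have := lt_le_trans (ltr0Sn R 0) (key 0%N).
  by rewrite pmulr_lgt0// powR_gt0// divr_gt0.
(* The added 1 makes the final inequality strict. *)
pose A := 2 * C `^ r^-1 + 1.
have C'0 : 0 <= C `^ r^-1 by exact: powR_ge0.
exists A; first by rewrite /A; lra.
move=> l m lm; set u := t m / 2.
have u0 : 0 < u by rewrite divr_gt0.
have p0 : 0 < 2 ^- l :> R by rewrite invr_gt0 exprn_gt0.
have ur : u `^ r <= C * 2 ^- l.
  rewrite ler_pdivlMr ?exprn_gt0// mulrC -ler_pdivlMr ?powR_gt0// -powRN.
  by apply: le_trans (key m); rewrite -natrX ler_nat.
have uC : u <= C `^ r^-1 * (2 ^- l) `^ r^-1.
  rewrite -powRM ?(ltW C0) ?(ltW p0)//.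
  have -> : u = (u `^ r) `^ r^-1 by rewrite -powRrM mulfV ?gt_eqF// powRr1// ltW.
  have Cl0 : 0 <= C * 2 ^- l by rewrite mulr_ge0 ?ltW.
  by apply: ge0_ler_powR => //; rewrite ?nnegrE ?powR_ge0// invr_ge0 ltW.
have rE : r^-1 = (2 * s / a)^-1 - 1.
  by rewrite /r; field; rewrite as0 !gt_eqF.
have pE : (2 ^- l) `^ r^-1 = (2 ^- l) `^ (2 * s / a)^-1 * 2 ^+ l :> R.
  rewrite rE powRB; last by rewrite (gt_eqF p0) implybT.
  by rewrite powRr1 ?(ltW p0)// invrK.
rewrite pE in uC; rewrite /scale -mulrA; set w := _ * 2 ^+ l in uC *.
have w0 : 0 < w by rewrite mulr_gt0 ?exprn_gt0// powR_gt0.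
have tu : t m = 2 * u by rewrite /u; field.
have -> : A * w = 2 * (C `^ r^-1 * w) + w by rewrite /A; ring.
by rewrite tu; lra.
Qed.

End weak_sequence.

(** * Pointwise convergence *)

Section convergence.
Context (R : realType) (n : nat) (a s : R) (t : nat -> R).
Local Notation Rn := (n.-tuple R).
Local Notation mu := (@lebesgue_Rn R n).

Lemma schrodinger_cvg_ae (f : Rn -> R[i]) : 0 < a -> 0 < s -> s < a / 2 ->
  (forall m, 0 < t m) -> (forall m, t m.+1 < t m) ->
  weak_l (2 * s / (a - 2 * s)) t -> sobolev s f ->
  {ae mu, forall x : Rn,
    schrodinger a (t m) f x @[m --> \oo] --> (f x : R[i]^o)}.
Proof.
move=> a0 s0 sa t0 tdec tw fs.
have [A A0 tT] := weak_l_lt_scale a0 s0 sa t0 tdec tw.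
pose sg := 2 * s / a.
pose T := scale sg A.
have T0 l : 0 < T l by rewrite /T /scale !mulr_gt0 ?powR_gt0 ?invr_gt0 ?exprn_gt0.
(* The predecessor accounts for the indexing from 0: block [l] consists of the [m] with
   [m.+1 = 2 ^ l + p] and [p < 2 ^ l]. *)
pose last_tau l p := t (2 ^ l + p).-1.
(* Scales [k < l] carry the digit steps of [dyadic_chain]; the scale [k = l] is reserved for the
   step from a time of the block to the dyadic multiple of [T l] just below it. *)
pose tau l k p : R := if (k < l)%N then (2 * p + 1)%:R / 2 ^+ k.+1 * T l else last_tau l p.
pose tau' l k p : R := if (k < l)%N then p%:R / 2 ^+ k * T l
  else (Num.truncn (last_tau l p / T l * 2 ^+ l))%:R / 2 ^+ l * T l.
have e0 k : 0 < 2 ^+ k :> R by rewrite exprn_gt0.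
have tT' l p : last_tau l p < T l.
  apply: tT; rewrite prednK ?leq_addr// addn_gt0 expn_gt0.
  by [].
(* A digit step at scale [k] has length half of [T l / 2 ^+ k], and rounding down at scale [l] loses
   at most [T l / 2 ^+ l]. *)
have tau_le l k p : (k <= l)%N -> (p < 2 ^ k)%N -> `|tau l k p - tau' l k p| <= T l / 2 ^+ k.
  move=> kl pk; rewrite /tau /tau'; case: ltnP => [_|lk].
    rewrite (_ : _ - _ = T l / 2 ^+ k / 2); last first.
      by rewrite natrD natrM exprS; field; rewrite gt_eqF.
    have h : 0 <= T l / 2 ^+ k by rewrite divr_ge0// ltW.
    by rewrite ger0_norm; lra.
  have -> : k = l by apply/eqP; rewrite eqn_leq kl lk.
  set v := last_tau l p / T l * 2 ^+ l.
  have v0 : 0 <= v by rewrite mulr_ge0 ?(ltW (e0 _))// divr_ge0 ?(ltW (T0 _))// ltW// t0.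
  have vE : last_tau l p = v / 2 ^+ l * T l by rewrite /v; field; rewrite !gt_eqF.
  have /andP[v1 v2] := truncn_itv v0.
  rewrite vE -mulrBl -mulrBl -mulrA [_^-1 * _]mulrC normrM.
  rewrite (@ger0_norm _ (T l / _)) ?divr_ge0 ?(ltW (T0 _)) ?(ltW (e0 _))//.
  rewrite ler_piMl ?divr_ge0 ?(ltW (T0 _)) ?(ltW (e0 _))//.
  by rewrite ger0_norm ?subr_ge0// lerBlDl -natr1 in v2 *; rewrite ltW.
have := level_sum_cvg0 a0 s0 sa fs A0 tau_le.
apply: filterS2 (schrodinger0 a fs) => x f0 lev.
apply: cvg_nsq; rewrite -f0.
pose q := rate sg.
have q0 : 0 < q := rate_gt0 sg.
have q1 : q < 1 := rate_lt1 (sigma_lt1 a0 sa).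
pose F (r : R) := schrodinger a r f x.
have bound m : nsq (F (t m) - F 0) <=
    2 * (1 - q)^-1 * level_sum a s f tau tau' (trunc_log 2 m.+1) x.
  set l := trunc_log 2 m.+1.
  have lm : (2 ^ l <= m.+1)%N by apply: trunc_logP.
  have ml : (m.+1 < 2 ^ l.+1)%N by apply: trunc_log_ltn.
  pose p := (m.+1 - 2 ^ l)%N.
  have pl : (p < 2 ^ l)%N by rewrite /p; move: ml; rewrite expnS; lia.
  have tm : t m = tau l l p by rewrite /tau ltnn /last_tau /p subnKC.
  pose p' := Num.truncn (last_tau l p / T l * 2 ^+ l).
  (* The strict inequality [t m < T l] keeps the rounded numerator below [2 ^ l], as [dyadic_chain]
     requires. *)
  have p'l : (p' < 2 ^ l)%N.
    have v0 : 0 <= last_tau l p / T l * 2 ^+ l.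
      by rewrite mulr_ge0 ?(ltW (e0 _))// divr_ge0 ?(ltW (T0 _))// ltW// t0.
    rewrite -(ltr_nat R) natrX; have /andP[v1 _] := truncn_itv v0.
    by apply: le_lt_trans v1 _; rewrite gtr_pMl// ltr_pdivrMr// mul1r.
  have t'm : tau' l l p = p'%:R / 2 ^+ l * T l by rewrite /tau' ltnn.
  pose B k := block_sum a f tau tau' l k x.
  have B0 k : 0 <= B k by exact: block_sum_ge0.
  have hE : nsq (F (t m) - F (p'%:R / 2 ^+ l * T l)) <= B l.
    rewrite tm -t'm /B /block_sum (big_cat_nat (n := p))//=; last exact: ltnW.
    rewrite [X in _ <= _ + X]big_ltn// addrCA lerDl addr_ge0//; apply: sumr_ge0 => *; exact: nsq_ge0.
  have := dyadic_chain F (T l) q0 q1 p'l.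
  set W := \sum_(0 <= k < l) _ => hW.
  have WE : W = \sum_(0 <= k < l) q ^- (l - k) * B k.
    rewrite /W big_nat [RHS]big_nat; apply: eq_bigr => k /andP[_ kl]; congr (_ * _).
    by rewrite /B /block_sum; apply: eq_bigr => i _; rewrite /tau /tau' kl.
  (* Reversing the order of summation separates the rounding scale, of weight 1, from the weighted
     digit steps. *)
  have lE : level_sum a s f tau tau' l x = W + B l.
    rewrite /level_sum -/q big_nat_rev/= big_nat.
    rewrite (eq_bigr (fun k => q ^- (l - k) * B k)); last first.
      by move=> k /andP[_ kl]; rewrite add0n subSS /B; congr (_ * block_sum _ _ _ _ _ _ _); rewrite subKn.
    by rewrite -big_nat big_nat_recr//= subnn expr0 invr1 mul1r WE.
  (* One triangle inequality joins the rounding to the walk to 0; it is the source of the factor 2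
     in [bound]. *)
  have tri := nsqB_tri (F (t m)) (F (p'%:R / 2 ^+ l * T l)) (F 0).
  have iq : 1 <= (1 - q)^-1 by rewrite invf_ge1 ?subr_gt0// gerBl ltW.
  rewrite lE mulrDr.
  have hB : B l <= (1 - q)^-1 * B l by rewrite ler_peMl.
  rewrite -!mulrA; lra.
apply: (squeeze_cvgr (f := fun=> 0)
  (h := fun m => 2 * (1 - q)^-1 * level_sum a s f tau tau' (trunc_log 2 m.+1) x)).
- by apply: nearW => m; rewrite nsq_ge0/=; exact: bound.
- exact: cvg_cst.
- rewrite -[X in _ --> X](mulr0 (2 * (1 - q)^-1)); apply: cvgM; first exact: cvg_cst.
  apply: (cvg_comp (fun m => trunc_log 2 m.+1) (fun l => level_sum a s f tau tau' l x) _ lev).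
  apply/cvgnyPge => N; exists (2 ^ N)%N => // m /= Nm.
  by apply: trunc_log_max => //; apply: leq_trans Nm _.
Qed.

End convergence.

Theorem theorem4 (R : realType) (n : nat) (a s : R) (t : nat -> R)
    (n_ge2 : (2 <= n)%N) (a_gt0 : 0 < a) (a_neq1 : a <> 1)
    (s_gt0 : 0 < s) (s_lt : s < a / 2)
    (t_lt1 : t 0%N < 1) (t_gt0 : forall m, 0 < t m)
    (t_decr : forall m, t m.+1 < t m)
    (t_cvg0 : t m @[m --> \oo] --> (0 : R))
    (t_weak : weak_l (2 * s / (a - 2 * s)) t)
    (f : n.-tuple R -> R[i]) (f_Hs : sobolev s f) :
  {ae @lebesgue_Rn R n, forall x : n.-tuple R,
    schrodinger a (t m) f x @[m --> \oo] --> (f x : R[i]^o)}.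
Proof. exact: (schrodinger_cvg_ae a_gt0 s_gt0 s_lt t_gt0 t_decr t_weak f_Hs). Qed.
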